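(* Let $n\geq 2$, let $f\in(\mathcal{E}'(\mathbb{R}^n))^n$ be a compactly supported covector-valued distribution, and let $V\subset\mathbb{R}^n$ be a nonempty open set. Assume that $\mathrm{d}f|_V=0$. Then $X_1f$ vanishes on all lines intersecting $V$ if and only if $f=\mathrm{d}\phi$ for some $\phi\in\mathcal{E}'(\mathbb{R}^n)$.
   Context: $\mathcal{E}'(\mathbb{R}^n)$ is the space of compactly supported distributions on $\mathbb{R}^n$. $f\in(\mathcal{E}'(\mathbb{R}^n))^n$ means $f=(f_1,\dots,f_n)$ with each $f_i\in\mathcal{E}'(\mathbb{R}^n)$, with pairing $\langle f,\varphi\rangle=\sum_i\langle f_i,\varphi_i\rangle$. One-forms are identified with vector fields. The exterior derivative of $f$ is given, in the sense of distributions, by $(\mathrm{d}f)_{ij}=\partial_i f_j-\partial_j f_i$. For a scalar distribution $\phi$, $\mathrm{d}\phi=(\partial_1\phi,\dots,\partial_n\phi)$. $\mathrm{d}f|_V=0$ means that all components $(\mathrm{d}f)_{ij}$ vanish as distributions on $V$. Let $\Gamma=\{(z,\theta):\theta\in S^{n-1},\ z\in\theta^\perp\}$ be the manifold of oriented lines, where $(z,\theta)$ represents $t\mapsto z+t\theta$, with measure $dz\,d\theta$. The X-ray transform of a smooth compactly supported one-form $f$ is $X_1f(z,\theta)=\int_{\mathbb{R}}f(z+t\theta)\cdot\theta\,dt$, and its adjoint, acting on $\psi\in C^\infty(\Gamma)$, is $(X_1^*\psi)_i(x)=\int_{S^{n-1}}\theta_i\,\psi(x-(x\cdot\theta)\theta,\theta)\,d\theta$.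 For $f\in(\mathcal{E}'(\mathbb{R}^n))^n$, $X_1f\in\mathcal{E}'(\Gamma)$ is defined by $\langle X_1f,\varphi\rangle=\langle f,X_1^*\varphi\rangle$ for $\varphi\in C^\infty(\Gamma)$. ''$X_1f$ vanishes on all lines intersecting $V$'' means that the distribution $X_1f$ vanishes on the open subset of $\Gamma$ consisting of the lines that meet $V$, i.e. $\langle X_1f,\varphi\rangle=0$ for every $\varphi\in C_c^\infty(\Gamma)$ supported in that open subset. *)

(* Defs.v *)
From HB Require Import structures.
From mathcomp Require Import all_boot all_order all_algebra.
From mathcomp Require Import all_classical all_reals all_analysis.

Set Implicit Arguments.
Unset Strict Implicit.
Unset Printing Implicit Defensive.

Import Order.TTheory GRing.Theory Num.Theory.
Import numFieldNormedType.Exports.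

Local Open Scope classical_set_scope.
Local Open Scope ring_scope.

(* Lebesgue measure on R^n, carried by n-tuples (which have the product
   sigma-algebra), as an iterated product measure. *)
Section tuple_lebesgue.
Context (R : realType).
Local Notation Rm := (measurableTypeR R).

Definition cons_pair n (p : Rm * n.-tuple Rm) : n.+1.-tuple Rm :=
  [the n.+1.-tuple Rm of p.1 :: p.2].

Definition uncons_pair n (t : n.+1.-tuple Rm) : Rm * n.-tuple Rm :=
  (thead t, [tuple of behead t]).

Lemma measurable_cons_pair n : measurable_fun setT (@cons_pair n).
Proof. exact: measurable_cons. Qed.

HB.instance Definition _ n :=
  isMeasurableFun.Build _ _ _ _ (@cons_pair n) (@measurable_cons_pair n).

Lemma measurable_uncons_pair n : measurable_fun setT (@uncons_pair n).
Proof.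
by apply/measurable_fun_pairP; split; [exact: measurable_tnth|
  exact: measurable_behead].
Qed.

Lemma cons_pairK n : cancel (@cons_pair n) (@uncons_pair n).
Proof. by move=> [x t]; congr pair; exact/val_inj. Qed.

Section cons_measure.
Context n (mu : {sigma_finite_measure set (n.-tuple Rm) -> \bar R}).

Definition cons_measure : set (n.+1.-tuple Rm) -> \bar R :=
  pushforward (@lebesgue_measure R \x mu)%E (@cons_pair n).

Let cons_measure0 : cons_measure set0 = 0%E.
Proof. by rewrite /cons_measure /pushforward preimage_set0 measure0. Qed.

Let cons_measure_ge0 A : (0 <= cons_measure A)%E.
Proof. by rewrite /cons_measure /pushforward measure_ge0. Qed.

Let cons_measure_sigma_additive : semi_sigma_additive cons_measure.
Proof.
exact: (@measure_semi_sigma_additive _ _ _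
  (pushforward (@lebesgue_measure R \x mu)%E (@cons_pair n))).
Qed.

HB.instance Definition _ := isMeasure.Build _ _ _ cons_measure
  cons_measure0 cons_measure_ge0 cons_measure_sigma_additive.

Let cons_measure_sigma_finite : sigma_finite setT cons_measure.
Proof.
have /sigma_finiteP[F [FT Fnd Foo]] := sigma_finiteT (@lebesgue_measure R).
have /sigma_finiteP[G [GT Gnd Goo]] := sigma_finiteT mu.
exists (fun k => @uncons_pair n @^-1` (F k `*` G k)).
  apply/esym/seteqP; split=> // t _.
  have : (\bigcup_k F k) (uncons_pair t).1 by rewrite -FT.
  have : (\bigcup_k G k) (uncons_pair t).2 by rewrite -GT.
  move=> [j _ Gj] [i _ Fi]; exists (maxn i j) => //; split.
    by move: Fi; exact/subsetPset/Fnd/leq_maxl.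
  by move: Gj; exact/subsetPset/Gnd/leq_maxr.
move=> k; have [mF Fk] := Foo k; have [mG Gk] := Goo k; split.
  rewrite -[X in measurable X]setTI.
  by apply: measurable_uncons_pair => //; exact: measurableX.
rewrite /cons_measure /pushforward -comp_preimage.
rewrite (_ : _ \o _ = id); last by apply/funext => p /=; rewrite cons_pairK.
by rewrite preimage_id product_measure1E// lte_mul_pinfty// ge0_fin_numE.
Qed.

HB.instance Definition _ := Measure_isSigmaFinite.Build _ _ _ cons_measure
  cons_measure_sigma_finite.

End cons_measure.

Fixpoint tuple_lebesgue n : {sigma_finite_measure set (n.-tuple Rm) -> \bar R} :=
  match n with
  | 0 => @dirac _ _ [tuple] R
  | m.+1 => cons_measure (tuple_lebesgue m)
  end.

End tuple_lebesgue.

Section smooth_functions.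
Context (R : realType) (E : normedModType R).
Implicit Types (f : E -> R) (U : set E).

Definition iter_derive (s : seq E) f : E -> R :=
  foldr (fun v g => fun x => 'D_v g x) f s.

(* C^oo on an open set U: every iterated directional derivative exists and is
   (Frechet) differentiable on U. *)
Definition smooth_on U f :=
  forall (s : seq E) (x : E), U x -> differentiable (iter_derive s f) x.

Definition smooth f := smooth_on setT f.

(* Smooth function on an embedded submanifold M of E: locally the restriction
   of a smooth function on an open subset of E.  Values off M are irrelevant. *)
Definition smooth_on_submanifold (M : set E) f :=
  forall p, M p -> exists (U : set E) (g : E -> R),
    [/\ open U, U p, smooth_on U g & {in M `&` U, f =1 g}].

(* The support of f|_M when M is closed. *)
Definition support_on (M : set E) f : set E :=
  closure (M `&` [set x | f x != 0]).

End smooth_functions.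

Section distributions.
Context (R : realType) (n : nat).
Local Notation Rn := 'rV[R]_n.

Definition basis (i : 'I_n) : Rn := delta_mx 0 i.

Definition partial (i : 'I_n) (phi : Rn -> R) : Rn -> R :=
  fun x => 'D_(basis i) phi x.

(* The sequence s plays the role of a multi-index of order size s. *)
Definition seminorm (K : set Rn) (N : nat) (phi : Rn -> R) : R :=
  sup [set r | exists (s : seq 'I_n) (x : Rn),
    [/\ (size s <= N)%N, K x & r = `|iter_derive (map basis s) phi x|]].

(* E'(R^n) is the dual of the Frechet space C^oo(R^n).  A distribution is
   encoded by a functional on all functions R^n -> R, of which only the values
   on smooth functions are meaningful; see [eq_distr]. *)
Record cs_distribution := CSDistribution {
  distr_fun :> (Rn -> R) -> R;
  distr_linear : forall (a : R) (phi psi : Rn -> R), smooth phi -> smooth psi ->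
    distr_fun (fun x => a * phi x + psi x) = a * distr_fun phi + distr_fun psi;
  distr_continuous : exists (K : set Rn) (N : nat) (C : R), compact K /\
    forall phi, smooth phi -> `|distr_fun phi| <= C * seminorm K N phi
}.

Definition eq_distr (S T : (Rn -> R) -> R) :=
  forall phi, smooth phi -> S phi = T phi.

Definition distr_partial (i : 'I_n) (T : (Rn -> R) -> R) : (Rn -> R) -> R :=
  fun phi => - T (partial i phi).

Definition vanishes_on (V : set Rn) (T : (Rn -> R) -> R) :=
  forall phi, smooth phi -> compact (support_on setT phi) ->
    support_on setT phi `<=` V -> T phi = 0.

Definition exterior_derivative (f : 'I_n -> cs_distribution) (i j : 'I_n) :
    (Rn -> R) -> R :=
  fun phi => distr_partial i (f j) phi - distr_partial j (f i) phi.

Definition is_differential (f : 'I_n -> cs_distribution) (u : cs_distribution) :=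
  forall i, eq_distr (f i) (distr_partial i u).

Definition pairing (f : 'I_n -> cs_distribution) (phi : 'I_n -> Rn -> R) : R :=
  \sum_i f i (phi i).

End distributions.

Section xray.
Context (R : realType) (n : nat).
Local Notation Rn := 'rV[R]_n.

Definition dot (x y : Rn) : R := \sum_i x 0 i * y 0 i.

(* The norm `|x| of the library on 'rV[R]_n is the sup norm. *)
Definition enorm (x : Rn) : R := Num.sqrt (dot x x).

Definition row_of_tuple (t : n.-tuple (measurableTypeR R)) : Rn :=
  \row_i tnth t i.

(* Integral over S^(n-1) for the surface measure
     sigma(A) = n * Leb {r *: theta | 0 < r <= 1, theta in A},
   i.e. the one for which integration in polar coordinates holds. *)
Definition sphere_integral (g : Rn -> R) : R :=
  n%:R * \int[tuple_lebesgue R n]_(t in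
            [set t | 0 < enorm (row_of_tuple t) <= 1])
    g ((enorm (row_of_tuple t))^-1 *: row_of_tuple t).

(* Oriented lines (z, theta), i.e. t |-> z + t theta *)
Definition lines : set (Rn * Rn) :=
  [set p | enorm p.2 = 1 /\ dot p.1 p.2 = 0].

Definition lines_meeting (V : set Rn) : set (Rn * Rn) :=
  lines `&` [set p | exists t : R, V (p.1 + t *: p.2)].

Definition xray_adjoint (psi : Rn * Rn -> R) (i : 'I_n) (x : Rn) : R :=
  sphere_integral
    (fun theta => theta 0 i * psi (x - dot x theta *: theta, theta)).

Definition xray (f : 'I_n -> cs_distribution R n) (psi : Rn * Rn -> R) : R :=
  pairing f (xray_adjoint psi).

Definition xray_vanishes_on_lines_meeting
    (f : 'I_n -> cs_distribution R n) (V : set Rn) :=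
  forall psi, smooth_on_submanifold lines psi ->
    compact (support_on lines psi) ->
    support_on lines psi `<=` lines_meeting V ->
    xray f psi = 0.

End xray.

(* Main.v *)
From HB Require Import structures.
Require Import Defs.
From mathcomp Require Import all_boot all_order all_algebra.
From mathcomp Require Import all_classical all_reals all_analysis.
From mathcomp Require Import measurable_realfun.
From mathcomp Require Import ring lra.

(** Write T_ij for the functional h |-> f_i(partial_j h) - f_j(partial_i h), a
    component of the exterior derivative of f.

    A differential f = du is invisible to the X-ray transform because the
    adjoint transform is divergence free: the integrand theta psi(line) of
    X^* psi is constant along theta, the direction by which it is weighted.
    Hence f(X^* psi) = - u(div X^* psi) = 0 ([xray_of_differential]).

    Conversely, a compactly supported f with T_ij = 0 on all of R^n is the
    differential of a compactly supported distribution ([closed_exact]; this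
    needs two distinct coordinates).  It therefore suffices to propagate
    T_ij = 0 from V to R^n, by a unique continuation argument in three steps.

    - Test the hypothesis on weights that concentrate at a single direction
      theta.  In the limit, theta . f vanishes on every smooth function that is
      constant along theta and supported in a thin tube around a line through V
      ([ridge_vanish]).  Consequently, for u and w spanning a plane, the
      functional S = sum_ij u_i w_j T_ij kills such functions for every
      direction theta of that plane ([curl_kills_plane_ridges]).

    - Fix q in V and average S against the translates of a test function eta
      with small support: g(x) = S(eta(. - x)) is smooth, vanishes near q
      because df = 0 there, vanishes far away, and by the first step has zero
      integral over the lines of the plane through q ([moll_line_integral]).
      The same holds for the derivatives of g, which have the same form.  Put
      I_k(x) = int t^-k g(q + t x) dt over the real line, k = 0, 1, 2 and so
      on.  Then I_0 = 0; I_1 has derivative I_0 (of a derivative of g) = 0, so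
      it is constant on a path from x to -x in the plane, and it is odd, so
      I_1 = 0; an integration by parts reduces the next exponents to the
      previous ones.  As all moments in 1/t vanish, g vanishes on the line
      ([moments_determine], [moll_plane]).

    - So sum_ij (x - q)_i w_j T_ij(eta(. - x)) = 0 for all x, w and all q in V.
      As q varies in an open set, each T_ij(eta(. - x)) is zero
      ([curl_moll_eq0]), and a partition of unity removes the restriction on
      supports ([vanish_of_small]). *)

Set Implicit Arguments.
Unset Strict Implicit.
Unset Printing Implicit Defensive.

Import Order.TTheory GRing.Theory Num.Theory.
Import numFieldNormedType.Exports.

Local Open Scope classical_set_scope.
Local Open Scope ring_scope.

(* The short name is also that of a notion of topology. *)
Local Notation basis := Defs.basis.


(** * Differentiability in terms of explicit estimates *)

Section differentiability.
Context (R : realType) (E F : normedModType R).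
Implicit Types (f g : E -> F).

(** Increments h centred at 0 are the form in which the remainder estimates below are written. *)
Lemma nbhs_shiftP (x : E) (P : set E) :
  nbhs x P <-> exists2 r : R, 0 < r & forall h, `|h| < r -> P (h + x).
Proof.
split=> [/nbhs_ballP[r /= r0 rP]|[r r0 rP]].
  exists r => // h hr; apply: rP; rewrite -ball_normE /ball_/=.
  by rewrite opprD addrCA subrr addr0 normrN.
apply/nbhs_ballP; exists r => //= y; rewrite -ball_normE /ball_/= => xy.
by rewrite -(subrK x y); apply: rP; rewrite distrC.
Qed.

(** Differentiability is defined through little-o notation; here and in
    [differentiable_near] it is exchanged for an explicit estimate. *)
Lemma differentiable_at (df : {linear E -> F}) f (x : E) : continuous df ->
  (forall e : R, 0 < e -> exists2 r : R, 0 < r & forall h, `|h| < r ->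
     `|f (h + x) - f x - df h| <= e * `|h|) ->
  differentiable f x /\ 'd f x = df :> (E -> F).
Proof.
move=> cdf fdf.
have dxf : f \o shift x = cst (f x) + df +o_ 0 id.
  apply: eqaddoE; apply/eqaddoP => /= e e0.
  have [r r0 rP] := fdf e e0; apply/nbhs_shiftP; exists r => // h /rP.
  by rewrite addr0 !fctE/= /cst opprD addrA.
have dE : 'd f x = df :> (E -> F) by apply: diff_unique.
split=> //; apply/diff_locallyP; split; first by rewrite dE.
by rewrite dE.
Qed.

Lemma differentiable_near f (x : E) : differentiable f x ->
  forall e : R, 0 < e -> exists2 r : R, 0 < r & forall h, `|h| < r ->
     `|f (h + x) - f x - 'd f x h| <= e * `|h|.
Proof.
move=> /diff_locallyP[_ /eqaddoP fo] e e0; move: (fo e e0).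
move=> /nbhs_shiftP[r r0 rP]; exists r => // h /rP.
by rewrite addr0 !fctE/= /cst opprD addrA.
Qed.

Lemma near_differentiable f g (x : E) : {near x, f =1 g} ->
  differentiable f x -> differentiable g x.
Proof.
move=> fg dfx; apply: (differentiable_at (df := 'd f x) _ _).1.
  by have /diff_locallyP[] := dfx.
move=> e e0; have [r r0 rP] := differentiable_near dfx e0.
move/nbhs_shiftP : (fg) => [r' r'0 fgr].
exists (Num.min r r'); first by rewrite lt_min r0.
move=> h; rewrite lt_min => /andP[hr hr'].
by rewrite -(nbhs_singleton fg) -fgr// rP.
Qed.

End differentiability.

Lemma open_near (T : topologicalType) (S : Type) (U : set T) (f g : T -> S) x :
  open U -> U x -> (forall y, U y -> f y = g y) -> {near x, f =1 g}.
Proof. by move=> oU Ux fg; apply: filterS (open_nbhs_nbhs (conj oU Ux)). Qed.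

(** * Smooth functions: closure properties *)

Section smooth_closure.
Context (R : realType) (E : normedModType R).
Implicit Types (f g : E -> R) (U : set E) (s : seq E).

Lemma iter_derive_rcons s v f :
  iter_derive (rcons s v) f = iter_derive s (fun x => 'D_v f x).
Proof. by rewrite /iter_derive foldr_rcons. Qed.

Lemma smooth_on_derive U f v : smooth_on U f -> smooth_on U (fun x => 'D_v f x).
Proof. by move=> sf s x Ux; rewrite -iter_derive_rcons; exact: sf. Qed.

Lemma smooth_on_differentiable U f x : smooth_on U f -> U x -> differentiable f x.
Proof. by move=> sf Ux; exact: (sf [::]). Qed.

Lemma smooth_on_iter U f s : smooth_on U f -> smooth_on U (iter_derive s f).
Proof.
by elim: s => //= v s IH sf; apply: smooth_on_derive; exact: IH.
Qed.

Lemma eq_on_derive U f g v x : open U -> (forall y, U y -> f y = g y) -> U x ->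
  'D_v f x = 'D_v g x.
Proof.
by move=> oU fg Ux; apply: near_eq_derive; exact: (open_near oU).
Qed.

Lemma eq_on_iter_derive U f g s x : open U -> (forall y, U y -> f y = g y) -> U x ->
  iter_derive s f x = iter_derive s g x.
Proof.
move=> oU; elim/last_ind : s f g x => [|s v IH] f g x fg Ux; first exact: fg.
rewrite !iter_derive_rcons; apply: IH => // y Uy; exact: (eq_on_derive _ oU).
Qed.

(** Smoothness by coinduction: a class of functions closed under directional
    derivatives, all of whose members are differentiable, consists of smooth
    functions.  Derivatives are
    compared with members of the class on the open set, where explicit formulas
    for them hold. *)
Lemma smooth_onP U (P : (E -> R) -> Prop) : open U ->
  (forall f, P f -> (forall x, U x -> differentiable f x) /\
     forall v, exists2 g, P g & forall x, U x -> 'D_v f x = g x) ->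
  forall f, P f -> smooth_on U f.
Proof.
move=> oU HP.
suff H s : forall f g, P g -> (forall x, U x -> f x = g x) ->
    forall x, U x -> differentiable (iter_derive s f) x.
  by move=> f Pf s x Ux; exact: (H s f f).
elim/last_ind : s => [|s v IH] f g Pg fg x Ux.
  apply: (@near_differentiable _ _ _ g); last exact: (HP _ Pg).1.
  by apply: (open_near oU Ux) => y Uy; exact/esym/fg.
have [_ /(_ v)[g' Pg' Dg]] := HP _ Pg.
rewrite iter_derive_rcons; apply: (IH _ g') => // y Uy.
by rewrite -Dg//; exact: (eq_on_derive _ oU).
Qed.

Lemma eq_smooth_on U f g : open U -> (forall x, U x -> f x = g x) ->
  smooth_on U f -> smooth_on U g.
Proof.
move=> oU fg sf s x Ux; apply: near_differentiable (sf s x Ux).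
by apply: (open_near oU Ux) => y Uy; exact: (eq_on_iter_derive _ oU).
Qed.

Lemma smooth_on_local U f : (forall x, U x -> exists V,
  [/\ open V, V x & smooth_on V f]) -> smooth_on U f.
Proof. by move=> H s x /H[V [oV Vx /(_ s x Vx)]]. Qed.

Lemma smooth_on_sub U V f : V `<=` U -> smooth_on U f -> smooth_on V f.
Proof. by move=> VU sf s x /VU Ux; exact: sf. Qed.

(** Derivatives of sums, products and compositions leave the class one starts
    from, but only by sums and products; closing under these makes
    [smooth_onP] applicable. *)
Inductive generated (B : (E -> R) -> Prop) : (E -> R) -> Prop :=
| gen_base f : B f -> generated B f
| gen_add f g : generated B f -> generated B g -> generated B (fun x => f x + g x)
| gen_mul f g : generated B f -> generated B g -> generated B (fun x => f x * g x).

Lemma generated_sum (B : (E -> R) -> Prop) (I : Type) (r : seq I)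
    (F : I -> E -> R) : B (fun=> 0) -> (forall i, generated B (F i)) ->
  generated B (fun x => \sum_(i <- r) F i x).
Proof.
move=> B0 BF; elim: r => [|i r IH].
  rewrite (_ : (fun _ => _) = fun=> 0); first exact: gen_base.
  by apply/funext => x; rewrite big_nil.
rewrite (_ : (fun _ => _) = fun x => F i x + \sum_(i <- r) F i x).
  exact: gen_add.
by apply/funext => x; rewrite big_cons.
Qed.

Lemma deriveD_fun f g v x : differentiable f x -> differentiable g x ->
  'D_v (fun x => f x + g x) x = 'D_v f x + 'D_v g x.
Proof. by move=> df dg; rewrite (@deriveD _ _ _ f g)//; exact: diff_derivable. Qed.

Lemma deriveM_fun f g v x : differentiable f x -> differentiable g x ->
  'D_v (fun x => f x * g x) x = f x * 'D_v g x + 'D_v f x * g x.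
Proof.
move=> df dg; rewrite (@deriveM _ _ f g); [|exact: diff_derivable..].
by congr (_ + _); rewrite [LHS]mulrC.
Qed.

Lemma differentiableD_fun f g x : differentiable f x -> differentiable g x ->
  differentiable (fun x => f x + g x) x.
Proof. exact: differentiableD. Qed.

Lemma differentiableM_fun f g x : differentiable f x -> differentiable g x ->
  differentiable (fun x => f x * g x) x.
Proof. exact: differentiableM. Qed.

(** It is enough to differentiate the generators, by the Leibniz rule. *)
Lemma smooth_on_generated U (B : (E -> R) -> Prop) : open U ->
  (forall f, B f -> (forall x, U x -> differentiable f x) /\
     forall v, exists2 g, generated B g & forall x, U x -> 'D_v f x = g x) ->
  forall f, generated B f -> smooth_on U f.
Proof.
move=> oU HB; apply: smooth_onP => // f; elim=> {f} [f /HB//| |].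
  move=> f g Bf [df Df] Bg [dg Dg]; split=> [x Ux|v].
    by apply: differentiableD_fun; [exact: df|exact: dg].
  have [f' f'B ff'] := Df v; have [g' g'B gg'] := Dg v.
  exists (fun x => f' x + g' x); first exact: gen_add.
  by move=> x Ux; rewrite deriveD_fun ?ff' ?gg'//; [exact: df|exact: dg].
move=> f g Bf [df Df] Bg [dg Dg]; split=> [x Ux|v].
  by apply: differentiableM_fun; [exact: df|exact: dg].
have [f' f'B ff'] := Df v; have [g' g'B gg'] := Dg v.
exists (fun x => f x * g' x + f' x * g x).
  by apply: gen_add; apply: gen_mul.
by move=> x Ux; rewrite deriveM_fun ?ff' ?gg'//; [exact: df|exact: dg].
Qed.

(** Both claims at once: the smooth functions generate themselves. *)
Lemma smooth_onDM U f g : open U -> smooth_on U f -> smooth_on U g ->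
  smooth_on U (fun x => f x + g x) /\ smooth_on U (fun x => f x * g x).
Proof.
move=> oU sf sg.
suff H h : generated (smooth_on U) h -> smooth_on U h.
  by split; apply: H; [apply: gen_add|apply: gen_mul]; exact: gen_base.
apply: smooth_on_generated => // {}h sh; split.
  by move=> x; exact: smooth_on_differentiable.
move=> v; exists (fun x => 'D_v h x) => //.
by apply: gen_base; exact: smooth_on_derive.
Qed.

Lemma smooth_onD U f g : open U -> smooth_on U f -> smooth_on U g ->
  smooth_on U (fun x => f x + g x).
Proof. by move=> oU sf sg; have [] := smooth_onDM oU sf sg. Qed.

Lemma smooth_onM U f g : open U -> smooth_on U f -> smooth_on U g ->
  smooth_on U (fun x => f x * g x).
Proof. by move=> oU sf sg; have [] := smooth_onDM oU sf sg. Qed.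

Lemma smooth_on_cst U (c : R) : open U -> smooth_on U (fun=> c).
Proof.
move=> oU; apply: (@smooth_onP U (fun f => exists c, f = fun=> c)) => //; last by exists c.
move=> f [d ->]; split=> [x _|v]; first exact: differentiable_cst.
by exists (fun=> 0); [exists 0|move=> x _; exact: derive_cst].
Qed.

Lemma smooth_onZ U (a : R) f : open U -> smooth_on U f ->
  smooth_on U (fun x => a * f x).
Proof. by move=> oU sf; apply: smooth_onM => //; exact: smooth_on_cst. Qed.

Lemma smooth_onN U f : open U -> smooth_on U f -> smooth_on U (fun x => - f x).
Proof.
move=> oU sf; apply: (@eq_smooth_on U (fun x => -1 * f x)) => //.
  by move=> x _; rewrite mulN1r.
exact: smooth_onZ.
Qed.

Lemma smooth_onB U f g : open U -> smooth_on U f -> smooth_on U g ->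
  smooth_on U (fun x => f x - g x).
Proof. by move=> oU sf sg; apply: smooth_onD => //; exact: smooth_onN. Qed.

Lemma smooth_on_sum U (I : Type) (r : seq I) (P : pred I) (F : I -> E -> R) :
  open U -> (forall i, P i -> smooth_on U (F i)) ->
  smooth_on U (fun x => \sum_(i <- r | P i) F i x).
Proof.
move=> oU sF; elim: r => [|i r IH].
  apply: (@eq_smooth_on U (fun=> 0)) => //; last exact: smooth_on_cst.
  by move=> x _; rewrite big_nil.
apply: (@eq_smooth_on U
  (fun x => (if P i then F i x else 0) + \sum_(i <- r | P i) F i x)) => //.
  by move=> x _; rewrite big_cons; case: ifP; rewrite ?add0r.
by apply: smooth_onD => //; case: (P i) (sF i) => [/(_ isT)//|_]; exact: smooth_on_cst.
Qed.

Lemma smooth_on_prod U (I : Type) (r : seq I) (P : pred I) (F : I -> E -> R) :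
  open U -> (forall i, P i -> smooth_on U (F i)) ->
  smooth_on U (fun x => \prod_(i <- r | P i) F i x).
Proof.
move=> oU sF; elim: r => [|i r IH].
  apply: (@eq_smooth_on U (fun=> 1)) => //; last exact: smooth_on_cst.
  by move=> x _; rewrite big_nil.
apply: (@eq_smooth_on U
  (fun x => (if P i then F i x else 1) * \prod_(i <- r | P i) F i x)) => //.
  by move=> x _; rewrite big_cons; case: ifP; rewrite ?mul1r.
by apply: smooth_onM => //; case: (P i) (sF i) => [/(_ isT)//|_]; exact: smooth_on_cst.
Qed.

Lemma smooth_on_linear U (l : {linear E -> R}) : open U -> continuous l ->
  smooth_on U l.
Proof.
move=> oU cl; apply: (@smooth_onP U
    (fun f => f = l \/ exists c, f = fun=> c)) => //; last by left.
move=> f [->|[c ->]]; split.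
- by move=> x _; exact: linear_differentiable.
- move=> v; exists (fun=> l v); first by right; exists (l v).
  by move=> x _; rewrite deriveE ?diff_lin//; exact: linear_differentiable.
- by move=> x _; exact: differentiable_cst.
- move=> v; exists (fun=> 0); first by right; exists 0.
  by move=> x _; exact: derive_cst.
Qed.

End smooth_closure.

(** * Smoothness of compositions *)

Section composition.
Context (R : realType) (E F : normedModType R).

Lemma differentiable_comp_fun (G : normedModType R) (h : F -> G) (psi : E -> F) x :
  differentiable psi x -> differentiable h (psi x) ->
  differentiable (fun x => h (psi x)) x /\
  forall v, 'D_v (fun x => h (psi x)) x = 'd h (psi x) ('D_v psi x).
Proof.
move=> dp dh; have dc : differentiable (h \o psi) x by exact: differentiable_comp.
split=> // v; rewrite (deriveE v dc) diff_comp//=.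
by rewrite (deriveE _ dp).
Qed.

(** Chain rule in coordinates: the derivative of h (Psi x) is a sum of products
    of derivatives of the coefficients psi i with derivatives of h evaluated at
    Psi x, hence again generated by functions of these two kinds. *)
Lemma smooth_on_comp m (b : 'I_m -> F) (psi : 'I_m -> E -> R)
    (U : set E) (W : set F) (h : F -> R) : open U ->
  (forall i, smooth_on U (psi i)) -> smooth_on W h ->
  (forall x, U x -> W (\sum_i psi i x *: b i)) ->
  smooth_on U (fun x => h (\sum_i psi i x *: b i)).
Proof.
move=> oU spsi sh UW; pose Psi x := \sum_i psi i x *: b i.
pose B f := smooth_on U f \/ exists2 k, smooth_on W k & f = fun x => k (Psi x).
apply: (@smooth_on_generated _ _ U B) => //; last by apply: gen_base; right; exists h.
have dpsi i x : U x -> differentiable (psi i) x.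
  exact: smooth_on_differentiable.
have PsiE : Psi = \sum_i (fun x => psi i x *: b i).
  by apply/funext => x; rewrite /Psi fct_sumE.
have dPsi x : U x -> differentiable Psi x.
  move=> Ux; rewrite PsiE; apply: differentiable_sum => i.
  by apply: differentiableZl; exact: dpsi.
have DPsi v x : U x -> 'D_v Psi x = \sum_i 'D_v (psi i) x *: b i.
  move=> Ux; rewrite PsiE derive_sum; last first.
    by move=> i; apply/diff_derivable/differentiableZl; exact: dpsi.
  apply: eq_bigr => i _.
  have dZ : differentiable (fun x => psi i x *: b i) x.
    by apply: differentiableZl; exact: dpsi.
  by rewrite (deriveE _ dZ) diffZl/= ?(deriveE _ (dpsi i x Ux))//; exact: dpsi.
move=> f [sf|[k sk ->]]; split.
- by move=> x; exact: smooth_on_differentiable.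
- move=> v; exists (fun x => 'D_v f x) => //.
  by apply: gen_base; left; exact: smooth_on_derive.
- move=> x Ux; apply: (differentiable_comp_fun (dPsi _ Ux) _).1.
  by apply: smooth_on_differentiable sk _; exact: UW.
- move=> v; exists (fun x => \sum_i 'D_v (psi i) x * 'D_(b i) k (Psi x)).
    apply: generated_sum; first by left; exact: smooth_on_cst.
    move=> i; apply: gen_mul; apply: gen_base.
      by left; exact: smooth_on_derive.
    right; exists (fun y => 'D_(b i) k y) => //; exact: smooth_on_derive.
  move=> x Ux; have dk : differentiable k (Psi x).
    by apply: smooth_on_differentiable sk _; exact: UW.
  rewrite (differentiable_comp_fun (dPsi _ Ux) dk).2 DPsi// linear_sum.
  by apply: eq_bigr => i _; rewrite linearZ (deriveE _ dk).
Qed.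

End composition.

(** * Smooth maps into normed spaces *)

Section smooth_maps.
Context (R : realType) (E : normedModType R).

(** Smoothness is available for scalar functions only.  All maps needed here
    take values in a fixed finite-dimensional subspace, so that scalar
    coefficients describe them. *)
Definition smooth_map (F : normedModType R) (U : set E) (Psi : E -> F) :=
  exists (m : nat) (b : 'I_m -> F) (psi : 'I_m -> E -> R),
    (forall i, smooth_on U (psi i)) /\
    forall x, U x -> Psi x = \sum_i psi i x *: b i.

Lemma smooth_on_compose (F : normedModType R) (U : set E) (W : set F)
    (h : F -> R) (Psi : E -> F) : open U -> smooth_map U Psi -> smooth_on W h ->
  (forall x, U x -> W (Psi x)) -> smooth_on U (fun x => h (Psi x)).
Proof.
move=> oU [m [b [psi [spsi PsiE]]]] sh UW.
apply: (@eq_smooth_on _ _ U (fun x => h (\sum_i psi i x *: b i))) => //.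
  by move=> x Ux; rewrite PsiE.
by apply: (smooth_on_comp oU spsi sh) => x Ux; rewrite -PsiE//; exact: UW.
Qed.

Lemma smooth_map_scale (F : normedModType R) (U : set E) (f : E -> R) (c : F) :
  smooth_on U f -> smooth_map U (fun x => f x *: c).
Proof.
move=> sf; exists 1, (fun=> c), (fun=> f); split=> // x _.
by rewrite big_ord1.
Qed.

Lemma smooth_map_cst (F : normedModType R) (U : set E) (c : F) : open U ->
  smooth_map U (fun=> c).
Proof.
move=> oU; exists 1, (fun=> c), (fun=> fun=> 1); split=> [i|x _].
  exact: smooth_on_cst.
by rewrite big_ord1 scale1r.
Qed.

Lemma smooth_map_add (F : normedModType R) (U : set E) (P Q : E -> F) :
  smooth_map U P -> smooth_map U Q -> smooth_map U (fun x => P x + Q x).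
Proof.
move=> [m [b [psi [spsi PE]]]] [k [c [phi [sphi QE]]]].
exists (m + k)%N, (fun i => match fintype.split i with inl j => b j | inr j => c j end),
  (fun i => match fintype.split i with inl j => psi j | inr j => phi j end); split.
  by move=> i; case: (fintype.split i).
move=> x Ux; rewrite PE// QE// big_split_ord/=; congr (_ + _).
  by apply: eq_bigr => i _; rewrite (unsplitK (inl _)).
by apply: eq_bigr => i _; rewrite (unsplitK (inr _)).
Qed.

Lemma smooth_map_mul (F : normedModType R) (U : set E) (f : E -> R) (P : E -> F) :
  open U -> smooth_on U f -> smooth_map U P -> smooth_map U (fun x => f x *: P x).
Proof.
move=> oU sf [m [b [psi [spsi PE]]]].
exists m, b, (fun i x => f x * psi i x); split=> [i|x Ux].
  exact: smooth_onM.
by rewrite PE// scaler_sumr; apply: eq_bigr => i _; rewrite scalerA.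
Qed.

Lemma smooth_map_opp (F : normedModType R) (U : set E) (P : E -> F) :
  open U -> smooth_map U P -> smooth_map U (fun x => - P x).
Proof.
move=> oU [m [b [psi [spsi PE]]]].
exists m, b, (fun i x => - psi i x); split=> [i|x Ux]; first exact: smooth_onN.
by rewrite PE// -sumrN; apply: eq_bigr => i _; rewrite scaleNr.
Qed.

Lemma smooth_map_pair (F G : normedModType R) (U : set E) (P : E -> F) (Q : E -> G) :
  smooth_map U P -> smooth_map U Q ->
  smooth_map U (fun x => (P x, Q x) : (F * G)%type).
Proof.
move=> [m [b [psi [spsi PE]]]] [k [c [phi [sphi QE]]]].
exists (m + k)%N, (fun i => match fintype.split i with
                     inl j => (b j, 0) | inr j => (0, c j) end),
  (fun i => match fintype.split i with inl j => psi j | inr j => phi j end); split.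
  by move=> i; case: (fintype.split i).
move=> x Ux; rewrite PE// QE// big_split_ord/=.
rewrite (eq_bigr (fun i => (psi i x *: b i, 0) : (F * G)%type)); last first.
  by move=> i _; rewrite (unsplitK (inl _))/= -[LHS]/(_, _)/= scaler0.
rewrite [X in _ = _ + X](eq_bigr (fun i => (0, phi i x *: c i) : (F * G)%type)); last first.
  by move=> i _; rewrite (unsplitK (inr _))/= -[LHS]/(_, _)/= scaler0.
have fstE (r : seq 'I_m) : \sum_(i <- r) ((psi i x *: b i, 0) : (F * G)%type) =
    (\sum_(i <- r) psi i x *: b i, 0).
  elim: r => [|i r IH]; first by rewrite !big_nil.
  by rewrite !big_cons IH -[LHS]/(_, _)/= addr0.
have sndE (r : seq 'I_k) : \sum_(i <- r) ((0, phi i x *: c i) : (F * G)%type) =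
    (0, \sum_(i <- r) phi i x *: c i).
  elim: r => [|i r IH]; first by rewrite !big_nil.
  by rewrite !big_cons IH -[LHS]/(_, _)/= addr0.
by rewrite fstE sndE -[RHS]/(_, _)/= addr0 add0r.
Qed.

Lemma smooth_map_real (U : set E) (f : E -> R) : smooth_on U f -> smooth_map U f.
Proof.
move=> sf; exists 1, (fun=> 1), (fun=> f); split=> // x _.
by rewrite big_ord1 -[RHS]/(_ * _) mulr1.
Qed.

Lemma smooth_on_scalar (U : set E) (f : E -> R) : open U -> continuous f ->
  (forall a x y, f (a *: x + y) = a * f x + f y) -> smooth_on U f.
Proof.
move=> oU cf lf.
pose l : {linear E -> R} := HB.pack f (GRing.isLinear.Build R E R _ f lf).
exact: (@smooth_on_linear R E U l).
Qed.

Lemma smooth_on_coord n (U : set E) (l : E -> 'rV[R]_n) i :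
  open U -> continuous l -> (forall a x y, l (a *: x + y) = a *: l x + l y) ->
  smooth_on U (fun x => l x 0 i).
Proof.
move=> oU cl ll; apply: smooth_on_scalar => // [|a x y]; last first.
  by rewrite ll !mxE.
move=> x; apply: (@continuous_comp _ _ _ l (fun M : 'rV[R]_n => M 0 i)).
  exact: cl.
exact: coord_continuous.
Qed.

Lemma smooth_map_row n (U : set E) (l : E -> 'rV[R]_n) :
  (forall i, smooth_on U (fun x => l x 0 i)) -> smooth_map U l.
Proof.
move=> sl; exists n, (fun i => delta_mx 0 i), (fun i x => l x 0 i).
by split=> // x _; exact: row_sum_delta.
Qed.

Lemma smooth_map_differentiable (F : normedModType R) (U : set E) (P : E -> F) x :
  open U -> smooth_map U P -> U x -> differentiable P x.
Proof.
move=> oU [m [b [psi [spsi PE]]]] Ux.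
apply: (@near_differentiable _ _ _ (\sum_i (fun x => psi i x *: b i))).
  by apply: (open_near oU Ux) => y Uy; rewrite PE// fct_sumE.
apply: differentiable_sum => i; apply: differentiableZl.
exact: smooth_on_differentiable (spsi i) Ux.
Qed.

End smooth_maps.

Section coordinates.
Context (R : realType) (n m : nat).
Local Notation V := 'rV[R]_n.
Local Notation W := 'rV[R]_m.

Lemma smooth_coord (U : set V) i : open U -> smooth_on U (fun x : V => x 0 i).
Proof. by move=> oU; apply: (@smooth_on_coord _ _ _ _ id) => // x; exact: cvg_id. Qed.

Lemma smooth_id (U : set V) : open U -> smooth_map U id.
Proof. by move=> oU; apply: smooth_map_row => i; exact: smooth_coord. Qed.

Lemma smooth_fst (F : normedModType R) (U : set (V * F)) :
  open U -> smooth_map U (fun p : V * F => p.1).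
Proof.
move=> oU; apply: smooth_map_row => i.
by apply: (@smooth_on_coord _ _ _ _ fst) => // x; exact: cvg_fst.
Qed.

Lemma smooth_snd (F : normedModType R) (U : set (F * W)) :
  open U -> smooth_map U (fun p : F * W => p.2).
Proof.
move=> oU; apply: smooth_map_row => i.
by apply: (@smooth_on_coord _ _ _ _ snd) => // x; exact: cvg_snd.
Qed.

Lemma smooth_sndR (F : normedModType R) (U : set (F * R)) :
  open U -> smooth_on U (fun p : F * R => p.2).
Proof.
by move=> oU; apply: smooth_on_scalar => // x; exact: cvg_snd.
Qed.

Lemma smooth_idR (U : set R) : open U -> smooth_on U id.
Proof. by move=> oU; apply: smooth_on_scalar => // x; exact: cvg_id. Qed.

End coordinates.

Lemma dist_le_add (R : realDomainType) (x y a e1 e2 : R) :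
  `|x - a| < e1 -> `|y - a| < e2 -> `|x - y| <= e1 + e2.
Proof.
move=> xa ya; rewrite (_ : x - y = (x - a) - (y - a)); last by ring.
by rewrite (le_trans (ler_normB _ _))// ltW// ltrD.
Qed.

(** * Mean value and Taylor estimates along lines; symmetry of second derivatives *)

Section lines.
Context (R : realType) (E : normedModType R).
Implicit Types (f : E -> R) (x v w : E).

Lemma line_is_derive f x v (t : R) : differentiable f (x + t *: v) ->
  is_derive t 1 (fun s : R => f (x + s *: v)) ('D_v f (x + t *: v)).
Proof.
move=> df; pose l (s : R) := x + s *: v.
have dl : differentiable l t.
  by apply: differentiableD; [exact: differentiable_cst|
    exact: (@differentiableZl _ _ _ id)].
have dZ : differentiable (fun s : R => s *: v) t.
  exact: (@differentiableZl _ _ _ id).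
have Dl : 'D_1 l t = v.
  rewrite /l (@deriveD _ _ _ (cst x) (fun s : R => s *: v)); last 2 first.
  - exact: derivable_cst.
  - exact: diff_derivable.
  rewrite derive_cst add0r deriveE// (@diffZl _ _ _ id)//=.
  by rewrite diff_val scale1r.
have [dc Dc] := differentiable_comp_fun dl df.
apply: DeriveDef; first exact: diff_derivable.
by rewrite (Dc 1) Dl deriveE.
Qed.

Lemma line_continuous f x v (t : R) : differentiable f (x + t *: v) ->
  {for t, continuous (fun s : R => f (x + s *: v))}.
Proof.
move=> /line_is_derive d; apply: differentiable_continuous.
exact/derivable1_diffP/ex_derive.
Qed.

Lemma mean_value f x v :
  (forall t, 0 <= t <= 1 -> differentiable f (x + t *: v)) ->
  exists2 t, 0 <= t <= 1 & f (x + v) - f x = 'D_v f (x + t *: v).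
Proof.
move=> df; pose g s := f (x + s *: v).
have [| |c c01] := @MVT_segment R g (fun t => 'D_v f (x + t *: v)) 0 1 ler01.
- by move=> t /subset_itv_oo_cc t01; apply: line_is_derive; apply: df.
- apply: continuous_in_subspaceT => t; rewrite inE/= => t01.
  by apply: line_continuous; apply: df.
rewrite /g scale0r scale1r addr0 subr0 mulr1 => fE.
by exists c => //; move: c01; rewrite in_itv.
Qed.

(** Two nested applications of the mean value theorem, whence a bound without
    the factor 1/2 of the sharp remainder. *)
Lemma taylor2 f x v M :
  (forall t, 0 <= t <= 1 -> differentiable f (x + t *: v)) ->
  (forall t, 0 <= t <= 1 -> differentiable (fun y => 'D_v f y) (x + t *: v)) ->
  (forall t, 0 <= t <= 1 -> `|'D_v (fun y => 'D_v f y) (x + t *: v)| <= M) ->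
  `|f (x + v) - f x - 'D_v f x| <= M.
Proof.
move=> df ddf DDf; have [t t01 ->] := mean_value df.
have /andP[t0 t1] := t01.
have [||c c01] := @MVT_segment R (fun s => 'D_v f (x + s *: v))
  (fun s => 'D_v (fun y => 'D_v f y) (x + s *: v)) 0 t t0.
- move=> s st; apply: (@line_is_derive (fun y => 'D_v f y)); apply: ddf.
  move: st; rewrite in_itv/= => /andP[s0 st].
  by rewrite ltW//= (le_trans (ltW st))//; case/andP: t01.
- apply: continuous_in_subspaceT => s; rewrite inE/= in_itv/= => /andP[s0 st].
  apply: (@line_continuous (fun y => 'D_v f y)); apply: ddf.
  by rewrite s0/= (le_trans st)//; case/andP: t01.
rewrite scale0r addr0 subr0 => ->.
have c01' : 0 <= c <= 1.
  by move: c01; rewrite in_itv/= => /andP[-> /= ct]; exact: le_trans t1.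
rewrite normrM (ger0_norm t0) (le_trans _ (DDf c c01'))//.
by rewrite ler_piMr.
Qed.

Lemma derive_combo f x (a : R) v w : differentiable f x ->
  'D_(a *: v + w) f x = a * 'D_v f x + 'D_w f x.
Proof. by move=> df; rewrite !deriveE// linearD linearZ. Qed.

Lemma deriveN_dir f x v : differentiable f x -> 'D_(- v) f x = - 'D_v f x.
Proof. by move=> df; rewrite !deriveE// linearN. Qed.

Lemma deriveZ_dir f x (a : R) v : differentiable f x ->
  'D_(a *: v) f x = a * 'D_v f x.
Proof. by move=> df; rewrite !deriveE// linearZ. Qed.

Lemma derive_sum_dir f x (I : Type) (r : seq I) (c : I -> R) (b : I -> E) :
  differentiable f x ->
  'D_(\sum_(i <- r) c i *: b i) f x = \sum_(i <- r) c i * 'D_(b i) f x.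
Proof.
move=> df; rewrite deriveE// linear_sum; apply: eq_bigr => i _.
by rewrite linearZ deriveE.
Qed.

(** The mean value theorem applied twice, to y |-> f (y + w) - f y along v and
    then to the derivative of f along w. *)
Lemma second_difference (U : set E) f v w x : smooth_on U f ->
  (forall s t : R, 0 <= s <= 1 -> 0 <= t <= 1 -> U (x + s *: v + t *: w)) ->
  exists s t : R, [/\ 0 <= s <= 1, 0 <= t <= 1 &
    f (x + v + w) - f (x + v) - f (x + w) + f x =
    'D_w (fun y => 'D_v f y) (x + s *: v + t *: w)].
Proof.
move=> sf HU.
have l01 : 0 <= (0 : R) <= 1 by rewrite lexx ler01.
have u01 : 0 <= (1 : R) <= 1 by rewrite lexx ler01.
have dfU y : U y -> differentiable f y by exact: smooth_on_differentiable.
pose g y := f (y + w) - f y.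
have dgt y : U y -> U (y + w) -> differentiable g y /\
    forall u, 'D_u g y = 'D_u f (y + w) - 'D_u f y.
  move=> Uy Uyw; have ds : differentiable (fun y => y + w) y.
    by apply: differentiableD => //; exact: differentiable_cst.
  have [dc Dc] := differentiable_comp_fun ds (dfU _ Uyw).
  split; first by apply: differentiableB => //; exact: dfU.
  move=> u; rewrite (@deriveB _ _ _ (fun y => f (y + w)) f).
  - congr (_ - _); rewrite (Dc u) (@deriveD _ _ _ id (cst w))//.
    by rewrite derive_id derive_cst addr0 deriveE//; exact: dfU.
  - exact: diff_derivable.
  - by apply: diff_derivable; exact: dfU.
have [s s01 sE] : exists2 s, 0 <= s <= 1 & g (x + v) - g x = 'D_v g (x + s *: v).
  apply: mean_value => t t01; apply: (dgt _ _ _).1.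
    by have := HU t 0 t01 l01; rewrite scale0r addr0.
  by have := HU t 1 t01 u01; rewrite scale1r.
have Us : U (x + s *: v).
  by have := HU s 0 s01 l01; rewrite scale0r addr0.
have Usw : U (x + s *: v + w).
  by have := HU s 1 s01 u01; rewrite scale1r.
have [t t01 tE] : exists2 t, 0 <= t <= 1 &
    'D_v f (x + s *: v + w) - 'D_v f (x + s *: v) =
    'D_w (fun y => 'D_v f y) (x + s *: v + t *: w).
  apply: (@mean_value (fun y => 'D_v f y)) => t t01.
  by apply: smooth_on_differentiable (smooth_on_derive v sf) _; exact: HU.
exists s, t; split=> //; rewrite -tE -(dgt _ Us Usw).2 -sE /g.
by rewrite !opprD !opprK; ring.
Qed.

(** The second difference is symmetric in v and w; by [second_difference] it is
    h^2 times either mixed derivative at nearby points, and both mixed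
    derivatives are continuous. *)
Lemma schwarz (U : set E) f v w x : open U -> smooth_on U f -> U x ->
  'D_v (fun y => 'D_w f y) x = 'D_w (fun y => 'D_v f y) x.
Proof.
move=> oU sf Ux.
pose a y := 'D_v (fun y => 'D_w f y) y; pose b y := 'D_w (fun y => 'D_v f y) y.
suff H e : 0 < e -> `|a x - b x| <= e.
  apply/eqP; rewrite -subr_eq0 -normr_le0; apply/ler_addgt0Pl => e /H.
  by rewrite addr0.
move=> e0.
have ca : {for x, continuous a}.
  apply: differentiable_continuous; apply: smooth_on_differentiable Ux.
  by do 2 apply: smooth_on_derive.
have cb : {for x, continuous b}.
  apply: differentiable_continuous; apply: smooth_on_differentiable Ux.
  by do 2 apply: smooth_on_derive.
have e20 : 0 < e / 2 by rewrite divr_gt0.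
have : \forall y \near x, [/\ `|a x - a y| < e / 2, `|b x - b y| < e / 2 & U y].
  have Ha : \forall y \near x, `|a x - a y| < e / 2 by move/cvgrPdist_lt : ca; apply.
  have Hb : \forall y \near x, `|b x - b y| < e / 2 by move/cvgrPdist_lt : cb; apply.
  have HU := open_nbhs_nbhs (conj oU Ux).
  by apply: filterS3 Ha Hb HU => y; split.
move=> /nbhs_shiftP[r r0 rP].
have [h h0 hr] : exists2 h : R, 0 < h & h * (`|v| + `|w|) < r.
  exists (r / (`|v| + `|w| + 1)).
    by rewrite divr_gt0// ltr_wpDl// addr_ge0.
  rewrite mulrAC ltr_pdivrMr ?ltr_wpDl ?addr_ge0// ltr_pM2l//.
  by rewrite ltrDl.
have near_x s t : 0 <= s <= 1 -> 0 <= t <= 1 ->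
    [/\ `|a x - a (x + s *: (h *: v) + t *: (h *: w))| < e / 2,
      `|b x - b (x + s *: (h *: v) + t *: (h *: w))| < e / 2 &
      U (x + s *: (h *: v) + t *: (h *: w))].
  move=> /andP[s0 s1] /andP[t0 t1]; rewrite -addrA addrC; apply: rP.
  apply: le_lt_trans hr; rewrite (le_trans (ler_normD _ _))// mulrDr.
  rewrite !normrZ (gtr0_norm h0) (ger0_norm s0) (ger0_norm t0).
  by rewrite lerD// ler_piMl// mulr_ge0// ltW.
have DhE u1 u2 y : U y -> 'D_(h *: u2) (fun z => 'D_(h *: u1) f z) y =
    h * (h * 'D_u2 (fun z => 'D_u1 f z) y).
  move=> Uy; rewrite deriveZ_dir; last first.
    exact: smooth_on_differentiable (smooth_on_derive _ sf) Uy.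
  congr (_ * _).
  rewrite (@eq_on_derive _ _ U _ (fun z => h * 'D_u1 f z))//.
    rewrite (@deriveM_fun _ _ (cst h)).
    - by rewrite derive_cst mul0r addr0.
    - exact: differentiable_cst.
    - exact: smooth_on_differentiable (smooth_on_derive _ sf) Uy.
  move=> z Uz; rewrite deriveZ_dir//; exact: smooth_on_differentiable Uz.
have [s [t [s01 t01 bE]]] := @second_difference U f (h *: v) (h *: w) x sf
  (fun s t s01 t01 => let: And3 _ _ H := near_x s t s01 t01 in H).
have HU' s' t' : 0 <= s' <= 1 -> 0 <= t' <= 1 ->
    U (x + s' *: (h *: w) + t' *: (h *: v)).
  by move=> s'01 t'01; rewrite addrAC; have [] := near_x _ _ t'01 s'01.
have [t' [s' [t'01 s'01 aE]]] := second_difference sf HU'.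
have [_ bx Ub] := near_x _ _ s01 t01.
have [ax _ Ua] := near_x _ _ s'01 t'01.
have aE' := DhE w v _ Ua; have bE' := DhE v w _ Ub.
have hhE : h * (h * a (x + s' *: (h *: v) + t' *: (h *: w))) =
    h * (h * b (x + s *: (h *: v) + t *: (h *: w))).
  rewrite -[LHS]aE' -[RHS]bE' -bE [in LHS]addrAC -aE.
  by rewrite (addrAC x (h *: w)); ring.
have AB := mulfI (lt0r_neq0 h0) (mulfI (lt0r_neq0 h0) hhE).
rewrite -AB in bx.
by rewrite (splitr e); exact: (dist_le_add ax bx).
Qed.

End lines.

(** * The supremum norm and linear forms on row vectors *)

Section row_vectors.
Context (R : realType) (n : nat).
Local Notation V := 'rV[R]_n.

Lemma coord_le_norm (x : V) i : `|x 0 i| <= `|x|.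
Proof.
rewrite [leRHS]/Num.norm/= mx_normrE.
exact: (@le_bigmax _ _ _ 0 (fun ij : 'I_1 * 'I_n => `|x ij.1 ij.2|) (0, i)).
Qed.

Lemma norm_le_coord (x : V) (M : R) : 0 <= M -> (forall i, `|x 0 i| <= M) ->
  `|x| <= M.
Proof.
move=> M0 xM; rewrite [leLHS]/Num.norm/= mx_normrE; apply/bigmax_leP; split=> //.
by move=> [i j] _ /=; rewrite (ord1 i).
Qed.

Lemma row_basis (x : V) : x = \sum_i x 0 i *: basis R i.
Proof. exact: row_sum_delta. Qed.

Definition cball (r : R) : set V := [set x | `|x| <= r].

Lemma compact_cball r : compact (cball r).
Proof.
apply: bounded_closed_compact.
  by exists r; split; [exact: num_real|move=> M rM x /= xr; exact: le_trans (ltW rM)].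
have -> : cball r = (@Num.norm R V) @^-1` [set y | y <= r] by [].
by apply: closed_comp; [move=> x _; exact: norm_continuous|exact: closed_le].
Qed.

Definition coord_form (c : 'I_n -> R) (h : V) : R := \sum_i h 0 i * c i.

Lemma coord_form_linear c a x y :
  coord_form c (a *: x + y) = a * coord_form c x + coord_form c y.
Proof.
rewrite /coord_form mulr_sumr -big_split/=; apply: eq_bigr => i _.
by rewrite !mxE; ring.
Qed.

Lemma coord_form_continuous c : continuous (coord_form c).
Proof.
move=> x; have -> : coord_form c = \sum_i (fun h : V => h 0 i * c i).
  by apply/funext => h; rewrite /coord_form fct_sumE.
apply: differentiable_continuous; apply: differentiable_sum => i.
by apply: differentiableM_fun; [exact: differentiable_coord|exact: differentiable_cst].
Qed.

(** A remainder that is quadratic in the increment gives differentiability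
    and identifies the differential; this is how integrals and functionals
    depending on a parameter are differentiated. *)
Lemma quadratic_differentiable (f : V -> R) x (c : 'I_n -> R) (C r : R) : 0 < r ->
  (forall h, `|h| < r ->
    `|f (x + h) - f x - coord_form c h| <= C * `|h| ^+ 2) ->
  differentiable f x /\ forall v, 'D_v f x = coord_form c v.
Proof.
move=> r0 fC.
pose l : {linear V -> R} :=
  HB.pack (coord_form c) (GRing.isLinear.Build R V R _ _ (coord_form_linear c)).
have [df dE] : differentiable f x /\ 'd f x = l :> (V -> R).
  apply: differentiable_at; first exact: coord_form_continuous.
  move=> e e0; pose C1 := `|C| + 1.
  have C10 : 0 < C1 by rewrite ltr_wpDl.
  exists (Num.min r (e / C1)); first by rewrite lt_min r0 divr_gt0.
  move=> h; rewrite lt_min => /andP[hr he]; rewrite (addrC h).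
  apply: le_trans (fC _ hr) _; rewrite expr2 mulrA ler_wpM2r//.
  apply: (@le_trans _ _ (C1 * `|h|)).
    by rewrite ler_wpM2r// ler_wpDr// ler_norm.
  by rewrite mulrC -ler_pdivlMr// ltW.
by split=> // v; rewrite deriveE// dE.
Qed.

Lemma coord_form_bound c (M : R) (h : V) : (forall i, `|c i| <= M) ->
  `|coord_form c h| <= n%:R * (`|h| * M).
Proof.
move=> cM; rewrite (le_trans (ler_norm_sum _ _ _))//.
apply: (@le_trans _ _ (\sum_(i < n) `|h| * M)).
  by apply: ler_sum => i _; rewrite normrM ler_pM// coord_le_norm.
by rewrite sumr_const card_ord mulr_natl.
Qed.

Lemma derive_coord_form (f : V -> R) x v : differentiable f x ->
  'D_v f x = coord_form (fun i => 'D_(basis R i) f x) v.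
Proof. by move=> df; rewrite {1}(row_basis v) derive_sum_dir. Qed.

End row_vectors.

Lemma compact_continuous_bounded (R : realType) (T : topologicalType) (K : set T)
    (f : T -> R) : compact K -> (forall x, K x -> {for x, continuous f}) ->
  exists2 M, 0 <= M & forall x, K x -> `|f x| <= M.
Proof.
move=> cK cf.
have /compact_bounded[M [_ MP]] : compact (f @` K).
  by apply: continuous_compact => //; apply: continuous_in_subspaceT => x;
    rewrite inE => /cf.
exists (`|M| + 1) => [|x Kx]; first by rewrite addr_ge0.
by apply: MP; [rewrite ltr_pwDr// ler_norm|exists x].
Qed.

(** Restricting to words over a finite alphabet of directions of bounded length
    leaves finitely many continuous functions on a compact set. *)
Lemma iter_derive_bound (R : realType) (E : normedModType R) (I : finType) (b : I -> E)
    (K U : set E) (f : E -> R) N : compact K -> K `<=` U -> smooth_on U f ->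
  exists2 M, 0 <= M & forall s : seq I, (size s <= N)%N -> forall x, K x ->
    `|iter_derive (map b s) f x| <= M.
Proof.
move=> cK KU; elim: N f => [|N IH] f sf.
  have [|M M0 MP] := @compact_continuous_bounded _ _ _ f cK.
    by move=> x Kx; exact/differentiable_continuous/(smooth_on_differentiable sf)/KU.
  by exists M => // -[|//] _.
have [M0 M00 M0P] : exists2 M, 0 <= M & forall x, K x -> `|f x| <= M.
  apply: compact_continuous_bounded => // x Kx.
  exact/differentiable_continuous/(smooth_on_differentiable sf)/KU.
have H i := IH _ (smooth_on_derive (b i) sf).
have [m mP] : exists m : I -> R, forall i, 0 <= m i /\
    forall s : seq I, (size s <= N)%N -> forall x, K x ->
      `|iter_derive (map b s) (fun x => 'D_(b i) f x) x| <= m i.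
  by exists (fun i => sval (cid2 (H i))) => i; case: cid2 => ? ? /=.
exists (M0 + \sum_i m i).
  by rewrite addr_ge0//; apply: sumr_ge0 => i _; case: (mP i).
move=> s; case/lastP: s => [_ x xr|s i].
  by rewrite (le_trans (M0P x xr))// lerDl; apply: sumr_ge0 => i _; case: (mP i).
rewrite size_rcons ltnS => sN x xr; rewrite map_rcons iter_derive_rcons.
apply: le_trans ((mP i).2 s sN x xr) _; apply: ler_wpDl => //.
by rewrite (bigD1 i)//= lerDl; apply: sumr_ge0 => j _; case: (mP j).
Qed.

(** * Integrals of bounded functions over sets of finite measure *)

Section bounded_integrals.
Context (R : realType) (d : measure_display) (T : measurableType d).
Context (mu : {measure set T -> \bar R}) (D : set T).
Hypotheses (mD : measurable D) (muD : (mu D < +oo)%E).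
Local Notation "'\I' f" := (\int[mu]_(t in D) f t) (at level 10).

(** On a set of finite measure this implies integrability, and it is preserved
    by all the operations used below. *)
Definition bounded_on (f : T -> R) := measurable_fun D f /\
  exists M, forall t, D t -> `|f t| <= M.

Lemma bounded_on_integrable f : bounded_on f -> mu.-integrable D (EFin \o f).
Proof.
move=> [mf [M fM]]; apply: measurable_bounded_integrable => //.
exists M; split; first exact: num_real.
by move=> x Mx t Dt /=; rewrite (le_trans (fM t Dt))// ltW.
Qed.

Lemma bounded_on_lin a f g : bounded_on f -> bounded_on g ->
  bounded_on (fun t => a * f t + g t).
Proof.
move=> [mf [M fM]] [mg [N gN]]; split.
  apply: measurable_funD => //; apply: measurable_funM => //.
exists (`|a| * M + N) => t Dt; rewrite (le_trans (ler_normD _ _))// lerD ?gN//.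
by rewrite normrM ler_wpM2l// fM.
Qed.

Lemma bounded_on_cst c : bounded_on (fun=> c).
Proof. by split; [exact: measurable_cst|exists `|c|]. Qed.

Lemma bounded_on_sum (I : Type) (r : seq I) (c : I -> R) (f : I -> T -> R) :
  (forall i, bounded_on (f i)) -> bounded_on (fun t => \sum_(i <- r) c i * f i t).
Proof.
move=> bf; elim: r => [|i r IH].
  rewrite (_ : (fun _ => _) = fun=> 0); first exact: bounded_on_cst.
  by apply/funext => t; rewrite big_nil.
rewrite (_ : (fun _ => _) = fun t => c i * f i t + \sum_(i <- r) c i * f i t).
  exact: bounded_on_lin.
by apply/funext => t; rewrite big_cons.
Qed.

Lemma Rintegral_lin a f g : bounded_on f -> bounded_on g ->
  \I (fun t => a * f t + g t) = a * \I f + \I g.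
Proof.
move=> bf bg; have [mf [M fM]] := bf.
have baf : bounded_on (fun t => a * f t).
  split; first exact: measurable_funM.
  by exists (`|a| * M) => t Dt; rewrite normrM ler_wpM2l// fM.
rewrite RintegralD ?RintegralZl//; exact: bounded_on_integrable.
Qed.

Lemma Rintegral_sum (I : Type) (r : seq I) (c : I -> R) (f : I -> T -> R) :
  (forall i, bounded_on (f i)) ->
  \I (fun t => \sum_(i <- r) c i * f i t) = \sum_(i <- r) c i * \I (f i).
Proof.
move=> bf; elim: r => [|i r IH].
  rewrite big_nil (_ : (fun _ => _) = fun=> 0).
    by rewrite Rintegral_cst// mul0r.
  by apply/funext => t; rewrite big_nil.
rewrite big_cons -IH -Rintegral_lin//; last exact: bounded_on_sum.
by apply: eq_Rintegral => t _; rewrite big_cons.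
Qed.

Lemma Rintegral_bound f M : bounded_on f -> (forall t, D t -> `|f t| <= M) ->
  `|\I f| <= M * fine (mu D).
Proof.
move=> bf fM; rewrite (le_trans (le_normr_Rintegral mD (bounded_on_integrable bf)))//.
rewrite -Rintegral_cst//; apply: le_Rintegral => //.
- apply: bounded_on_integrable; have [mf [N fN]] := bf; split.
    exact: measurableT_comp.
  by exists N => t Dt; rewrite normr_id fN.
- exact/bounded_on_integrable/bounded_on_cst.
Qed.

End bounded_integrals.

(** * Differentiation under the integral sign *)

Section parametric_integrals.
Context (R : realType) (n : nat) (F : normedModType R).
Context (d : measure_display) (T : measurableType d).
Context (mu : {measure set T -> \bar R}) (D : set T).
Hypotheses (mD : measurable D) (muD : (mu D < +oo)%E).
Context (pi : T -> F) (C O : set F).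
Hypotheses (cC : compact C) (piD : forall t, D t -> C (pi t)).
Hypotheses (oO : open O) (CO : C `<=` O).
Hypothesis mpi : forall k : F -> R, (forall y, O y -> {for y, continuous k}) ->
  measurable_fun D (k \o pi).
Local Notation V := 'rV[R]_n.

(** The parameter x is free; only the variable of integration is confined to
    the open set O. *)
Definition slab : set (V * F) := [set p | O p.2].

Lemma open_slab : open slab.
Proof. by apply: (@open_comp _ _ snd O) => // p _; exact: cvg_snd. Qed.

Lemma pair0_basis (h : V) :
  ((h, 0) : (V * F)%type) = \sum_i h 0 i *: ((basis R i, 0) : (V * F)%type).
Proof.
have E (r : seq 'I_n) : \sum_(i <- r) h 0 i *: ((basis R i, 0) : (V * F)%type) =
    (\sum_(i <- r) h 0 i *: basis R i, 0).
  elim: r => [|i r IH]; first by rewrite !big_nil.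
  by rewrite !big_cons IH -[LHS]/(_, _)/= scaler0 addr0.
by rewrite E -row_basis.
Qed.

Lemma derive_pair0 (Phi : V * F -> R) p (h : V) : differentiable Phi p ->
  'D_(h, 0) Phi p = coord_form (fun i => 'D_(basis R i, 0) Phi p) h.
Proof. by move=> dP; rewrite pair0_basis derive_sum_dir. Qed.

Lemma slice_bounded_on (Phi : V * F -> R) x : smooth_on slab Phi ->
  bounded_on D (fun t => Phi (x, pi t)).
Proof.
move=> sPhi.
have cP y : O y -> {for y, continuous (fun y => Phi (x, y))}.
  move=> Oy; apply: differentiable_continuous.
  apply: (@differentiable_comp_fun _ _ _ _ Phi (fun y => (x, y)) y _ _).1.
    by apply: (@differentiable_pair _ _ _ _ (cst x) id) => //; exact: differentiable_cst.
  exact: (smooth_on_differentiable sPhi).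
split; first exact: (mpi cP).
have [M _ MP] := compact_continuous_bounded cC (fun y Cy => cP y (CO Cy)).
by exists M => t Dt; apply: MP; exact: piD.
Qed.

Definition param_int (Phi : V * F -> R) (x : V) : R :=
  \int[mu]_(t in D) Phi (x, pi t).

(** Taylor estimate of the integrand, with a bound on the second derivatives
    that is uniform on a compact neighbourhood, integrated and fed to
    [quadratic_differentiable]. *)
Lemma param_int_derive_at (Phi : V * F -> R) x : smooth_on slab Phi ->
  differentiable (param_int Phi) x /\
  forall v, 'D_v (param_int Phi) x = param_int (fun p => 'D_(v, 0) Phi p) x.
Proof.
move=> sPhi; pose e i : (V * F)%type := (basis R i, 0).
have sD v : smooth_on slab (fun p => 'D_v Phi p) by exact: smooth_on_derive.
have sDD v w : smooth_on slab (fun p => 'D_w (fun p => 'D_v Phi p) p).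
  exact: smooth_on_derive.
have dP p : slab p -> differentiable Phi p by exact: smooth_on_differentiable.
pose K : set (V * F) := cball (`|x| + 1) `*` C.
have cK : compact K by apply: compact_setX => //; exact: compact_cball.
have KO : K `<=` slab by move=> p [_ /CO].
have [M M0 MP] : exists2 M, 0 <= M & forall i j p, K p ->
    `|'D_(e j) (fun p => 'D_(e i) Phi p) p| <= M.
  have H i j := compact_continuous_bounded cK (fun p Kp =>
    differentiable_continuous (smooth_on_differentiable (sDD (e i) (e j)) (KO p Kp))).
  have [m mP] : exists m : 'I_n -> 'I_n -> R, forall i j, 0 <= m i j /\
      forall p, K p -> `|'D_(e j) (fun p => 'D_(e i) Phi p) p| <= m i j.
    by exists (fun i j => sval (cid2 (H i j))) => i j; case: cid2 => ? ? /=.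
  have m0 i j : 0 <= m i j by case: (mP i j).
  exists (\sum_i \sum_j m i j) => [|i j p Kp].
    by apply: sumr_ge0 => i _; apply: sumr_ge0.
  apply: (le_trans ((mP i j).2 p Kp)); apply: (@le_trans _ _ (\sum_k m i k)).
    by rewrite (bigD1 j)//= lerDl sumr_ge0.
  by rewrite [leRHS](bigD1 i)//= lerDl sumr_ge0// => k _; apply: sumr_ge0.
pose c i := param_int (fun p => 'D_(e i) Phi p) x.
pose C0 := n%:R * (n%:R * M) * fine (mu D).
have [|df DE] := @quadratic_differentiable R n (param_int Phi) x c C0 1 ltr01; last first.
  split=> // v; rewrite DE /coord_form.
  rewrite /c /param_int -Rintegral_sum//; last by move=> i; exact: (slice_bounded_on x (sD (e i))).
  apply: eq_Rintegral => t; rewrite inE => Dt; rewrite pair0_basis derive_sum_dir//.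
  by apply: dP; exact/CO/piD.
move=> h h1.
have bh y : bounded_on D (fun t => Phi (y, pi t)) by exact: (slice_bounded_on y sPhi).
have bs : bounded_on D (fun t => \sum_i h 0 i * 'D_(e i) Phi (x, pi t)).
  by apply: bounded_on_sum => i; exact: (slice_bounded_on x (sD (e i))).
have -> : param_int Phi (x + h) - param_int Phi x - coord_form c h =
    \int[mu]_(t in D) (-1 * (\sum_i h 0 i * 'D_(e i) Phi (x, pi t)) +
      (-1 * Phi (x, pi t) + Phi (x + h, pi t))).
  rewrite !Rintegral_lin//; last exact: bounded_on_lin.
  rewrite Rintegral_sum//; last by move=> i; exact: (slice_bounded_on x (sD (e i))).
  by rewrite /coord_form /param_int; ring.
rewrite (_ : C0 * _ = n%:R * (n%:R * M) * `|h| ^+ 2 * fine (mu D)); last first.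
  by rewrite /C0; ring.
apply: Rintegral_bound => //.
  by apply: bounded_on_lin => //; apply: bounded_on_lin.
move=> t Dt.
have slabt y : slab (y, pi t) by exact/CO/piD.
have lineE s : (x, pi t) + s *: ((h, 0) : (V * F)%type) = (x + s *: h, pi t).
  by rewrite -[LHS]/(_, _)/= scaler0 addr0.
have -> : -1 * (\sum_i h 0 i * 'D_(e i) Phi (x, pi t)) +
    (-1 * Phi (x, pi t) + Phi (x + h, pi t)) =
    Phi ((x, pi t) + ((h, 0) : (V * F)%type)) - Phi (x, pi t) - 'D_(h, 0) Phi (x, pi t).
  have -> : (x, pi t) + ((h, 0) : (V * F)%type) = (x + h, pi t).
    by have := lineE 1; rewrite !scale1r.
  have -> : 'D_(h, 0) Phi (x, pi t) = \sum_i h 0 i * 'D_(e i) Phi (x, pi t).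
    by rewrite pair0_basis derive_sum_dir//; exact: dP.
  by ring.
apply: taylor2 => s s01; rewrite lineE.
- exact: dP.
- exact: smooth_on_differentiable (sD _) _.
have Ks : K (x + s *: h, pi t).
  split; last exact: piD.
  rewrite /= /cball/= (le_trans (ler_normD _ _))// lerD2l normrZ.
  case/andP: s01 => s0 s1; rewrite ger0_norm//.
  by rewrite (le_trans (ler_piMl _ _))// ltW.
rewrite derive_pair0; last exact: smooth_on_differentiable (sD _) _.
rewrite (le_trans (coord_form_bound (M := n%:R * (`|h| * M)) _ _))//.
  move=> i; rewrite (schwarz _ _ open_slab sPhi)//.
  rewrite derive_pair0; last exact: smooth_on_differentiable (sD _) _.
  by apply: coord_form_bound => j; exact: MP.
by rewrite [leRHS](_ : _ = n%:R * (`|h| * (n%:R * (`|h| * M))))//; ring.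
Qed.

Theorem param_int_smooth (Phi : V * F -> R) : smooth_on slab Phi ->
  smooth (param_int Phi).
Proof.
move=> sPhi; apply: (@smooth_onP _ _ setT (fun f => exists2 Phi,
    smooth_on slab Phi & f = param_int Phi)); [exact: openT| |by exists Phi].
move=> f [Psi sPsi ->]; split=> [x _|v].
  exact: (param_int_derive_at x sPsi).1.
exists (param_int (fun p => 'D_(v, 0) Psi p)) => [|x _].
  by exists (fun p => 'D_(v, 0) Psi p) => //; exact: smooth_on_derive.
exact: (param_int_derive_at x sPsi).2.
Qed.

End parametric_integrals.

(** * Integrals over compact intervals *)

Section interval_integrals.
Context (R : realType) (n : nat) (a b : R) (O : set R).
Hypotheses (oO : open O) (abO : forall t, a <= t <= b -> O t).
Local Notation V := 'rV[R]_n.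
Local Notation mu := (@lebesgue_measure R).

Lemma itv_subset : `[a, b]%classic `<=` O.
Proof. by move=> t; rewrite /= in_itv/=; exact: abO. Qed.

Lemma itv_measurable (k : R -> R) : (forall y, O y -> {for y, continuous k}) ->
  measurable_fun `[a, b] k.
Proof.
move=> ck; apply: subspace_continuous_measurable_fun => //.
apply: continuous_in_subspaceT => x; rewrite inE => /itv_subset; exact: ck.
Qed.

Lemma itv_finite_measure : (mu `[a, b] < +oo)%E.
Proof. by apply: compact_finite_measure; exact: segment_compact. Qed.

Lemma itv_bounded_on (k : R -> R) : (forall y, O y -> {for y, continuous k}) ->
  bounded_on `[a, b] k.
Proof.
move=> ck; split; first exact: itv_measurable.
have [|M _ MP] := @compact_continuous_bounded R R `[a, b] k (@segment_compact _ a b).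
  by move=> x /itv_subset; exact: ck.
by exists M.
Qed.

Definition itv_int (Phi : V * R -> R) (x : V) : R :=
  \int[mu]_(t in `[a, b]) Phi (x, t).

Lemma itv_int_smooth (Phi : V * R -> R) : smooth_on (slab O) Phi ->
  smooth (itv_int Phi).
Proof.
move=> sPhi; apply: (@param_int_smooth _ _ _ _ _ mu `[a, b]%classic _ _ id `[a, b]%classic O) => //.
- exact: itv_finite_measure.
- exact: segment_compact.
- by move=> k; exact: itv_measurable.
Qed.

Lemma itv_int_derive (Phi : V * R -> R) v x : smooth_on (slab O) Phi ->
  'D_v (itv_int Phi) x = itv_int (fun p => 'D_(v, 0) Phi p) x.
Proof.
move=> sPhi; apply: (@param_int_derive_at R n R _ _ mu `[a, b]%classic _ _ id
  `[a, b]%classic O _ _ _ _ _ Phi x sPhi).2 => //.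
- exact: itv_finite_measure.
- exact: segment_compact.
- by move=> k; exact: itv_measurable.
Qed.

Lemma itv_FTC (F f : R -> R) : a < b ->
  (forall t, O t -> is_derive t 1 F (f t)) ->
  (forall t, O t -> {for t, continuous f}) ->
  \int[mu]_(t in `[a, b]) f t = F b - F a.
Proof.
move=> ab dF cf; rewrite /Rintegral (@continuous_FTC2 _ f F)//.
- by apply: continuous_in_subspaceT => x; rewrite inE => /itv_subset; exact: cf.
- have cF t : O t -> {for t, continuous F}.
    move=> Ot; apply: differentiable_continuous; apply/derivable1_diffP.
    by case: (dF _ Ot).
  have Oa : O a by apply: abO; rewrite lexx ltW.
  have Ob : O b by apply: abO; rewrite lexx ltW.
  split.
  + move=> t /subset_itv_oo_cc; rewrite in_itv/= => /abO Ot.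
    by case: (dF _ Ot).
  + exact: cvg_at_right_filter (cF _ Oa).
  + exact: cvg_at_left_filter (cF _ Ob).
- move=> t /subset_itv_oo_cc; rewrite in_itv/= => /abO Ot.
  by rewrite derive1E; case: (dF _ Ot).
Qed.

End interval_integrals.

(** * Euclidean geometry of row vectors *)

Section sphere.
Context (R : realType) (n : nat).
Local Notation V := 'rV[R]_n.
Local Notation Rm := (measurableTypeR R).
Implicit Types x y : V.

Lemma dotC x y : dot x y = dot y x.
Proof. by apply: eq_bigr => i _; rewrite mulrC. Qed.

Lemma dot_lin a x y z : dot (a *: x + y) z = a * dot x z + dot y z.
Proof.
rewrite /dot mulr_sumr -big_split/=; apply: eq_bigr => i _.
by rewrite !mxE; ring.
Qed.

Lemma dotZl a x z : dot (a *: x) z = a * dot x z.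
Proof. by rewrite /dot mulr_sumr; apply: eq_bigr => i _; rewrite !mxE mulrA. Qed.

Lemma dotZr a x z : dot z (a *: x) = a * dot z x.
Proof. by rewrite dotC dotZl dotC. Qed.

Lemma dotDl x y z : dot (x + y) z = dot x z + dot y z.
Proof. by rewrite -[x in LHS]scale1r dot_lin mul1r. Qed.

Lemma dotDr x y z : dot z (x + y) = dot z x + dot z y.
Proof. by rewrite dotC dotDl !(dotC z). Qed.

Lemma dotNl x z : dot (- x) z = - dot x z.
Proof. by rewrite -scaleN1r dotZl mulN1r. Qed.

Lemma dotNr x z : dot z (- x) = - dot z x.
Proof. by rewrite dotC dotNl dotC. Qed.

Lemma dot_ge0 x : 0 <= dot x x.
Proof. by apply: sumr_ge0 => i _; rewrite -expr2 sqr_ge0. Qed.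

Lemma dot_eq0 x : (dot x x == 0) = (x == 0).
Proof.
apply/eqP/eqP => [|->]; last by apply: big1 => i _; rewrite mxE mul0r.
move=> /eqP; rewrite psumr_eq0; last by move=> i _; rewrite -expr2 sqr_ge0.
move=> /allP H; apply/rowP => i; rewrite mxE.
by have := H i (mem_index_enum _); rewrite mulf_eq0 orbb => /eqP.
Qed.

Lemma enorm_ge0 x : 0 <= enorm x.
Proof. exact: sqrtr_ge0. Qed.

Lemma enorm_sqr x : enorm x ^+ 2 = dot x x.
Proof. by rewrite sqr_sqrtr// dot_ge0. Qed.

Lemma enorm_gt0 x : (0 < enorm x) = (x != 0).
Proof. by rewrite sqrtr_gt0 lt_def dot_eq0 dot_ge0 andbT. Qed.

Lemma enormZ a x : enorm (a *: x) = `|a| * enorm x.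
Proof. by rewrite /enorm dotZl dotZr mulrA -expr2 sqrtrM ?sqr_ge0// sqrtr_sqr. Qed.

Lemma norm_le_enorm x : `|x| <= enorm x.
Proof.
apply: norm_le_coord => [|i]; first exact: enorm_ge0.
rewrite -sqrtr_sqr ler_sqrt ?dot_ge0// /dot (bigD1 i)//= -expr2 lerDl.
by apply: sumr_ge0 => j _; rewrite -expr2 sqr_ge0.
Qed.

Lemma dot_le_norm x y : `|dot x y| <= n%:R * (`|x| * `|y|).
Proof. exact: (@coord_form_bound _ _ (fun i => y 0 i) `|y| x (coord_le_norm y)). Qed.

Lemma enorm_le_norm x : enorm x <= n%:R * `|x|.
Proof.
have n0 : 0 <= n%:R * `|x| by rewrite mulr_ge0.
rewrite -[leRHS]ger0_norm// -sqrtr_sqr ler_sqrt ?sqr_ge0//.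
rewrite (le_trans (ler_norm _))// (le_trans (dot_le_norm _ _))//.
rewrite exprMn -expr2 ler_wpM2r ?sqr_ge0// -natrX ler_nat.
by case: (n) => // k; rewrite expnS expn1 leq_pmulr.
Qed.

(** Extends a function on the sphere to the open set of nonzero vectors, where
    it can be differentiated. *)
Definition unit_dir x : V := (enorm x)^-1 *: x.

Lemma unit_dirZ a x : 0 < a -> unit_dir (a *: x) = unit_dir x.
Proof.
move=> a0; rewrite /unit_dir enormZ gtr0_norm// invfM scalerA mulrAC mulVf//.
  by rewrite mul1r.
exact: lt0r_neq0.
Qed.

Lemma enorm_unit_dir x : x != 0 -> enorm (unit_dir x) = 1.
Proof.
rewrite -enorm_gt0 => x0; rewrite enormZ ger0_norm ?invr_ge0 ?enorm_ge0//.
by rewrite mulVf// lt0r_neq0.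
Qed.

Lemma unit_dir_id x : enorm x = 1 -> unit_dir x = x.
Proof. by move=> x1; rewrite /unit_dir x1 invr1 scale1r. Qed.

(** Tuples carry the product sigma-algebra, rows the product topology: an open
    set is a countable union of boxes with rational centres and radii. *)
Lemma measurable_row_open (U : set V) : open U ->
  measurable (@row_of_tuple R n @^-1` U).
Proof.
move=> oU.
pose B (c : {ffun 'I_n -> rat} * rat) : set V :=
  [set x | forall i, `|x 0 i - ratr (c.1 i)| < ratr c.2].
pose A (c : {ffun 'I_n -> rat} * rat) : set (n.-tuple Rm) :=
  if `[< B c `<=` U >] then @row_of_tuple R n @^-1` B c else set0.
have -> : @row_of_tuple R n @^-1` U = \bigcup_c A c.
  apply/seteqP; split=> [t /= Ut|t [c _]]; last first.
    by rewrite /A; case: asboolP => // BU /BU.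
  have [r r0 rP] : exists2 r : R, 0 < r & forall y, `|y - row_of_tuple t| < r -> U y.
    have /nbhs_shiftP[r r0 rP] := open_nbhs_nbhs (conj oU Ut).
    by exists r => // y yr; have := rP _ yr; rewrite subrK.
  have r20 : 0 < r / 2 by rewrite divr_gt0.
  have [q] := rat_in_itvoo r20; rewrite in_itv/= => /andP[q0 qr].
  have Hc i : exists c : rat, `|tnth t i - ratr c| < ratr q :> R.
    have : tnth t i - ratr q < tnth t i + ratr q :> R.
      by rewrite ltrD2l (lt_trans _ q0)// oppr_lt0.
    move=> /rat_in_itvoo[c]; rewrite in_itv/= => /andP[c1 c2]; exists c.
    by rewrite ltr_distlC c1 c2.
  pose c := [ffun i => sval (cid (Hc i))].
  exists (c, q) => //; rewrite /A; case: asboolP => [_|[]].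
    by move=> i /=; rewrite mxE ffunE; case: cid.
  move=> y yB; apply: rP; apply: (@le_lt_trans _ _ (ratr q + ratr q)).
    apply: norm_le_coord => [|i]; first by rewrite addr_ge0// ltW.
    have := yB i; rewrite !mxE !ffunE; case: cid => k /= tk yk.
    by rewrite distrC; apply: dist_le_add tk yk.
  by rewrite (splitr r) ltrD.
apply: countable_bigcupT_measurable => [|c]; first exact: countableP.
rewrite /A; case: asboolP => // _.
have -> : @row_of_tuple R n @^-1` B c = \bigcap_(i in [set` finset.setT]) 
   ((fun t : n.-tuple Rm => tnth t i) @^-1` [set u : Rm | `|u - ratr (c.1 i)| < ratr c.2]).
  apply/seteqP; split=> [t /= tB i _|t tB i] /=; first by have := tB i; rewrite mxE.
  by rewrite mxE; apply: tB; rewrite /= finset.inE.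
apply: fin_bigcap_measurable => [|i _]; first exact: finite_finset.
rewrite -[X in measurable X]setTI; apply: measurable_tnth => //.
rewrite (_ : [set u | _] = ball (ratr (c.1 i) : R) (ratr c.2)); first exact: measurable_ball.
by apply/seteqP; split=> u; rewrite -ball_normE /ball_/= distrC.
Qed.

End sphere.

(** * Volume of boxes *)

Section tuple_box.
Context (R : realType).
Local Notation Rm := (measurableTypeR R).

(** The only sets whose iterated product measure has to be computed: they give
    finiteness of the measure of the ball and positivity of integrals. *)
Definition box n (c : n.-tuple Rm) (r : R) : set (n.-tuple Rm) :=
  [set t | forall i, ball (tnth c i : R) r (tnth t i)].

Lemma measurable_box n (c : n.-tuple Rm) r : measurable (box c r).
Proof.
have -> : box c r = \bigcap_(i in [set` finset.setT])
   ((fun t : n.-tuple Rm => tnth t i) @^-1` (ball (tnth c i : R) r)).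
  apply/seteqP; split=> [t /= tB i _|t tB i] /=; first exact: tB.
  by apply: tB; rewrite /= finset.inE.
apply: fin_bigcap_measurable => [|i _]; first exact: finite_finset.
rewrite -[X in measurable X]setTI; apply: measurable_tnth => //.
exact: measurable_ball.
Qed.

Lemma tuple_lebesgue_box n (c : n.-tuple Rm) r : 0 <= r ->
  tuple_lebesgue R n (box c r) = ((r *+ 2) ^+ n)%:E.
Proof.
move=> r0; elim: n c => [|n IH] c.
  rewrite /= diracE (_ : [tuple] \in box c r) ?expr0//.
  by rewrite inE => -[].
case/tupleP: c => x c.
rewrite [LHS]/(cons_measure _ _) /cons_measure /pushforward.
have -> : (@cons_pair R n) @^-1` (box [tuple of x :: c] r) = ball (x : R) r `*` box c r.
  apply/seteqP; split=> [[y t] /= H|[y t] [/= xy H] i].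
    split=> [|i]; first by have := H ord0; rewrite !tnth0.
    by have := H (lift ord0 i); rewrite !tnthS.
  by case: (unliftP ord0 i) => [j ->|->]; rewrite ?tnth0 ?tnthS.
rewrite product_measure1E//; [|exact: measurable_ball|exact: measurable_box].
rewrite IH exprS EFinM; congr (_ * _)%E; exact: lebesgue_measure_ball.
Qed.

End tuple_box.

(** * Integration over the unit sphere *)

Section sphere_integrals.
Context (R : realType) (n : nat).
Local Notation V := 'rV[R]_n.
Local Notation Rm := (measurableTypeR R).
Local Notation mu := (tuple_lebesgue R n).

(** The domain of integration in the definition of [sphere_integral]. *)
Definition punctured_ball : set (n.-tuple Rm) :=
  [set t | 0 < enorm (row_of_tuple t) <= 1].

Definition radial (t : n.-tuple Rm) : V := unit_dir (row_of_tuple t).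

Definition unit_sphere : set V := [set x | enorm x = 1].

Definition nonzero : set V := [set x | x != 0].

Lemma open_nonzero : open nonzero.
Proof.
rewrite (_ : nonzero = @Num.norm R V @^-1` [set y | 0 < y]).
  by apply: open_comp; [move=> x _; exact: norm_continuous|exact: open_gt].
by apply/seteqP; split=> x; rewrite /= normr_gt0.
Qed.

Lemma smooth_dot (E : normedModType R) (U : set E) (f g : E -> V) : open U ->
  (forall i, smooth_on U (fun x => f x 0 i)) ->
  (forall i, smooth_on U (fun x => g x 0 i)) ->
  smooth_on U (fun x => dot (f x) (g x)).
Proof.
by move=> oU sf sg; apply: smooth_on_sum => // i _; exact: smooth_onM.
Qed.

Lemma enorm_continuous : continuous (@enorm R n).
Proof.
move=> x; apply: (@continuous_comp _ _ _ (fun y => dot y y) (@Num.sqrt R)).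
  apply: differentiable_continuous; apply: (@smooth_on_differentiable _ _ setT) => //.
  by apply: smooth_dot; [exact: openT|move=> i|move=> i]; exact/smooth_coord/openT.
exact: sqrt_continuous.
Qed.

Lemma unit_dir_continuous x : x != 0 -> {for x, continuous (@unit_dir R n)}.
Proof.
move=> x0; have ce : (fun y => (enorm y)^-1) @ x --> (enorm x)^-1.
  have e0 : enorm x != 0 by rewrite lt0r_neq0// enorm_gt0.
  exact: (cvgV e0 (@enorm_continuous x)).
suff : (fun y => (enorm y)^-1 *: y) @ x --> (enorm x)^-1 *: x by [].
by apply: (cvgZ ce); exact: cvg_id.
Qed.

Lemma closed_unit_sphere : closed unit_sphere.
Proof.
rewrite (_ : unit_sphere = @enorm R n @^-1` [set y | y = 1]) //.
by apply: closed_comp; [move=> x _; exact: enorm_continuous|exact: closed_eq].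
Qed.

Lemma compact_unit_sphere : compact unit_sphere.
Proof.
apply: bounded_closed_compact; last exact: closed_unit_sphere.
exists 1; split; first exact: num_real.
move=> M M1 x /= x1; rewrite (le_trans (norm_le_enorm x))//.
by rewrite (x1 : enorm x = 1) ltW.
Qed.

Lemma unit_sphere_nonzero : unit_sphere `<=` nonzero.
Proof. by move=> x x1; rewrite /nonzero/= -enorm_gt0 (x1 : enorm x = 1). Qed.

Lemma measurable_punctured_ball : measurable punctured_ball.
Proof.
have -> : punctured_ball = (@row_of_tuple R n @^-1` [set x | 0 < enorm x]) `\`
    (@row_of_tuple R n @^-1` [set x | 1 < enorm x]).
  apply/seteqP; split=> t; rewrite /punctured_ball /setD/=.
    by case/andP => t0 t1; split=> //; apply/negP; rewrite -leNgt.
  by case=> t0 /negP; rewrite -leNgt => t1; apply/andP.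
have op (a : R) : open [set x : V | a < enorm x].
  rewrite (_ : [set x | _] = @enorm R n @^-1` [set y | a < y])//.
  by apply: open_comp; [move=> x _; exact: enorm_continuous|exact: open_gt].
by apply: measurableD; apply: measurable_row_open; exact: op.
Qed.

Lemma finite_punctured_ball : (mu punctured_ball < +oo)%E.
Proof.
pose c : n.-tuple Rm := [tuple (0 : R) | i < n].
apply: (@le_lt_trans _ _ (mu (box c 2))); last by rewrite tuple_lebesgue_box ?ltry.
apply: le_measure; rewrite ?inE; [exact: measurable_punctured_ball|
  exact: measurable_box|].
move=> t /= /andP[_ t1] i; rewrite -ball_normE /ball_/= tnth_mktuple sub0r normrN.
have := coord_le_norm (row_of_tuple t) i; rewrite mxE => /le_lt_trans; apply.
rewrite (le_lt_trans (norm_le_enorm _))// (le_lt_trans t1)//.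
by rewrite ltr1n.
Qed.

Lemma radial_unit t : punctured_ball t -> unit_sphere (radial t).
Proof. by move=> /andP[t0 _]; apply: enorm_unit_dir; rewrite -enorm_gt0. Qed.

(** Inverse images of intervals are inverse images of open sets of rows. *)
Lemma measurable_radial (k : V -> R) :
  (forall y, nonzero y -> {for y, continuous k}) ->
  measurable_fun punctured_ball (k \o radial).
Proof.
move=> ck; apply: (measurability _ (RGenOpens.measurableE R)).
move=> _ [_ [a [b ->] <-]].
pose W : set V := nonzero `&` (k \o @unit_dir R n) @^-1` `]a, b[%classic.
have oW : open W.
  rewrite openE => x [x0 Wx]; apply: filterI; first exact: open_nbhs_nbhs (conj open_nonzero x0).
  have ckx : {for x, continuous (k \o @unit_dir R n)}.
    apply: continuous_comp; first exact: unit_dir_continuous.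
    by apply: ck; exact/unit_sphere_nonzero/enorm_unit_dir.
  apply: ckx; apply: open_nbhs_nbhs; split => //; exact: interval_open.
rewrite (_ : _ `&` _ = punctured_ball `&` (@row_of_tuple R n @^-1` W)).
  by apply: measurableI; [exact: measurable_punctured_ball|exact: measurable_row_open].
apply/seteqP; split=> t [Dt Ht]; split=> //; last by case: Ht.
by split=> //; rewrite /nonzero/= -enorm_gt0; case/andP: Dt.
Qed.

Lemma sphere_integralE (g : V -> R) : sphere_integral g =
  n%:R * \int[mu]_(t in punctured_ball) g (radial t).
Proof. by []. Qed.

Lemma sphere_bounded_on (g : V -> R) :
  (forall y, nonzero y -> {for y, continuous g}) ->
  bounded_on punctured_ball (fun t => g (radial t)).
Proof.
move=> cg; split; first exact: (measurable_radial cg).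
have [M _ MP] := compact_continuous_bounded compact_unit_sphere
  (fun x Cx => cg x (unit_sphere_nonzero Cx)).
by exists M => t /radial_unit; exact: MP.
Qed.

(** An integral over the sphere is [param_int] for the map [radial], whose
    values lie in the compact unit sphere, inside the open set of nonzero
    vectors. *)
Definition sphere_param (Phi : V * V -> R) (x : V) : R :=
  sphere_integral (fun theta => Phi (x, theta)).

Let P (Phi : V * V -> R) := @param_int R n V _ _ mu punctured_ball radial Phi.

Let sphere_paramE Phi : sphere_param Phi = fun x => n%:R * P Phi x.
Proof. by []. Qed.

Let P_derive_at Phi x : smooth_on (slab nonzero) Phi -> differentiable (P Phi) x /\
  forall v, 'D_v (P Phi) x = P (fun p => 'D_(v, 0) Phi p) x.
Proof.
move=> sPhi; apply: (@param_int_derive_at R n V _ _ mu _ _ _ _ unit_sphere nonzero _ _ _ _ _ Phi x sPhi).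
- exact: measurable_punctured_ball.
- exact: finite_punctured_ball.
- exact: compact_unit_sphere.
- exact: radial_unit.
- exact: open_nonzero.
- exact: unit_sphere_nonzero.
- exact: measurable_radial.
Qed.

Lemma sphere_param_derive Phi v : smooth_on (slab nonzero) Phi ->
  (fun x => 'D_v (sphere_param Phi) x) = sphere_param (fun p => 'D_(v, 0) Phi p).
Proof.
move=> sPhi; apply/funext => x; have [dP DP] := P_derive_at x sPhi.
rewrite !sphere_paramE (@deriveM_fun _ _ (cst n%:R)).
- by rewrite DP derive_cst mul0r addr0.
- exact: differentiable_cst.
- exact: dP.
Qed.

Lemma sphere_param_smooth Phi : smooth_on (slab nonzero) Phi ->
  smooth (sphere_param Phi).
Proof.
move=> sPhi; rewrite sphere_paramE; apply: smooth_onZ; first exact: openT.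
apply: (@param_int_smooth R n V _ _ mu _ _ _ _ unit_sphere nonzero _ _ _ _ _ Phi sPhi).
- exact: measurable_punctured_ball.
- exact: finite_punctured_ball.
- exact: compact_unit_sphere.
- exact: radial_unit.
- exact: open_nonzero.
- exact: unit_sphere_nonzero.
- exact: measurable_radial.
Qed.

Lemma sphere_param_iter Phi s : smooth_on (slab nonzero) Phi ->
  iter_derive s (sphere_param Phi) =
  sphere_param (iter_derive [seq ((v, 0) : (V * V)%type) | v <- s] Phi).
Proof.
move=> sPhi; elim: s => //= v s ->; rewrite sphere_param_derive//.
exact: smooth_on_iter.
Qed.

Lemma eq_sphere_integral (g h : V -> R) : (forall x, enorm x = 1 -> g x = h x) ->
  sphere_integral g = sphere_integral h.
Proof.
move=> gh; rewrite !sphere_integralE; congr (_ * _); apply: eq_Rintegral => t.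
by rewrite inE => /radial_unit; exact: gh.
Qed.

Lemma sphere_integral_lin a (g h : V -> R) :
  (forall y, nonzero y -> {for y, continuous g}) ->
  (forall y, nonzero y -> {for y, continuous h}) ->
  sphere_integral (fun x => a * g x + h x) = a * sphere_integral g + sphere_integral h.
Proof.
move=> cg ch; rewrite !sphere_integralE Rintegral_lin ?mulrDr; first by ring.
- exact: measurable_punctured_ball.
- exact: finite_punctured_ball.
- exact: sphere_bounded_on.
- exact: sphere_bounded_on.
Qed.

Lemma sphere_integral_sum (I : Type) (r : seq I) (c : I -> R) (g : I -> V -> R) :
  (forall i y, nonzero y -> {for y, continuous (g i)}) ->
  sphere_integral (fun x => \sum_(i <- r) c i * g i x) =
  \sum_(i <- r) c i * sphere_integral (g i).
Proof.
move=> cg; rewrite !sphere_integralE.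
rewrite (@Rintegral_sum _ _ _ mu punctured_ball measurable_punctured_ball
  finite_punctured_ball I r c (fun i t => g i (radial t))).
  by rewrite mulr_sumr; apply: eq_bigr => i _; rewrite sphere_integralE mulrCA.
by move=> i; apply: sphere_bounded_on; exact: cg.
Qed.

Lemma sphere_integral_le (g h : V -> R) :
  (forall y, nonzero y -> {for y, continuous g}) ->
  (forall y, nonzero y -> {for y, continuous h}) ->
  (forall x, enorm x = 1 -> `|g x| <= h x) ->
  `|sphere_integral g| <= sphere_integral h.
Proof.
move=> cg ch gh; rewrite !sphere_integralE normrM ger0_norm// ler_wpM2l//.
have mD := measurable_punctured_ball; have fD := finite_punctured_ball.
have ig := bounded_on_integrable mD fD (sphere_bounded_on cg).
have ih := bounded_on_integrable mD fD (sphere_bounded_on ch).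
apply: le_trans (le_normr_Rintegral mD ig) _; apply: le_Rintegral => //.
  apply: bounded_on_integrable => //.
  apply: (@sphere_bounded_on (fun x => `|g x|)) => y y0.
  by apply: (@continuous_comp _ _ _ g Num.norm); [exact: cg|exact: norm_continuous].
by move=> t /radial_unit; exact: gh.
Qed.

(** The integrand stays above g theta / 2 on the cone over a neighbourhood of
    theta, which contains a box of positive volume. *)
Lemma sphere_integral_gt0 (g : V -> R) theta : enorm theta = 1 ->
  (forall y, nonzero y -> {for y, continuous g}) ->
  (forall x, enorm x = 1 -> 0 <= g x) -> 0 < g theta -> 0 < sphere_integral g.
Proof.
move=> th1 cg g0 gth.
have th0 : theta != 0 by exact: unit_sphere_nonzero.
have n0 : (0 < n)%N.
  rewrite lt0n; apply/eqP => n0; move/eqP: th0; apply.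
  by apply/rowP => i; have := ltn_ord i; rewrite {2}n0.
pose x := 2^-1 *: theta.
have x0 : nonzero x by rewrite /nonzero/= scaler_eq0 invr_eq0 pnatr_eq0 (negbTE th0).
pose W : set V := [set y | [/\ g theta / 2 < g (unit_dir y), 0 < enorm y & enorm y < 1]].
have W_near : nbhs x W.
  have cx : {for x, continuous (g \o @unit_dir R n)}.
    apply: continuous_comp; first exact: unit_dir_continuous.
    by apply: cg; exact/unit_sphere_nonzero/enorm_unit_dir.
  have gx : g (unit_dir x) = g theta by rewrite unit_dirZ ?invr_gt0// unit_dir_id.
  have Ha : \forall y \near x, g theta / 2 < g (unit_dir y).
    apply: (cvgr_gt _ cx); rewrite /= gx ltr_pdivrMr// ltr_pMr//.
    by rewrite ltr1n.
  have ex : enorm x = 2^-1 by rewrite enormZ th1 mulr1 ger0_norm// invr_ge0.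
  have Hb : \forall y \near x, 0 < enorm y.
    by apply: (cvgr_gt _ (@enorm_continuous x)); rewrite ex invr_gt0.
  have Hc : \forall y \near x, enorm y < 1.
    by apply: (cvgr_lt _ (@enorm_continuous x)); rewrite ex invf_lt1// ltr1n.
  by apply: filterS3 Ha Hb Hc => y; split.
have [r r0 rP] : exists2 r : R, 0 < r &
    forall y : V, (forall i, `|y 0 i - x 0 i| < r) -> W y.
  have /nbhs_shiftP[r r0 rP] := W_near.
  exists (r / 2) => [|y yr]; first by rewrite divr_gt0.
  rewrite -(subrK x y); apply: rP; apply: (@le_lt_trans _ _ (r / 2)).
    apply: norm_le_coord => [|i]; first by rewrite ltW// divr_gt0.
    by have := yr i; rewrite /x !mxE => /ltW.
  by rewrite ltr_pdivrMr// ltr_pMr// ltr1n.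
pose c : n.-tuple Rm := [tuple (x 0 i : R) | i < n].
have BW t : box c r t -> W (row_of_tuple t).
  move=> ct; apply: rP => i; have := ct i.
  by rewrite -ball_normE /ball_/= tnth_mktuple distrC [row_of_tuple t 0 i]mxE.
have BD : box c r `<=` punctured_ball.
  by move=> t /BW[_ e0 e1]; rewrite /punctured_ball/= e0 ltW.
have mD := measurable_punctured_ball; have fD := finite_punctured_ball.
have mB : measurable (box c r) by exact: measurable_box.
rewrite sphere_integralE mulr_gt0 ?ltr0n//.
have bg := sphere_bounded_on cg.
have fB : (mu (box c r) < +oo)%E by rewrite tuple_lebesgue_box ?ltry// ltW.
have bB : bounded_on (box c r) (fun t => g (radial t)).
  have [mg [M gM]] := bg; split; last by exists M => t /BD; exact: gM.
  exact: measurable_funS mg.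
have bc : bounded_on (box c r) (fun t => g theta / 2).
  exact: bounded_on_cst.
have : g theta / 2 * fine (mu (box c r)) <= \int[mu]_(t in box c r) g (radial t).
  rewrite -Rintegral_cst//; apply: le_Rintegral => //.
  - exact: (bounded_on_integrable mB fB bc).
  - exact: (bounded_on_integrable mB fB bB).
  - by move=> t /BW[/ltW].
have : \int[mu]_(t in box c r) g (radial t) <= \int[mu]_(t in punctured_ball) g (radial t).
  rewrite -(setIidr BD) Rintegral_mkcondr.
  have bR : bounded_on punctured_ball ((fun t => g (radial t)) \_ (box c r)).
    have [mg [M gM]] := bg; split.
      apply/(measurable_restrict _ mB mD).
      by apply: measurable_funS mg => //; rewrite setIidr.
    exists M => t Dt; rewrite patchE; case: ifP => _; first exact: gM.
    by rewrite normr0 (le_trans _ (gM t Dt)).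
  apply: le_Rintegral => //; [exact: bounded_on_integrable bR|
    exact: bounded_on_integrable bg|].
  move=> t Dt; rewrite patchE; case: ifP => // _; apply: g0; exact: radial_unit.
move=> le1 le2; apply: lt_le_trans le1; apply: lt_le_trans le2.
rewrite tuple_lebesgue_box ?ltW//= mulr_gt0// ?divr_gt0// exprn_gt0//.
by rewrite mulrn_wgt0.
Qed.

End sphere_integrals.

Lemma deriveX_fun (R : realType) (E : normedModType R) (f : E -> R) v x k :
  differentiable f x -> differentiable (fun y => f y ^+ k) x /\
  'D_v (fun y => f y ^+ k) x = k%:R * f x ^+ k.-1 * 'D_v f x.
Proof.
move=> df; elim: k => [|k [dk Dk]].
  rewrite (_ : (fun y => f y ^+ 0) = cst 1); last by apply/funext => y; rewrite expr0.
  by rewrite derive_cst !mul0r; split=> //; exact: differentiable_cst.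
rewrite (_ : (fun y => f y ^+ k.+1) = fun y => f y * f y ^+ k); last first.
  by apply/funext => y; rewrite exprS.
split; first exact: differentiableM_fun.
rewrite deriveM_fun// Dk /=; case: (k) => [|j]; first by rewrite !expr0; ring.
by rewrite /= exprS; ring.
Qed.

(** * Flat functions and a smooth step *)

Section one_variable.
Context (R : realType).

Lemma is_derive_dir (f : R -> R) (x v df : R) : is_derive x 1 f df ->
  differentiable f x /\ 'D_v f x = v * df.
Proof.
move=> [dx Df]; have dfx : differentiable f x by exact/derivable1_diffP.
split=> //; rewrite -{1}[v]mulr1 -[v * 1]/(v *: (1 : R)) deriveZ_dir//.
by rewrite Df.
Qed.

(** In one variable the derivatives in all directions are multiples of a single
    one; constants are among the generators to express this. *)
Lemma smooth_on_generatedR (U : set R) (B : (R -> R) -> Prop) : open U ->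
  (forall c, B (fun=> c)) ->
  (forall f, B f -> exists2 g, generated B g & forall x, U x -> is_derive x 1 f (g x)) ->
  forall f, B f -> smooth_on U f.
Proof.
move=> oU Bc HB f Bf; apply: (@smooth_on_generated _ _ U B) => //; last exact: gen_base.
move=> h /HB[g Bg dh]; split=> [x Ux|v].
  exact: (is_derive_dir 0 (dh x Ux)).1.
exists (fun x => v * g x) => [|x Ux].
  by apply: gen_mul => //; exact: gen_base.
exact: (is_derive_dir v (dh x Ux)).2.
Qed.

Lemma near_is_derive (f g : R -> R) (x df : R) : {near x, f =1 g} ->
  is_derive x 1 f df -> is_derive x 1 g df.
Proof. by move=> fg; exact: near_eq_is_derive. Qed.

Lemma open_gt0 : open [set x : R | 0 < x].
Proof. exact: open_gt. Qed.

Lemma smooth_on_inv : smooth_on [set x : R | 0 < x] (fun x => x^-1).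
Proof.
pose B (f : R -> R) := (exists c, f = fun=> c) \/ f = fun x => x^-1.
apply: (@smooth_on_generatedR _ B); [exact: open_gt0|by move=> c; left; exists c| |by right].
move=> f [[c ->]|->].
  by exists (fun=> 0) => [|x _]; [by apply: gen_base; left; exists 0|exact: is_derive_cst].
exists (fun x => -1 * (x^-1 * x^-1)) => [|x x0].
  by repeat apply: gen_mul; apply: gen_base; [left; exists (-1)|right|right].
have x0' : x != 0 by rewrite gt_eqF.
apply: DeriveDef; first by apply: derivableV => //; exact: derivable_id.
rewrite (@deriveV _ _ id)// derive_id -[LHS]/(_ * _) /= mulr1 mulN1r.
by rewrite -invfM -expr2.
Qed.

Lemma smooth_on_invsqrt : smooth_on [set x : R | 0 < x] (fun x => (Num.sqrt x)^-1).
Proof.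
pose B (f : R -> R) := (exists c, f = fun=> c) \/ f = fun x => (Num.sqrt x)^-1.
apply: (@smooth_on_generatedR _ B); [exact: open_gt0|by move=> c; left; exists c| |by right].
move=> f [[c ->]|->].
  by exists (fun=> 0) => [|x _]; [by apply: gen_base; left; exists 0|exact: is_derive_cst].
pose s (x : R) := (Num.sqrt x)^-1.
exists (fun x => - 2^-1 * (s x * (s x * s x))) => [|x x0].
  by repeat apply: gen_mul; apply: gen_base; [left; exists (- 2^-1)|right|right|right].
have s0 : Num.sqrt x != 0 by rewrite gt_eqF// sqrtr_gt0.
have [dsq Dsq] := is_derive1_sqrt x0.
apply: DeriveDef; first by apply: derivableV.
rewrite (@deriveV _ _ Num.sqrt)// Dsq -[LHS]/(_ * _) /s.
by field.
Qed.

(** The family x^-k exp (-1/x), cut off at 0, is closed under differentiation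
    up to linear combinations ([is_derive_flat]), so that all its members are
    smooth at once. *)
Definition flat (k : nat) (x : R) : R :=
  if 0 < x then x^-1 ^+ k * expR (- x^-1) else 0.

(** By the exponential series: the quadratic bound gives derivative 0 at 0. *)
Lemma flat_small k x : `|flat k x| <= (k.+2)`!%:R * x ^+ 2.
Proof.
rewrite /flat; case: ifPn => [x0|_]; last by rewrite normr0 mulr_ge0 ?sqr_ge0.
have ix0 : 0 <= x^-1 by rewrite invr_ge0 ltW.
rewrite ger0_norm ?mulr_ge0 ?exprn_ge0 ?expR_ge0//.
rewrite expRN ler_pdivrMr ?expR_gt0//.
have := @expR_ge1Dxn R x^-1 k.+1 ix0; set e := expR _ => He.
have {}He : x^-1 ^+ k.+2 / (k.+2)`!%:R <= e by rewrite (le_trans _ He)// lerDr.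
have f0 : 0 < (k.+2)`!%:R :> R by rewrite ltr0n fact_gt0.
have -> : x^-1 ^+ k = (k.+2)`!%:R * x ^+ 2 * (x^-1 ^+ k.+2 / (k.+2)`!%:R).
  rewrite -addn2 exprD; field.
  by rewrite (gt_eqF x0) gt_eqF.
by rewrite ler_wpM2l// mulr_ge0 ?sqr_ge0 ?ltW.
Qed.

Lemma is_derive_flat (k : nat) (x : R) :
  is_derive x (1 : R) (flat k) (- k%:R * flat k.+1 x + flat k.+2 x).
Proof.
have [x0|x0|->] := ltgtP x 0.
- rewrite [X in is_derive _ _ _ X](_ : _ = 0); last first.
    by rewrite /flat ltNge ltW//= !(mulr0, addr0).
  apply: (@near_is_derive (cst 0)).
  near=> y; rewrite /cst /flat ifF//; apply/negbTE; rewrite -leNgt ltW//.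
  by near: y; exact: lt_nbhsl.
- pose h := fun y : R => y^-1 ^+ k * expR (- y^-1).
  apply: (@near_is_derive h).
    near=> y; rewrite /flat ifT//.
    by near: y; exact: lt_nbhsr.
  have x0' : x != 0 by rewrite gt_eqF.
  have [di Di] : is_derive x 1 (fun y : R => y^-1) (- x^-1 ^+ 2).
    apply: DeriveDef; first by apply: derivableV => //; exact: derivable_id.
    by rewrite (@deriveV _ _ id)// derive_id -[LHS]/(_ * _) mulr1 exprVn.
  have dfi : differentiable (fun y : R => y^-1) x by exact/derivable1_diffP.
  have dfn : differentiable (fun y : R => - y^-1) x by exact: differentiableN.
  have dfe : differentiable (@expR R) (- x^-1) by exact/derivable1_diffP/derivable_expR.
  have [dc Dc] := differentiable_comp_fun dfn dfe.
  have [dX DX] := deriveX_fun (1 : R) k dfi.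
  apply: DeriveDef; first exact/derivable1_diffP/differentiableM_fun.
  rewrite deriveM_fun// Dc.
  have -> : 'D_1 (fun y : R => - y^-1) x = x^-1 ^+ 2.
    by rewrite (@deriveN _ _ _ (fun y : R => y^-1))// Di opprK.
  have -> : 'd expR (- x^-1) (x^-1 ^+ 2) = x^-1 ^+ 2 * expR (- x^-1).
    rewrite -deriveE// -{1}[x^-1 ^+ 2]mulr1 -[x^-1 ^+ 2 * 1]/(x^-1 ^+ 2 *: (1 : R)).
    by rewrite deriveZ_dir// derive_val.
  rewrite DX Di.
  rewrite /flat x0; case: (k) => [|j]; first by rewrite !expr0 !exprS expr0; ring.
  by rewrite /= !exprS; ring.
- rewrite [X in is_derive _ _ _ X](_ : _ = 0); last first.
    by rewrite /flat ltxx/= !(mulr0, addr0).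
  have f0 j : flat j 0 = 0 by rewrite /flat ltxx.
  pose z : {linear R -> R} := \0.
  have [df dE] : differentiable (flat k) 0 /\ 'd (flat k) 0 = z :> (R -> R).
    apply: differentiable_at; first by move=> y; exact: cvg_cst.
    move=> e e0; have c0 : 0 < (k.+2)`!%:R :> R by rewrite ltr0n fact_gt0.
    exists (e / (k.+2)`!%:R) => [|h he]; first by rewrite divr_gt0.
    rewrite addr0 f0 subr0 /z/= subr0 (le_trans (flat_small _ _))//.
    rewrite -real_normK ?num_real// expr2 mulrA ler_wpM2r//.
    by rewrite mulrC -ler_pdivlMr// ltW.
  by apply: DeriveDef; [exact: diff_derivable|rewrite deriveE// dE].
Unshelve. all: by end_near. Qed.

Lemma smooth_flat k : smooth_on setT (flat k).
Proof.
pose B (f : R -> R) := (exists c, f = fun=> c) \/ (exists j, f = flat j).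
apply: (@smooth_on_generatedR _ B); [exact: openT|by move=> c; left; exists c| |by right; exists k].
move=> f [[c ->]|[j ->]].
  by exists (fun=> 0) => [|x _]; [by apply: gen_base; left; exists 0|exact: is_derive_cst].
exists (fun x => - j%:R * flat j.+1 x + flat j.+2 x) => [|x _]; last exact: is_derive_flat.
apply: gen_add; last by apply: gen_base; right; exists j.+2.
by apply: gen_mul; apply: gen_base; [left; exists (- j%:R)|right; exists j.+1].
Qed.

Lemma flat_gt0 k x : (0 < flat k x) = (0 < x).
Proof.
rewrite /flat; case: ifP => [x0|_]; last by rewrite ltxx.
by rewrite mulr_gt0 ?expR_gt0// exprn_gt0// invr_gt0.
Qed.

Lemma flat_ge0 k x : 0 <= flat k x.
Proof. by rewrite /flat; case: ifP => // x0; rewrite mulr_ge0 ?expR_ge0// exprn_ge0// invr_ge0 ltW. Qed.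

Lemma flat_eq0 k x : x <= 0 -> flat k x = 0.
Proof. by rewrite /flat leNgt => /negbTE ->. Qed.

Lemma smooth_on_comp1 (E : normedModType R) (U : set E) (W : set R) (h : R -> R)
    (f : E -> R) : open U -> smooth_on U f -> smooth_on W h ->
  (forall x, U x -> W (f x)) -> smooth_on U (fun x => h (f x)).
Proof.
by move=> oU sf sh; apply: (smooth_on_compose oU _ sh); exact: smooth_map_real.
Qed.

(** A smooth transition from 0 to 1 over the unit interval; consecutive integer
    translates differ by functions that add up to 1. *)
Definition step (x : R) : R := flat 0 x / (flat 0 x + flat 0 (1 - x)).

Lemma step_den_gt0 x : 0 < flat 0 x + flat 0 (1 - x).
Proof.
have [x0|x0] := ltP 0 x; first by rewrite ltr_wpDr ?flat_ge0// flat_gt0.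
by rewrite ltr_wpDl ?flat_ge0// flat_gt0 subr_gt0 (le_lt_trans x0).
Qed.

Lemma smooth_step : smooth_on setT step.
Proof.
have oT := @openT R.
have s1 : smooth_on setT (fun x : R => flat 0 (1 - x)).
  apply: (@smooth_on_comp1 _ _ setT) => //; last exact: smooth_flat.
  by apply: smooth_onB => //; [exact: smooth_on_cst|exact: smooth_idR].
apply: smooth_onM => //; first exact: smooth_flat.
apply: (@smooth_on_comp1 _ _ [set x | 0 < x] (fun x => x^-1)) => //.
- by apply: smooth_onD => //; exact: smooth_flat.
- exact: smooth_on_inv.
- by move=> x _; exact: step_den_gt0.
Qed.

Lemma step0 x : x <= 0 -> step x = 0.
Proof. by move=> x0; rewrite /step flat_eq0// mul0r. Qed.

Lemma step1 x : 1 <= x -> step x = 1.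
Proof.
move=> x1; rewrite /step [flat 0 (1 - x)]flat_eq0 ?subr_le0// addr0 divff//.
by rewrite gt_eqF// flat_gt0 (lt_le_trans _ x1).
Qed.

End one_variable.

(** * Linear functionals of finite order *)

Section functionals.
Context (R : realType) (n : nat).
Local Notation V := 'rV[R]_n.
Implicit Types (S : (V -> R) -> R) (phi : V -> R).

(** Functionals are total on R^n -> R and meaningful on smooth functions only. *)
Definition smooth_linear S := forall a phi psi, smooth phi -> smooth psi ->
  S (fun x => a * phi x + psi x) = a * S phi + S psi.

Definition order_bound (r : R) (N : nat) phi (M : R) :=
  forall s : seq 'I_n, (size s <= N)%N -> forall x, `|x| <= r ->
    `|iter_derive (map (@Defs.basis R n) s) phi x| <= M.

(** Continuity of a functional on smooth functions, phrased with upper bounds of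
    derivatives instead of the suprema in [seminorm].  In this form it is
    stable under the operations on functionals used below. *)
Definition finite_order S := exists (r : R) (N : nat) (C : R), 0 <= C /\
  forall phi M, smooth phi -> 0 <= M -> order_bound r N phi M -> `|S phi| <= C * M.

Lemma smooth0 : smooth (fun _ : V => 0 : R).
Proof. exact/smooth_on_cst/openT. Qed.

Lemma smooth_linear0 S : smooth_linear S -> S (fun=> 0) = 0.
Proof.
move=> lS; have := lS 1 _ _ smooth0 smooth0.
rewrite (_ : (fun x => _) = fun _ : V => 0 : R); last by apply/funext => x; rewrite mulr0 addr0.
by rewrite mul1r => /eqP; rewrite -subr_eq subrr eq_sym => /eqP.
Qed.

Lemma smooth_linear_sum S (I : Type) (r : seq I) (c : I -> R) (F : I -> V -> R) :
  smooth_linear S -> (forall i, smooth (F i)) ->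
  S (fun x => \sum_(i <- r) c i * F i x) = \sum_(i <- r) c i * S (F i).
Proof.
move=> lS sF; elim: r => [|i r IH].
  rewrite big_nil -{2}(smooth_linear0 lS); congr S.
  by apply/funext => x; rewrite big_nil.
rewrite big_cons -IH -lS//.
  by congr S; apply/funext => x; rewrite big_cons.
apply: smooth_on_sum => [|j _]; first exact: openT.
by apply: smooth_onZ; [exact: openT|exact: sF].
Qed.

Lemma smooth_linearZ S a phi : smooth_linear S -> smooth phi ->
  S (fun x => a * phi x) = a * S phi.
Proof.
move=> lS sphi; rewrite -[RHS]addr0 -(smooth_linear0 lS) -lS//; last exact: smooth0.
by congr S; apply/funext => x; rewrite addr0.
Qed.

Lemma smooth_linearB S phi psi : smooth_linear S -> smooth phi -> smooth psi ->
  S (fun x => phi x - psi x) = S phi - S psi.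
Proof.
move=> lS sphi spsi; rewrite addrC -[- S psi]mulN1r -lS//.
by congr S; apply/funext => x; rewrite mulN1r addrC.
Qed.

(** Compact support of the functional. *)
Lemma finite_order_local S : smooth_linear S -> finite_order S ->
  exists2 r : R, 0 < r & forall phi psi, smooth phi -> smooth psi ->
    (forall x, `|x| < r -> phi x = psi x) -> S phi = S psi.
Proof.
move=> lS [r [N [C [C0 SC]]]]; exists (`|r| + 1) => [|phi psi sphi spsi E].
  by rewrite ltr_wpDl.
have sB : smooth (fun x => phi x - psi x) by apply: smooth_onB => //; exact: openT.
apply/eqP; rewrite -subr_eq0 -smooth_linearB// -normr_le0 -(mulr0 C).
apply: SC => // s _ x xr.
pose W := [set x : V | `|x| < `|r| + 1].
have oW : open W.
  rewrite (_ : W = @Num.norm R V @^-1` [set y | y < `|r| + 1])//.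
  by apply: open_comp; [move=> ? _; exact: norm_continuous|exact: open_lt].
have Wx : W x by rewrite /W/= (le_lt_trans xr)// ltr_pwDr// ler_norm.
rewrite (@eq_on_iter_derive _ _ W _ (fun=> 0))//; last first.
  by move=> y Wy; rewrite E// subrr.
suff -> : iter_derive [seq Defs.basis R i | i <- s] (fun _ : V => 0 : R) = fun=> 0.
  by rewrite normr0.
elim: (map _ s) => //= v t ->; apply/funext => y; exact: derive_cst.
Qed.

Lemma cs_smooth_linear (f : cs_distribution R n) : smooth_linear f.
Proof. by move=> a phi psi; exact: distr_linear. Qed.

(** The compact set of the continuity estimate may be enlarged to a ball. *)
Lemma cs_finite_order (f : cs_distribution R n) : finite_order f.
Proof.
have [K [N [C [cK fC]]]] := distr_continuous f.
have [M0 [_ KM]] := compact_bounded cK.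
pose r := `|M0| + 1.
have Kr x : K x -> `|x| <= r.
  by apply: KM; rewrite /r ltr_pwDr// ler_norm.
exists r, N, `|C|; split=> // phi M sphi M0' HM.
have sup_le : seminorm K N phi <= M.
  rewrite /seminorm; set A := [set _ | _].
  have [A0|/set0P A0] := eqVneq A set0; first by rewrite A0 sup0.
  by apply: ge_sup => // _ [s [x [sN Kx ->]]]; apply: HM => //; exact: Kr.
have sup_ge : 0 <= seminorm K N phi.
  rewrite /seminorm; set A := [set _ | _].
  have [A0|/set0P A0] := eqVneq A set0; first by rewrite A0 sup0.
  have [y [s [x [sN Kx yE]]]] := A0.
  apply: le_trans (normr_ge0 (iter_derive (map (@Defs.basis R n) s) phi x)) _.
  apply: sup_ubound; last by exists s, x.
  by exists M => _ [s' [x' [sN' Kx' ->]]]; apply: HM => //; exact: Kr.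
apply: le_trans (fC _ sphi) _; apply: (@le_trans _ _ (`|C| * seminorm K N phi)).
  by rewrite ler_wpM2r// ler_norm.
by rewrite ler_wpM2l.
Qed.

Lemma smooth_derive phi v : smooth phi -> smooth (fun x => 'D_v phi x).
Proof. exact: smooth_on_derive. Qed.

End functionals.

Lemma derive_invariant (R : realType) (E : normedModType R) (f : E -> R) (p v : E) :
  (forall t : R, f (p + t *: v) = f p) -> 'D_v f p = 0.
Proof.
move=> fv; rewrite /derive (_ : (fun h => _) = cst 0); first exact: lim_cst.
by apply/funext => h /=; rewrite (addrC (h *: v)) fv subrr scaler0.
Qed.

(** * The adjoint X-ray transform is divergence free *)

Section adjoint.
Context (R : realType) (n : nat).
Local Notation V := 'rV[R]_n.
Local Notation O := (slab (nonzero (R := R) (n := n)) : set (V * V)).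

Lemma smooth_inv_enorm : smooth_on (nonzero (R := R) (n := n)) (fun x => (enorm x)^-1).
Proof.
apply: (@smooth_on_comp1 _ _ _ [set x | 0 < x] (fun u => (Num.sqrt u)^-1)).
- exact: open_nonzero.
- by apply: smooth_dot => [|i|i]; [exact: open_nonzero|
    exact/smooth_coord/open_nonzero|exact/smooth_coord/open_nonzero].
- exact: smooth_on_invsqrt.
- by move=> x x0; rewrite /= lt_def dot_eq0 dot_ge0 andbT.
Qed.

Lemma open_O : open O.
Proof. exact/open_slab/open_nonzero. Qed.

Lemma smooth_unit_dir : smooth_map O (fun p : V * V => unit_dir p.2).
Proof.
apply: smooth_map_mul; [exact: open_O| |exact/smooth_snd/open_O].
apply: (@smooth_on_compose R (V * V)%type V O (@nonzero R n) (fun x : V => (enorm x)^-1) (fun p => p.2)) => //.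
- exact: open_O.
- exact/smooth_snd/open_O.
- exact: smooth_inv_enorm.
Qed.

(** Defined for every nonzero direction, so that it is a smooth map from an
    open set; restricted to unit directions, it gives the argument of psi in
    [xray_adjoint]. *)
Definition line_of (p : V * V) : V * V :=
  (p.1 - dot p.1 (unit_dir p.2) *: unit_dir p.2, unit_dir p.2).

Lemma smooth_map_coord (E : normedModType R) (U : set E) (P : E -> V) i : open U ->
  smooth_map U P -> smooth_on U (fun x => P x 0 i).
Proof.
move=> oU sP; apply: (@smooth_on_compose _ _ V U setT (fun y => y 0 i) P) => //.
exact/smooth_coord/openT.
Qed.

Lemma smooth_line_of : smooth_map O line_of.
Proof.
have oO := open_O; have su := smooth_unit_dir.
apply: smooth_map_pair => //.
apply: smooth_map_add; first exact: smooth_fst.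
apply: smooth_map_opp => //; apply: smooth_map_mul => //.
apply: smooth_dot => // i; apply: smooth_map_coord => //; exact: smooth_fst.
Qed.

Lemma line_of_lines p : O p -> lines (line_of p).
Proof.
move=> p0; split; first exact: enorm_unit_dir.
rewrite /line_of/= dotDl dotNl dotZl -enorm_sqr enorm_unit_dir//.
by rewrite expr1n mulr1 subrr.
Qed.

Lemma line_of_unit x theta : enorm theta = 1 ->
  line_of (x, theta) = (x - dot x theta *: theta, theta).
Proof. by move=> t1; rewrite /line_of/= unit_dir_id. Qed.

(** Smoothness of psi on the submanifold only provides local extensions; these
    suffice because [line_of] takes its values in the submanifold. *)
Lemma smooth_pullback psi : smooth_on_submanifold (@lines R n) psi ->
  smooth_on O (fun p => psi (line_of p)).
Proof.
move=> spsi; apply: smooth_on_local => q Oq.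
have [U [g [oU Uq sg psig]]] := spsi _ (line_of_lines Oq).
pose W := O `&` line_of @^-1` U.
have oW : open W.
  rewrite openE => p [Op Up]; apply: filterI.
    exact: open_nbhs_nbhs (conj open_O Op).
  have cl : {for p, continuous line_of}.
    apply: differentiable_continuous.
    exact: smooth_map_differentiable open_O smooth_line_of Op.
  by apply: cl; exact: open_nbhs_nbhs (conj oU Up).
exists W; split=> //.
apply: (@eq_smooth_on _ _ W (fun p => g (line_of p))) => //.
  move=> p [Op Up]; rewrite psig//; rewrite inE; split=> //.
  exact: line_of_lines.
apply: (@smooth_on_compose _ _ _ W U g line_of) => //; last by move=> p [].
have [m [b [phi [sphi E]]]] := smooth_line_of.
exists m, b, phi; split=> [i|x [Ox _]]; last exact: E.
by apply: smooth_on_sub (sphi i) => p [].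
Qed.

Definition adjoint_kernel (psi : V * V -> R) i (p : V * V) : R :=
  unit_dir p.2 0 i * psi (line_of p).

Lemma smooth_adjoint_kernel psi i : smooth_on_submanifold (@lines R n) psi ->
  smooth_on O (adjoint_kernel psi i).
Proof.
move=> spsi; apply: smooth_onM; first exact: open_O.
  by apply: smooth_map_coord; [exact: open_O|exact: smooth_unit_dir].
exact: smooth_pullback.
Qed.

Lemma xray_adjointE psi i : xray_adjoint psi i = sphere_param (adjoint_kernel psi i).
Proof.
apply/funext => x; apply: eq_sphere_integral => theta t1.
by rewrite /adjoint_kernel line_of_unit//= unit_dir_id.
Qed.

Lemma smooth_xray_adjoint psi i : smooth_on_submanifold (@lines R n) psi ->
  smooth (xray_adjoint psi i).
Proof.
by move=> spsi; rewrite xray_adjointE; apply: sphere_param_smooth; exact: smooth_adjoint_kernel.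
Qed.

Lemma slice_continuous (Phi : V * V -> R) x : smooth_on O Phi ->
  forall y, nonzero y -> {for y, continuous (fun theta => Phi (x, theta))}.
Proof.
move=> sPhi y y0; apply: differentiable_continuous.
apply: (@differentiable_comp_fun _ _ _ _ Phi (fun y => (x, y)) y _ _).1.
  by apply: (@differentiable_pair _ _ _ _ (cst x) id) => //; exact: differentiable_cst.
exact: (smooth_on_differentiable sPhi).
Qed.

Lemma derive_adjoint_kernel psi i x theta (v : V) :
  smooth_on_submanifold (@lines R n) psi -> enorm theta = 1 ->
  'D_(v, 0) (adjoint_kernel psi i) (x, theta) =
  theta 0 i * 'D_(v, 0) (fun p => psi (line_of p)) (x, theta).
Proof.
move=> spsi t1; have Oq : O (x, theta) by exact: unit_sphere_nonzero.
have su := smooth_map_coord i open_O smooth_unit_dir.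
rewrite deriveM_fun.
- rewrite (@derive_invariant _ _ (fun p : V * V => unit_dir p.2 0 i)).
    by rewrite mul0r addr0 /= unit_dir_id.
  by move=> t; rewrite /= scaler0 addr0.
- exact: smooth_on_differentiable su Oq.
- exact: smooth_on_differentiable (smooth_pullback spsi) Oq.
Qed.

(** Differentiate under the integral: the divergence of the integrand is its
    derivative along theta, and moving x along theta does not change the line. *)
Lemma xray_adjoint_div0 psi x : smooth_on_submanifold (@lines R n) psi ->
  \sum_i partial i (xray_adjoint psi i) x = 0.
Proof.
move=> spsi.
pose D i (p : V * V) := 'D_(basis R i, 0) (adjoint_kernel psi i) p.
have sD i : smooth_on O (D i).
  by apply: smooth_on_derive; exact: smooth_adjoint_kernel.
transitivity (\sum_i 1 * sphere_integral (fun theta => D i (x, theta))).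
  apply: eq_bigr => i _; rewrite mul1r /partial xray_adjointE.
  have := sphere_param_derive (basis R i) (smooth_adjoint_kernel i spsi).
  by move=> /(congr1 (@^~ x)).
rewrite -(@sphere_integral_sum _ _ _ _ (fun=> 1) (fun i theta => D i (x, theta))); last first.
  by move=> i; exact: slice_continuous.
rewrite (@eq_sphere_integral _ _ _ (fun=> 0)).
  by rewrite sphere_integralE Rintegral_cst ?mul0r ?mulr0//; exact: measurable_punctured_ball.
move=> theta t1; have Oq : O (x, theta) by exact: unit_sphere_nonzero.
transitivity ('D_(theta, 0) (fun p => psi (line_of p)) (x, theta)).
  rewrite derive_pair0; last exact: smooth_on_differentiable (smooth_pullback spsi) Oq.
  apply: eq_bigr => i _; rewrite mul1r; exact: derive_adjoint_kernel.
apply: derive_invariant => t.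
have -> : (x, theta) + t *: ((theta, 0) : (V * V)%type) = (x + t *: theta, theta).
  by rewrite -[LHS]/(_, _)/= scaler0 addr0.
rewrite !line_of_unit//; congr psi; congr (_, _).
rewrite dotDl dotZl -enorm_sqr t1 expr1n mulr1 scalerDl opprD addrACA.
by rewrite subrr addr0.
Qed.

(** Move the partial derivatives from u to the adjoint transform, whose
    divergence is zero. *)
Theorem xray_of_differential (f : 'I_n -> cs_distribution R n) (u : cs_distribution R n)
    psi : smooth_on_submanifold (@lines R n) psi -> is_differential f u ->
  xray f psi = 0.
Proof.
move=> spsi fu; rewrite /xray /pairing.
transitivity (\sum_i (-1) * u (partial i (xray_adjoint psi i))).
  by apply: eq_bigr => i _; rewrite fu ?mulN1r//; exact: smooth_xray_adjoint.
rewrite -smooth_linear_sum; [|exact: cs_smooth_linear|]; last first.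
  by move=> i; apply: smooth_derive; exact: smooth_xray_adjoint.
rewrite -[RHS](smooth_linear0 (cs_smooth_linear u)); congr (distr_fun u _).
by apply/funext => x; rewrite -mulr_sumr xray_adjoint_div0// mulr0.
Qed.

End adjoint.

Section interval_linearity.
Context (R : realType) (a b : R).
Local Notation mu := (@lebesgue_measure R).

Lemma itv_Rintegral_lin c (f g : R -> R) : bounded_on `[a, b] f -> bounded_on `[a, b] g ->
  \int[mu]_(t in `[a, b]) (c * f t + g t) =
  c * \int[mu]_(t in `[a, b]) f t + \int[mu]_(t in `[a, b]) g t.
Proof.
exact: (@Rintegral_lin _ _ _ mu `[a, b]%classic (measurable_itv _) (itv_finite_measure a b)).
Qed.

Lemma itv_Rintegral_bound (f : R -> R) M : a <= b -> bounded_on `[a, b] f ->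
  (forall t, `[a, b]%classic t -> `|f t| <= M) ->
  `|\int[mu]_(t in `[a, b]) f t| <= M * (b - a).
Proof.
move=> ab bf fM; apply: le_trans (@Rintegral_bound _ _ _ mu `[a, b]%classic
  (measurable_itv _) (itv_finite_measure a b) _ _ bf fM) _.
rewrite le_eqVlt; apply/orP; left; apply/eqP; congr (_ * _).
transitivity (fine (lebesgue_measure (`[a, b]%classic : set R))); first by [].
rewrite lebesgue_measure_itv/= lte_fin; case: ltP => // ba.
by have -> : a = b by [apply/eqP; rewrite eq_le ab]; rewrite subrr.
Qed.

End interval_linearity.

(** Chain rule for affine substitutions: a directional derivative only depends
    on the restriction of the function to a line. *)
Lemma derive_curve_eq (R : realType) (E F : normedModType R) (f : E -> R)
    (g : F -> R) (p v : E) (q w : F) :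
  (forall t : R, f (p + t *: v) = g (q + t *: w)) -> 'D_v f p = 'D_w g q.
Proof.
move=> fg; rewrite /derive.
rewrite (_ : (fun h => h^-1 *: _) = fun h => h^-1 *: ((g \o shift q) (h *: w) - g q))//.
apply/funext => h /=; rewrite (addrC (h *: v)) (addrC (h *: w)) fg.
by have := fg 0; rewrite !scale0r !addr0 => ->.
Qed.

(** * Closed covectors of compactly supported distributions are exact *)

Section primitive.
Context (R : realType) (n : nat).
Local Notation V := 'rV[R]_n.
Local Notation e := (@Defs.basis R n).
Implicit Types (k i : 'I_n) (g : V -> R) (x : V).

(** The segment from x to its projection on the hyperplane x_k = 0 is traced by
    c from 1 to 0. *)
Definition shrink k (c : R) (x : V) : V := x + ((c - 1) * x 0 k) *: e k.

Lemma shrinkE k c x j : shrink k c x 0 j = if j == k then c * x 0 k else x 0 j.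
Proof.
rewrite /shrink !mxE eqxx /=; case: eqP => [->|_] /=; last by rewrite mulr0 addr0.
by rewrite mulr1; ring.
Qed.

Lemma shrink_lin k c t x y : shrink k c (x + t *: y) = shrink k c x + t *: shrink k c y.
Proof. by apply/rowP => j; rewrite !(shrinkE, mxE); case: ifP => // _; ring. Qed.

Lemma shrink1 k x : shrink k 1 x = x.
Proof. by rewrite /shrink subrr mul0r scale0r addr0. Qed.

Lemma norm_shrink k c x : 0 <= c <= 1 -> `|shrink k c x| <= `|x|.
Proof.
move=> /andP[c0 c1]; apply: norm_le_coord => // j; rewrite shrinkE.
case: ifP => _; last exact: coord_le_norm.
by rewrite normrM ger0_norm// (le_trans (ler_piMl _ c1))// coord_le_norm.
Qed.

Definition prim_kernel k g (p : V * R) : R := p.1 0 k * g (shrink k p.2 p.1).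

Local Notation O := (slab (setT : set R) : set (V * R)).

Lemma open_OR : open O.
Proof. exact/open_slab/openT. Qed.

Lemma smooth_coord_fst k : smooth_on O (fun p : V * R => p.1 0 k).
Proof.
by apply: smooth_map_coord; [exact: open_OR|exact: smooth_fst open_OR].
Qed.

Lemma smooth_shrink k : smooth_map O (fun p : V * R => shrink k p.2 p.1).
Proof.
have oO := open_OR.
apply: smooth_map_add; first exact: smooth_fst.
apply: smooth_map_scale; apply: smooth_onM => //; last exact: smooth_coord_fst.
by apply: smooth_onB => //; [exact: smooth_sndR|exact: smooth_on_cst].
Qed.

Lemma smooth_prim_kernel k g : smooth g -> smooth_on O (prim_kernel k g).
Proof.
move=> sg; apply: smooth_onM; [exact: open_OR|exact: smooth_coord_fst|].
exact: (@smooth_on_compose _ _ _ O setT g _ open_OR (smooth_shrink k) sg).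
Qed.

(** The primitive int_0^{x_k} g in the k-th variable, written over a fixed
    interval to make it a parametric integral. *)
Definition prim k g : V -> R := itv_int 0 1 (prim_kernel k g).

Lemma smooth_prim k g : smooth g -> smooth (prim k g).
Proof.
move=> sg; apply: (@itv_int_smooth _ _ 0 1 setT) => //; first exact: openT.
exact: smooth_prim_kernel.
Qed.

Lemma derive_prim_kernel k g (w : V) x (c : R) : smooth g ->
  'D_(w, 0) (prim_kernel k g) (x, c) =
  x 0 k * 'D_(shrink k c w) g (shrink k c x) + w 0 k * g (shrink k c x).
Proof.
move=> sg; have lineE t : (x, c) + t *: ((w, 0) : (V * R)%type) = (x + t *: w, c).
  by rewrite -[LHS]/(_, _)/= scaler0 addr0.
have sgs : smooth_on O (fun p : V * R => g (shrink k p.2 p.1)).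
  exact: (@smooth_on_compose _ _ _ O setT g _ open_OR (smooth_shrink k) sg).
have A : 'D_(w, 0) (fun p : V * R => g (shrink k p.2 p.1)) (x, c) =
    'D_(shrink k c w) g (shrink k c x).
  by apply: derive_curve_eq => t; rewrite lineE/= shrink_lin.
have dc : differentiable (fun y : V => y 0 k) x by exact: differentiable_coord.
have B : 'D_(w, 0) (fun p : V * R => p.1 0 k) (x, c) = 'D_w (fun y : V => y 0 k) x.
  by apply: derive_curve_eq => t; rewrite lineE.
have d1 : differentiable (fun p : V * R => p.1 0 k) (x, c).
  exact: smooth_on_differentiable (smooth_coord_fst k) _.
have d2 : differentiable (fun p : V * R => g (shrink k p.2 p.1)) (x, c).
  exact: smooth_on_differentiable sgs _.
rewrite (deriveM_fun (w, 0) d1 d2) A B /=; congr (_ + _ * _).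
rewrite derive_coord_form// /coord_form (bigD1 k)//= big1 ?addr0.
  rewrite (@derive_curve_eq _ _ R _ (fun u => u) _ _ (x 0 k) 1).
    by rewrite derive_id mulr1.
  by move=> t; rewrite !mxE !eqxx.
move=> i ik; rewrite derive_invariant ?mulr0// => t.
by rewrite !mxE eqxx (eq_sym k) (negbTE ik) mulr0 addr0.
Qed.

(** In the direction k the integrand is the derivative in c of
    c g (shrink k c x); the other partial derivatives pass under the integral. *)
Lemma derive_prim k g i x : smooth g ->
  'D_(e i) (prim k g) x = if i == k then g x else prim k (fun y => 'D_(e i) g y) x.
Proof.
move=> sg; rewrite (@itv_int_derive _ _ 0 1 setT)//; [|exact: openT|exact: smooth_prim_kernel].
rewrite /prim /itv_int; have dg y : differentiable g y by exact: smooth_on_differentiable sg _.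
case: eqP => [->|/eqP ik]; last first.
  apply: eq_Rintegral => c _; rewrite derive_prim_kernel//.
  have eik : e i 0 k = 0 :> R by rewrite mxE eq_sym (negbTE ik) andbF.
  by rewrite eik mul0r addr0 /shrink eik mulr0 scale0r addr0.
have oT := @openT R.
pose G (c : R) := g (shrink k 0 x + c *: (x 0 k *: e k)).
have lineE c : shrink k 0 x + c *: (x 0 k *: e k) = shrink k c x.
  by rewrite /shrink scalerA -addrA -scalerDl; congr (_ + _ *: _); ring.
pose f (c : R) := c * 'D_(x 0 k *: e k) g (shrink k c x) + g (shrink k c x).
have dG (c : R) : is_derive c 1 (fun c => c * G c) (f c).
  have [dl Dl] := @line_is_derive _ _ g (shrink k 0 x) (x 0 k *: e k) c (dg _).
  have dG : differentiable G c by exact/derivable1_diffP.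
  have di : differentiable (fun c : R => c) c by exact: ex_diff.
  apply: DeriveDef; first exact/diff_derivable/differentiableM_fun.
  by rewrite deriveM_fun// Dl derive_id mul1r /G /f lineE.
transitivity (\int[@lebesgue_measure R]_(c in `[0, 1]) f c).
  apply: eq_Rintegral => c _; rewrite derive_prim_kernel//.
  have ekk : e k 0 k = 1 :> R by rewrite mxE !eqxx.
  have -> : shrink k c (e k) = c *: e k.
    by rewrite /shrink ekk mulr1 -{1}(scale1r (e k)) -scalerDl addrC subrK.
  by rewrite ekk /f !deriveZ_dir//; ring.
rewrite (@itv_FTC _ 0 1 setT _ (fun c => c * G c))//.
  by rewrite mul1r mul0r subr0 /G lineE shrink1.
move=> c _; rewrite /f.
have cu : smooth_on setT (fun c : R => c * 'D_(x 0 k *: e k) g (shrink k c x) + g (shrink k c x)).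
  have sl : smooth_map setT (fun c : R => shrink k c x).
    apply: smooth_map_add; first exact: smooth_map_cst.
    apply: smooth_map_scale; apply: smooth_onM => //; last exact: smooth_on_cst.
    by apply: smooth_onB => //; [exact: smooth_idR|exact: smooth_on_cst].
  apply: smooth_onD => //; last exact: smooth_on_compose sl sg _.
  apply: smooth_onM => //; first exact: smooth_idR.
  exact: (smooth_on_compose oT sl (smooth_on_derive (x 0 k *: e k) sg)).
exact/differentiable_continuous/(smooth_on_differentiable cu).
Qed.

Lemma prim_derive k g x : smooth g ->
  prim k (fun y => 'D_(e k) g y) x = g x - g (shrink k 0 x).
Proof.
move=> sg; have oT := @openT R.
have dg y : differentiable g y by exact: smooth_on_differentiable sg _.
pose G (c : R) := g (shrink k 0 x + c *: (x 0 k *: e k)).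
have lineE c : shrink k 0 x + c *: (x 0 k *: e k) = shrink k c x.
  by rewrite /shrink scalerA -addrA -scalerDl; congr (_ + _ *: _); ring.
pose f (c : R) := 'D_(x 0 k *: e k) g (shrink k 0 x + c *: (x 0 k *: e k)).
transitivity (\int[@lebesgue_measure R]_(c in `[0, 1]) f c).
  by apply: eq_Rintegral => c _; rewrite /f lineE deriveZ_dir.
have dG (t : R) : setT t -> is_derive t 1 G (f t) by move=> _; exact: line_is_derive.
have cf (t : R) : setT t -> {for t, continuous f}.
  move=> _; apply: (@line_continuous _ _ (fun y => 'D_(x 0 k *: e k) g y)).
  exact: smooth_on_differentiable (smooth_on_derive _ sg) _.
rewrite (@itv_FTC R 0 1 setT (fun _ _ => I) G f ltr01 dG cf).
by rewrite /G !lineE shrink1.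
Qed.

Lemma prim_linear k a g h x : smooth g -> smooth h ->
  prim k (fun y => a * g y + h y) x = a * prim k g x + prim k h x.
Proof.
move=> sg sh; have bk u : smooth u -> bounded_on `[(0:R), 1] (fun c => prim_kernel k u (x, c)).
  move=> su; apply: (@itv_bounded_on _ 0 1 setT) => // c _; apply: differentiable_continuous.
  apply: (@differentiable_comp_fun _ _ _ _ (prim_kernel k u) (fun c => (x, c)) c _ _).1.
    by apply: (@differentiable_pair _ _ _ _ (cst x) id) => //; exact: differentiable_cst.
  exact: (smooth_on_differentiable (smooth_prim_kernel k su)).
rewrite /prim /itv_int -(@itv_Rintegral_lin R 0 1 a _ _ (bk _ sg) (bk _ sh)).
by apply: eq_Rintegral => c _; rewrite /prim_kernel /=; ring.
Qed.

Lemma prim_bound k g x r M : smooth g -> `|x| <= r ->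
  (forall y, `|y| <= r -> `|g y| <= M) -> `|prim k g x| <= r * M.
Proof.
move=> sg xr gM; have bk : bounded_on `[(0:R), 1] (fun c => prim_kernel k g (x, c)).
  apply: (@itv_bounded_on _ 0 1 setT) => // c _; apply: differentiable_continuous.
  apply: (@differentiable_comp_fun _ _ _ _ (prim_kernel k g) (fun c => (x, c)) c _ _).1.
    by apply: (@differentiable_pair _ _ _ _ (cst x) id) => //; exact: differentiable_cst.
  exact: (smooth_on_differentiable (smooth_prim_kernel k sg)).
have kM c : `[0, 1]%classic c -> `|prim_kernel k g (x, c)| <= r * M.
  rewrite /= in_itv/= => c01; rewrite /prim_kernel/= normrM ler_pM//.
    by rewrite (le_trans (coord_le_norm _ _)).
  by apply: gM; rewrite (le_trans (norm_shrink k x c01)).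
apply: le_trans (itv_Rintegral_bound ler01 bk kM) _.
by rewrite subr0 mulr1.
Qed.

(** Either no derivative is in the direction k, or the first one that is removes
    the integral. *)
Lemma iter_derive_prim k g (s : seq 'I_n) : smooth g ->
  iter_derive (map e s) (prim k g) = prim k (iter_derive (map e s) g) \/
  exists2 t : seq 'I_n, (size t < size s)%N &
    iter_derive (map e s) (prim k g) = iter_derive (map e t) g.
Proof.
move=> sg; elim: s => [|i s [IH|[t ts IH]]]; first by left.
  have si : smooth (iter_derive (map e s) g) by exact: smooth_on_iter.
  have [->|ik] := eqVneq i k.
    right; exists s => //=; rewrite IH; apply/funext => x.
    by rewrite derive_prim// eqxx.
  left; rewrite /= IH; apply/funext => x.
  by rewrite derive_prim// (negbTE ik).
by right; exists (i :: t) => //=; rewrite IH.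
Qed.

(** Hence composing with [prim] preserves finite order. *)
Lemma prim_order_bound k g r N M : 0 <= r -> smooth g -> 0 <= M ->
  order_bound r N g M -> order_bound r N (prim k g) ((1 + r) * M).
Proof.
move=> r0 sg M0 gM s sN x xr; have [->|[t ts ->]] := iter_derive_prim k s sg.
  apply: (@le_trans _ _ (r * M)); last by rewrite mulrDl mul1r lerDr.
  by apply: prim_bound => //; [exact: smooth_on_iter|move=> y; exact: gM].
apply: le_trans (gM t (leq_trans (ltnW ts) sN) x xr) _.
by rewrite mulrDl mul1r lerDl mulr_ge0.
Qed.

Lemma order_bound_exists r N g : smooth g -> exists2 M, 0 <= M & order_bound r N g M.
Proof.
exact: (@iter_derive_bound _ _ _ e _ setT g N (@compact_cball R n r) (@subsetT _ _)).
Qed.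

Lemma order_bound_seminorm r N g : smooth g ->
  order_bound r N g (seminorm (cball (n := n) r) N g).
Proof.
move=> sg s sN x xr; have [M _ MP] := order_bound_exists r N sg.
apply: sup_ubound; last by exists s, x.
by exists M => _ [t [y [tN yr ->]]]; exact: MP.
Qed.

Lemma seminorm_ge0 r N g : 0 <= r -> smooth g -> 0 <= seminorm (cball (n := n) r) N g.
Proof.
move=> r0 sg; apply: le_trans (order_bound_seminorm sg (leq0n N : size [::] <= N)%N (x := 0) _).
  exact: normr_ge0.
by rewrite normr0.
Qed.

(** The radius in [finite_order] is arbitrary; replacing it by its absolute
    value makes the ball nonempty and hence [seminorm] nonnegative. *)
Lemma finite_order_distribution (S : (V -> R) -> R) : smooth_linear S -> finite_order S ->
  exists u : cs_distribution R n, u = S :> ((V -> R) -> R).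
Proof.
move=> lS [r [N [C [C0 SC]]]].
have cS : exists (K : set V) (N : nat) (C : R), compact K /\
    forall phi, smooth phi -> `|S phi| <= C * seminorm K N phi.
  exists (cball `|r|), N, C; split; first exact: compact_cball.
  move=> phi sphi; apply: SC => //; first exact: seminorm_ge0.
  move=> s sN x xr; apply: order_bound_seminorm => //.
  by rewrite (le_trans xr)// ler_norm.
by exists (CSDistribution lS cS).
Qed.

(** The potential is u(g) = - f_k(prim k g).  In direction i <> k, closedness
    moves the derivative from f_k to f_i and [prim] is undone.  In direction k
    there remains f_k(v) with v = w on the hyperplane x_k = 0, extended
    constantly in x_k; writing v as a derivative in the second direction l and
    using closedness once more gives f_l(partial_k (prim l v)), which is zero
    since v does not depend on x_k. *)
Theorem closed_exact (f : 'I_n -> cs_distribution R n) k l : k != l ->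
  (forall i j h, smooth h -> f i (partial j h) = f j (partial i h)) ->
  exists u : cs_distribution R n, is_differential f u.
Proof.
move=> kl closed; pose S g := -1 * f k (prim k g).
have lS : smooth_linear S.
  move=> a g h sg sh; rewrite /S.
  have -> : prim k (fun x => a * g x + h x) = fun x => a * prim k g x + prim k h x.
    by apply/funext => x; rewrite prim_linear.
  by rewrite cs_smooth_linear; [ring|exact: smooth_prim|exact: smooth_prim].
have oS : finite_order S.
  have [r [N [C [C0 fC]]]] := cs_finite_order (f k).
  exists `|r|, N, (C * (1 + `|r|)); split; first by rewrite mulr_ge0// addr_ge0.
  move=> g M sg M0 gM; rewrite /S normrM normrN1 mul1r -mulrA; apply: fC.
  - exact: smooth_prim.
  - by rewrite mulr_ge0// addr_ge0.
  - move=> s sN x xr; apply: (prim_order_bound k (normr_ge0 r) sg M0 gM sN).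
    exact: le_trans xr (ler_norm r).
have [u uS] := finite_order_distribution lS oS.
exists u => i w sw; rewrite /distr_partial uS /S mulN1r opprK.
have [->|ik] := eqVneq i k; last first.
  have -> : prim k (partial i w) = partial i (prim k w).
    by apply/funext => x; rewrite /partial derive_prim// (negbTE ik).
  rewrite closed; last exact: smooth_prim.
  by congr (distr_fun (f i) _); apply/funext => x; rewrite /partial derive_prim// eqxx.
pose v y := w (shrink k 0 y).
have sv : smooth v.
  have oT := @openT V.
  apply: (@smooth_on_compose _ _ _ setT setT w _ oT) => //.
  apply: smooth_map_add; first exact: smooth_id.
  apply: smooth_map_scale; apply: smooth_onM => //; last exact: smooth_coord.
  exact: smooth_on_cst.
have -> : prim k (partial k w) = fun x => w x - v x.
  by apply/funext => x; rewrite prim_derive.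
rewrite smooth_linearB//; last exact: cs_smooth_linear.
suff -> : f k v = 0 by rewrite subr0.
have -> : v = partial l (prim l v).
  by apply/funext => x; rewrite /partial derive_prim// eqxx.
rewrite closed; last exact: smooth_prim.
rewrite -(smooth_linear0 (cs_smooth_linear (f l))).
congr (distr_fun (f l) _); apply/funext => x; rewrite /partial derive_prim// (negbTE kl).
have -> : (fun y => 'D_(e k) v y) = fun=> 0.
  apply/funext => y; apply: derive_invariant => t; congr w.
  apply/rowP => j; rewrite !shrinkE; case: (eqVneq j k) => [_|jk]; first by rewrite !mul0r.
  by rewrite !mxE eqxx (negbTE jk) mulr0 addr0.
transitivity (\int[@lebesgue_measure R]_(c in `[0, 1]) (fun=> 0 : R) c).
  by apply: eq_Rintegral => c _; rewrite /prim_kernel mulr0.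
by rewrite Rintegral_cst// mul0r.
Qed.

End primitive.

Lemma iter_derive_lin (R : realType) (E : normedModType R) (a : R) (f g : E -> R)
    (s : seq E) : smooth f -> smooth g ->
  iter_derive s (fun x => a * f x + g x) =
  fun x => a * iter_derive s f x + iter_derive s g x.
Proof.
move=> sf sg; have oT := @openT E; elim: s => //= v s ->; apply/funext => x.
have s1 : smooth (iter_derive s f) by exact: smooth_on_iter.
have s2 : smooth (iter_derive s g) by exact: smooth_on_iter.
have d1 : differentiable (fun x => a * iter_derive s f x) x.
  exact: smooth_on_differentiable (smooth_onZ a oT s1) _.
rewrite deriveD_fun//; last exact: smooth_on_differentiable s2 _.
rewrite (@deriveM_fun _ _ (cst a)).
- by rewrite derive_cst mul0r addr0.
- exact: differentiable_cst.
- exact: smooth_on_differentiable s1 _.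
Qed.

(** * Weights concentrating at a direction *)

Section concentration.
Context (R : realType) (n : nat).
Local Notation V := 'rV[R]_n.
Local Notation e := (@Defs.basis R n).
Local Notation hor s := [seq ((v, 0) : (V * V)%type) | v <- s].

Lemma sphere_integral0 : sphere_integral (fun _ : V => 0 : R) = 0.
Proof.
by rewrite sphere_integralE Rintegral_cst ?mul0r ?mulr0//; exact: measurable_punctured_ball.
Qed.

Lemma iter_derive_slice (Phi : V * V -> R) s x theta :
  iter_derive (hor s) Phi (x, theta) = iter_derive s (fun y => Phi (y, theta)) x.
Proof.
elim: s x => //= v s IH x; apply: derive_curve_eq => t; rewrite -IH.
by congr (iter_derive _ _ _); rewrite -[LHS]/(_, _)/= scaler0 addr0.
Qed.

(** The weight does not depend on the variable that is differentiated. *)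
Lemma iter_derive_weight (a : V -> R) (Phi : V * V -> R) s p : smooth a ->
  smooth_on setT Phi ->
  iter_derive (hor s) (fun p => a p.2 * Phi p) p = a p.2 * iter_derive (hor s) Phi p.
Proof.
move=> sa sPhi; have oT := @openT (V * V)%type.
have sa2 : smooth_on setT (fun p : V * V => a p.2).
  by apply: (@smooth_on_compose _ _ _ setT setT a _ oT (smooth_snd _)).
elim: s p => //= v s IH p.
have sI : smooth_on setT (iter_derive (hor s) Phi) by exact: smooth_on_iter.
rewrite (_ : iter_derive _ _ = fun p => a p.2 * iter_derive (hor s) Phi p); last first.
  by apply/funext.
rewrite deriveM_fun; last 2 first.
- exact: smooth_on_differentiable sa2 _.
- exact: smooth_on_differentiable sI _.
rewrite (@derive_invariant _ _ (fun p : V * V => a p.2)) ?mul0r ?addr0//.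
by move=> t; rewrite /= scaler0 addr0.
Qed.

Lemma pair_basis2 (h : V) :
  ((0, h) : (V * V)%type) = \sum_i h 0 i *: ((0, e i) : (V * V)%type).
Proof.
have E (r : seq 'I_n) : \sum_(i <- r) h 0 i *: ((0, e i) : (V * V)%type) =
    (0, \sum_(i <- r) h 0 i *: e i).
  elim: r => [|i r IH]; first by rewrite !big_nil.
  by rewrite !big_cons IH -[LHS]/(_, _)/= scaler0 addr0.
by rewrite E -row_basis.
Qed.

(** A density concentrating at theta evaluates the integrand there, up to an
    error proportional to its mass and to delta.  As S sees finitely many
    derivatives in x on a compact set, it is enough to apply the mean value
    theorem in theta to each of them. *)
Lemma sphere_concentration (S : (V -> R) -> R) (Xi : V * V -> R) theta :
  smooth_linear S -> finite_order S -> smooth_on setT Xi -> enorm theta = 1 ->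
  exists2 K, 0 <= K & forall (delta : R) (a : V -> R), 0 < delta <= 1 -> smooth a ->
    (forall w, 0 <= a w) -> (forall w, a w != 0 -> `|w - theta| <= delta) ->
    `|S (sphere_param (fun p => a p.2 * Xi p)) -
      sphere_integral a * S (fun x => Xi (x, theta))| <=
    sphere_integral a * (K * delta).
Proof.
move=> lS [r [N [C [C0 SC]]]] sXi th1.
pose b (i : 'I_n + 'I_n) : (V * V)%type :=
  match i with inl i => (e i, 0) | inr i => (0, e i) end.
pose K : set (V * V) := cball (n := n) r `*` cball (n := n) 2.
have cK : compact K.
  by apply: compact_setX; exact: compact_cball.
have [M M0 MP] := @iter_derive_bound _ _ _ b _ setT Xi N.+1 cK (@subsetT _ _) sXi.
exists (C * (n%:R * M)); first by rewrite !mulr_ge0.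
move=> delta a /andP[d0 d1] sa a0 ad; set c := sphere_integral a.
have oT := @openT V; have oTT := @openT (V * V)%type.
have thn : `|theta| <= 1 by rewrite -th1 norm_le_enorm.
have sX : smooth (fun x => Xi (x, theta)).
  apply: (@smooth_on_compose _ _ _ setT setT Xi _ oT) => //.
  by apply: smooth_map_pair; [exact: smooth_id|exact: smooth_map_cst].
have sa2 : smooth_on setT (fun p : V * V => a p.2).
  by apply: (@smooth_on_compose _ _ _ setT setT a _ oTT (smooth_snd _)).
have sW : smooth_on setT (fun p => a p.2 * Xi p) by exact: smooth_onM.
have sWO : smooth_on (slab (nonzero (R := R) (n := n))) (fun p => a p.2 * Xi p).
  exact: smooth_on_sub sW.
have sP : smooth (sphere_param (fun p => a p.2 * Xi p)) by exact: sphere_param_smooth.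
have ca y : nonzero y -> {for y, continuous a}.
  by move=> _; exact/differentiable_continuous/(smooth_on_differentiable sa).
have c0 : 0 <= c by rewrite /c sphere_integralE mulr_ge0// Rintegral_ge0.
have -> : S (sphere_param (fun p => a p.2 * Xi p)) - c * S (fun x => Xi (x, theta)) =
    S (fun x => - c * Xi (x, theta) + sphere_param (fun p => a p.2 * Xi p) x).
  by rewrite lS//; ring.
rewrite (_ : c * _ = C * (c * (n%:R * M * delta))); last by ring.
apply: SC.
- by apply: smooth_onD => //; exact: smooth_onZ.
- by apply: mulr_ge0 => //; rewrite !mulr_ge0// ltW.
move=> s sN x xr; set t := map e s.
pose G := iter_derive (hor t) Xi.
have sG : smooth_on setT G by exact: smooth_on_iter.
have -> : iter_derive t (fun x => - c * Xi (x, theta) +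
      sphere_param (fun p => a p.2 * Xi p) x) x =
    sphere_integral (fun w => - G (x, theta) * a w + a w * G (x, w)).
  rewrite sphere_integral_lin; last 2 first.
  - exact: ca.
  - move=> y y0; apply: (@slice_continuous _ _ (fun p => a p.2 * G p)) => //.
    by apply: (@smooth_on_sub _ _ setT) => //; exact: smooth_onM.
  have -> : sphere_integral (fun w => a w * G (x, w)) =
      iter_derive t (sphere_param (fun p => a p.2 * Xi p)) x.
    rewrite sphere_param_iter//; congr sphere_integral; apply/funext => w.
    by rewrite iter_derive_weight.
  have -> : G (x, theta) = iter_derive t (fun y => Xi (y, theta)) x.
    exact: iter_derive_slice.
  have aux (u v w : R) : - u * v + w = - v * u + w by ring.
  by rewrite iter_derive_lin//; exact: aux.
have cG : forall y, nonzero y -> {for y, continuous (fun w => - G (x, theta) * a w + a w * G (x, w))}.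
  move=> y y0; apply: (@slice_continuous _ _ (fun p => - G (x, theta) * a p.2 + a p.2 * G p)) => //.
  apply: (@smooth_on_sub _ _ setT) => //.
  by apply: smooth_onD => //; [exact: smooth_onZ|exact: smooth_onM].
have -> : c * (n%:R * M * delta) = sphere_integral (fun w => (n%:R * M * delta) * a w + 0).
  rewrite sphere_integral_lin//; last first.
    by move=> y _; apply: differentiable_continuous; exact: differentiable_cst.
  by rewrite sphere_integral0 addr0; exact: mulrC.
apply: sphere_integral_le => //.
  move=> y y0; apply/differentiable_continuous/(@smooth_on_differentiable _ _ setT) => //.
  by apply: smooth_onD => //; [exact: smooth_onZ|exact: smooth_on_cst].
move=> w w1; rewrite addr0.
have -> : - G (x, theta) * a w + a w * G (x, w) = a w * (G (x, w) - G (x, theta)) by ring.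
have [->|aw] := eqVneq (a w) 0; first by rewrite mul0r mulr0 normr0.
rewrite normrM (ger0_norm (a0 w)) mulrC ler_wpM2r//.
have lineE u : (x, theta) + u *: ((0, w - theta) : (V * V)%type) =
    (x, theta + u *: (w - theta)).
  by rewrite -[LHS]/(_, _)/= scaler0 addr0.
have [|u u01] := @mean_value _ _ G (x, theta) (0, w - theta).
  by move=> u _; exact: smooth_on_differentiable sG _.
have -> : (x, theta) + ((0, w - theta) : (V * V)%type) = (x, w).
  by have := lineE 1; rewrite !scale1r (addrC theta) subrK.
move=> ->; rewrite lineE pair_basis2 derive_sum_dir; last exact: smooth_on_differentiable sG _.
apply: (@le_trans _ _ (n%:R * (`|w - theta| * M))).
  apply: (@coord_form_bound _ _ (fun i => 'D_((0, e i)) G (x, theta + u *: (w - theta)))).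
  move=> i; have := MP (inr i :: map inl s); rewrite /= size_map ltnS => /(_ sN).
  rewrite -map_comp /= (_ : [seq (b \o inl) i | i <- s] = hor t); last first.
    by rewrite /t -map_comp.
  apply; split=> //=; rewrite /cball/=.
  case/andP: u01 => u0 u1; rewrite (le_trans (ler_normD _ _))// -[leRHS]/(1 + 1) lerD//.
  by rewrite normrZ ger0_norm// mulr_ile1// (le_trans (ad _ aw)).
by rewrite -mulrA ler_wpM2l// mulrC ler_wpM2l// ad.
Qed.

End concentration.

(** * Ridge functions through the open set *)

Section ridges.
Context (R : realType) (n : nat).
Local Notation V := 'rV[R]_n.

(** Its mass is never computed: being positive, it cancels in
    [ridge_vanish]. *)
Definition bump (theta : V) (delta : R) (w : V) : R :=
  flat 0 (delta ^+ 2 - dot (w - theta) (w - theta)).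

Lemma smooth_bump theta delta : smooth (bump theta delta).
Proof.
have oT := @openT V.
have sm : smooth_map setT (fun w : V => w - theta).
  by apply: smooth_map_add; [exact: smooth_id|exact: smooth_map_cst].
apply: (@smooth_on_comp1 _ _ setT setT (flat 0)) => //; last exact: smooth_flat.
apply: smooth_onB => //; first exact: smooth_on_cst.
by apply: smooth_dot => // i; exact: smooth_map_coord.
Qed.

Lemma bump_ge0 theta delta w : 0 <= bump theta delta w.
Proof. exact: flat_ge0. Qed.

Lemma bump_center theta delta : 0 < delta -> 0 < bump theta delta theta.
Proof.
move=> d0; rewrite flat_gt0 subrr (_ : dot 0 0 = 0) ?subr0 ?exprn_gt0//.
by apply/eqP; rewrite dot_eq0.
Qed.

Lemma bump_support theta delta w : 0 < delta -> bump theta delta w != 0 ->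
  `|w - theta| < delta.
Proof.
move=> d0 b0; have : 0 < bump theta delta w by rewrite lt_def b0 bump_ge0.
rewrite flat_gt0 subr_gt0 => H; apply: le_lt_trans (norm_le_enorm _) _.
rewrite -(@ltr_pXn2r _ 2) ?nnegrE ?enorm_ge0 ?ltW//.
by rewrite enorm_sqr.
Qed.

Lemma smooth_dot_dir (q : V) (U : set (V * V)) : open U ->
  smooth_map U (fun p : V * V => dot q p.2 *: p.2).
Proof.
move=> oU; apply: smooth_map_mul => //; last exact: smooth_snd.
apply: smooth_dot => // i; first exact: smooth_on_cst.
by apply: smooth_map_coord => //; exact: smooth_snd.
Qed.

(** The functions of the form h(P x), P the projection along theta. *)
Definition ridge (theta : V) (h : V -> R) := forall x (t : R), h (x + t *: theta) = h x.

(** The distance of x from the line through q in direction theta, measured in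
    the norm of row vectors. *)
Definition tube (q theta : V) (rho : R) (x : V) :=
  `|x - q - dot (x - q) theta *: theta| <= rho.

Lemma closed_eqR (T : topologicalType) (f g : T -> R) : continuous f -> continuous g ->
  closed [set x | f x = g x].
Proof.
move=> cf cg; rewrite (_ : [set x | _] = (fun x => f x - g x) @^-1` [set y | y = 0]).
  apply: closed_comp; last exact: closed_eq.
  by move=> x _; apply: cvgB; [exact: cf|exact: cg].
by apply/seteqP; split=> x /=; [move=> ->; rewrite subrr|move/eqP; rewrite subr_eq0 => /eqP].
Qed.

Lemma smooth_continuous (E : normedModType R) (f : E -> R) : smooth f -> continuous f.
Proof.
by move=> sf x; exact/differentiable_continuous/(smooth_on_differentiable sf).
Qed.

(** Test X f on psi (z, w) = h (z + (q.w) w) a(w), where a is a bump at theta of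
    radius delta; the line (z, w) passes through z + (q.w) w, its point closest
    to q.  At w = theta the adjoint transform of psi is theta_i h by invariance
    of h, so [sphere_concentration] bounds the mass of a times theta . f(h) by
    O(delta) times the same mass. *)
Lemma ridge_vanish (f : 'I_n -> cs_distribution R n) (A : set V) (q theta : V) rho h :
  xray_vanishes_on_lines_meeting f A -> enorm theta = 1 -> 0 < rho ->
  (forall y, `|y - q| <= 2 * rho -> A y) -> smooth h -> ridge theta h ->
  (forall x, h x != 0 -> tube q theta rho x) ->
  \sum_i theta 0 i * f i h = 0.
Proof.
move=> fA th1 rho0 qA sh rh htube.
have oT := @openT V; have oTT := @openT (V * V)%type.
have thn : `|theta| <= 1 by rewrite -th1 norm_le_enorm.
pose Xi i (p : V * V) := p.2 0 i * h (p.1 - dot p.1 p.2 *: p.2 + dot q p.2 *: p.2).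
have sXi i : smooth_on setT (Xi i).
  apply: smooth_onM => //.
    by apply: smooth_map_coord => //; exact: smooth_snd.
  apply: (@smooth_on_compose _ _ _ setT setT h _ oTT) => //.
  apply: smooth_map_add; last exact: smooth_dot_dir.
  apply: smooth_map_add; first exact: smooth_fst.
  apply: smooth_map_opp => //; apply: smooth_map_mul => //; last exact: smooth_snd.
  by apply: smooth_dot => // j; apply: smooth_map_coord => //;
    [exact: smooth_fst|exact: smooth_snd].
have XiE i x : Xi i (x, theta) = theta 0 i * h x.
  rewrite /Xi /= -addrA addrC -scaleNr -scalerDl addrC rh//.
have HK i := sphere_concentration (@cs_smooth_linear _ _ (f i)) (@cs_finite_order _ _ (f i))
  (sXi i) th1.
have [K KP] : exists K : 'I_n -> R, forall i, 0 <= K i /\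
    forall (delta : R) (a : V -> R), 0 < delta <= 1 -> smooth a ->
    (forall w, 0 <= a w) -> (forall w, a w != 0 -> `|w - theta| <= delta) ->
    `|f i (sphere_param (fun p => a p.2 * Xi i p)) -
      sphere_integral a * f i (fun x => Xi i (x, theta))| <=
    sphere_integral a * (K i * delta).
  by exists (fun i => sval (cid2 (HK i))) => i; case: cid2 => ? ? /=.
set F := \sum_i _; pose K0 := \sum_i K i.
have K00 : 0 <= K0 by apply: sumr_ge0 => i _; case: (KP i).
suff H (delta : R) : 0 < delta -> delta <= 1 -> n%:R * delta <= 2^-1 ->
    `|F| <= K0 * delta.
  apply/eqP; rewrite -normr_le0; apply/ler_addgt0Pl => eps eps0; rewrite addr0.
  pose delta := Num.min 1 (Num.min (2^-1 / (n%:R + 1)) (eps / (K0 + 1))).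
  have n10 : 0 < n%:R + 1 :> R by rewrite ltr_wpDl.
  have K10 : 0 < K0 + 1 :> R by rewrite ltr_wpDl.
  have d0 : 0 < delta by rewrite !lt_min ltr01 !divr_gt0//.
  have d1 : delta <= 1 by rewrite ge_min lexx.
  have d2 : delta <= 2^-1 / (n%:R + 1) by rewrite !ge_min lexx orbT.
  have d3 : delta <= eps / (K0 + 1) by rewrite !ge_min lexx !orbT.
  rewrite (le_trans (H delta d0 d1 _))//.
    move: d2; rewrite ler_pdivlMr// => /(le_trans _); apply.
    by rewrite mulrC ler_wpM2l// ?lerDl// ltW.
  move: d3; rewrite ler_pdivlMr// => /(le_trans _); apply.
  by rewrite mulrC ler_wpM2l// ?lerDl// ltW.
move=> d0 d1 nd; pose a := bump theta delta.
have sa : smooth a by exact: smooth_bump.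
pose psi (p : V * V) := h (p.1 + dot q p.2 *: p.2) * a p.2.
have spsi : smooth_on setT psi.
  apply: smooth_onM => //.
    apply: (@smooth_on_compose _ _ _ setT setT h _ oTT) => //.
    by apply: smooth_map_add; [exact: smooth_fst|exact: smooth_dot_dir].
  by apply: (@smooth_on_compose _ _ _ setT setT a _ oTT (smooth_snd _)).
have ssub : smooth_on_submanifold (@lines R n) psi.
  by move=> p _; exists setT, psi; split.
(* For delta small, lines of the support that meet the tube are nearly parallel
   to theta, hence pass within 2 rho of q. *)
pose C : set (V * V) := [set p | enorm p.2 = 1 /\ dot p.1 p.2 = 0] `&`
  [set p | `|p.1 + dot q p.2 *: p.2 - q| <= 2 * rho].
have psiC : (@lines R n `&` [set p | psi p != 0]) `<=` C.
  move=> p [[p1 p2] /=]; rewrite mulf_eq0 negb_or => /andP[h0 a0].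
  split=> //=; set y := p.1 + _ - q.
  have yp : dot y p.2 = 0.
    by rewrite !dotDl dotNl dotZl -enorm_sqr p1 expr1n mulr1 p2 add0r subrr.
  have := htube _ h0; rewrite /tube -/y => yt.
  have dn : `|p.2 - theta| < delta by exact: bump_support.
  have ydot : `|dot y theta| <= `|y| / 2.
    rewrite (_ : dot y theta = - dot y (p.2 - theta)); last first.
      by rewrite dotDr dotNr yp sub0r opprK.
    rewrite normrN (le_trans (dot_le_norm _ _))//.
    rewrite mulrCA ler_wpM2l// (le_trans _ nd)// ler_wpM2l// ltW//.
  have : `|y| <= rho + `|y| / 2.
    rewrite -{1}(subrK (dot y theta *: theta) y) (le_trans (ler_normD _ _))//.
    rewrite lerD// normrZ (le_trans _ ydot)// ler_piMr//.
  by lra.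
have closedC : closed C.
  apply: closedI; last first.
    rewrite (_ : [set p | _] = (fun p : V * V => `|p.1 + dot q p.2 *: p.2 - q|) @^-1`
        [set u | u <= 2 * rho])//.
    apply: closed_comp; last exact: closed_le.
    move=> p _; apply: (@continuous_comp _ _ _ (fun p : V * V => p.1 + dot q p.2 *: p.2 - q)).
      apply: differentiable_continuous.
      apply: (@smooth_map_differentiable _ _ _ setT) => //.
      apply: smooth_map_add; last exact: smooth_map_cst.
      by apply: smooth_map_add; [exact: smooth_fst|exact: smooth_dot_dir].
    exact: norm_continuous.
  apply: (@closedI _ [set p : V * V | enorm p.2 = 1] [set p | dot p.1 p.2 = 0]).
    apply: closed_eqR => p; last exact: cvg_cst.
    by apply: continuous_comp; [exact: cvg_snd|exact: enorm_continuous].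
  apply: closed_eqR => p; last exact: cvg_cst.
  apply: smooth_continuous; apply: smooth_dot => // i; apply: smooth_map_coord => //;
    [exact: smooth_fst|exact: smooth_snd].
have suppC : support_on (@lines R n) psi `<=` C.
  by rewrite /support_on => p /(closure_subset psiC); rewrite -(closure_id C).1.
have C2 p : C p -> `|p.1| <= `|q| + 2 * rho + n%:R * `|q| /\ `|p.2| <= 1.
  move=> [[p1 p2] /= pq].
  have p2n : `|p.2| <= 1 by rewrite -p1 norm_le_enorm.
  split=> //.
  rewrite (_ : p.1 = q + (p.1 + dot q p.2 *: p.2 - q) - dot q p.2 *: p.2); last first.
    by rewrite (addrC q) subrK addrK.
  rewrite (le_trans (ler_normB _ _))// lerD//.
    by rewrite (le_trans (ler_normD _ _))// lerD2l.
  rewrite normrZ (le_trans (ler_wpM2r _ (dot_le_norm _ _)))//.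
  rewrite -mulrA ler_wpM2l// -mulrA ler_piMr// mulr_ile1//.
have cK : compact (support_on (@lines R n) psi).
  pose B : set (V * V) := cball (n := n) (`|q| + 2 * rho + n%:R * `|q|) `*` cball (n := n) 1.
  have cB : compact B by apply: compact_setX; exact: compact_cball.
  apply: (subclosed_compact _ cB); first exact: closed_closure.
  by move=> p /suppC/C2.
have suppA : support_on (@lines R n) psi `<=` lines_meeting A.
  move=> p /suppC[[p1 p2] pq]; split; first by split.
  by exists (dot q p.2); exact: qA.
have := fA psi ssub cK suppA; rewrite /xray /pairing => X0.
set c := sphere_integral a.
have ca y : nonzero y -> {for y, continuous a}.
  by move=> _; exact: smooth_continuous.
have c0 : 0 < c.
  apply: (@sphere_integral_gt0 _ _ a theta) => //; last exact: bump_center.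
  by move=> x _; exact: bump_ge0.
have adjE i : xray_adjoint psi i = sphere_param (fun p => a p.2 * Xi i p).
  apply/funext => x; congr sphere_integral; apply/funext => w.
  by rewrite /psi /Xi /=; ring.
have HF : `|c * F| <= c * (K0 * delta).
  rewrite (_ : c * F = - \sum_i (f i (xray_adjoint psi i) - c * (theta 0 i * f i h))).
    rewrite normrN (le_trans (ler_norm_sum _ _ _))// /K0 mulr_suml mulr_sumr.
    apply: ler_sum => i _; rewrite adjE.
    have -> : theta 0 i * f i h = f i (fun x => Xi i (x, theta)).
      rewrite -smooth_linearZ//; last exact: cs_smooth_linear.
      by congr (distr_fun (f i) _); apply/funext => x; rewrite XiE.
    apply: (KP i).2 => //; [by rewrite d0|exact: bump_ge0|].
    by move=> w /(bump_support d0)/ltW.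
  by rewrite sumrB X0 sub0r opprK mulr_sumr.
by move: HF; rewrite normrM (gtr0_norm c0) ler_pM2l.
Qed.

End ridges.

(** * Averaging a functional against translates of a test function *)

Section mollification.
Context (R : realType) (n : nat).
Local Notation V := 'rV[R]_n.
Local Notation e := (@Defs.basis R n).
Implicit Types (eta : V -> R).

Lemma iter_derive_shift eta s (x y : V) :
  iter_derive s (fun y => eta (y - x)) y = iter_derive s eta (y - x).
Proof.
elim: s y => //= v s IH y; apply: derive_curve_eq => t; rewrite IH.
by rewrite addrAC.
Qed.

Lemma smooth_shift eta x : smooth eta -> smooth (fun y => eta (y - x)).
Proof.
move=> se; apply: (@smooth_on_compose _ _ _ setT setT eta _ (@openT V)) => //.
by apply: smooth_map_add; [exact/smooth_id/openT|exact/smooth_map_cst/openT].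
Qed.

Lemma iter_derive_comm eta s v : smooth eta ->
  iter_derive s (fun y => 'D_v eta y) = fun y => 'D_v (iter_derive s eta) y.
Proof.
move=> se; elim: s => //= w s ->; apply/funext => y.
have sI : smooth (iter_derive s eta) by exact: smooth_on_iter.
by rewrite (schwarz _ _ (@openT V) sI).
Qed.

(** The convolution of S with the reflection of eta. *)
Definition moll (S : (V -> R) -> R) eta (x : V) : R := S (fun y => eta (y - x)).

(** The Taylor remainder of the translates of eta is quadratically small
    together with its derivatives, uniformly on the ball seen by S. *)
Lemma moll_derive_at S eta x : smooth_linear S -> finite_order S -> smooth eta ->
  differentiable (moll S eta) x /\
  forall v, 'D_v (moll S eta) x = - moll S (fun y => 'D_v eta y) x.
Proof.
move=> lS [r [N [C [C0 SC]]]] se; pose c i := - moll S (fun y => 'D_(e i) eta y) x.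
have sD v : smooth (fun y => 'D_v eta y) by exact: smooth_derive.
have cK : compact (cball (n := n) (r + `|x| + 1)) by exact: compact_cball.
have [M M0 MP] := @iter_derive_bound _ _ _ e _ setT eta N.+2 cK (@subsetT _ _) se.
have oT := @openT V.
have SD v : S (fun y => 'D_v eta (y - x)) =
    \sum_i v 0 i * S (fun y => 'D_(e i) eta (y - x)).
  rewrite -smooth_linear_sum//; last by move=> i; exact: smooth_shift (sD (e i)).
  congr S; apply/funext => y; rewrite derive_coord_form//.
  exact: smooth_on_differentiable se _.
have [|df DE] := @quadratic_differentiable R n (moll S eta) x c
    (C * (n%:R * (n%:R * M))) 1 ltr01; last first.
  split=> // v; rewrite DE /coord_form /c /moll SD -sumrN.
  by apply: eq_bigr => i _; rewrite mulrN.
move=> h h1.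
have sh : smooth (fun y => 'D_h eta (y - x)) by exact: smooth_shift (sD h).
have s1 : smooth (fun y => eta (y - (x + h))) by exact: smooth_shift.
have s0 : smooth (fun y => eta (y - x)) by exact: smooth_shift.
have -> : moll S eta (x + h) - moll S eta x - coord_form c h =
    S (fun y => -1 * eta (y - x) + (1 * 'D_h eta (y - x) + eta (y - (x + h)))).
  rewrite lS//; last by apply: smooth_onD => //; exact: smooth_onZ.
  rewrite lS// /moll (_ : coord_form c h = - S (fun y => 'D_h eta (y - x))).
    by ring.
  by rewrite SD -sumrN; apply: eq_bigr => i _; rewrite /c mulrN.
rewrite (_ : C * _ * _ = C * (n%:R * (`|h| * (n%:R * (`|h| * M))))); last by ring.
apply: SC; first by apply: smooth_onD => //; [exact: smooth_onZ|apply: smooth_onD => //; exact: smooth_onZ].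
  by rewrite !mulr_ge0.
move=> s sN y yr; rewrite iter_derive_lin//; last by apply: smooth_onD => //; exact: smooth_onZ.
rewrite iter_derive_lin// (iter_derive_shift eta) (iter_derive_shift (fun y => 'D_h eta y)).
rewrite (iter_derive_shift eta) iter_derive_comm//.
set t := map e s; pose z := iter_derive t eta.
have sz : smooth z by exact: smooth_on_iter.
have dz w : differentiable z w by exact: smooth_on_differentiable sz _.
rewrite -/z mul1r mulN1r (_ : y - (x + h) = y - x + (- h)); last by rewrite opprD addrA.
rewrite (_ : - z (y - x) + _ = z (y - x + - h) - z (y - x) - 'D_(- h) z (y - x)); last first.
  by rewrite deriveN_dir//; ring.
have sDz v : smooth (fun y => 'D_v z y) by exact: smooth_derive.
have nh : `|- h| = `|h| by rewrite normrN.
apply: taylor2 => u u01.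
- exact: dz.
- exact: smooth_on_differentiable (sDz _) _.
rewrite derive_coord_form; last exact: smooth_on_differentiable (sDz _) _.
rewrite -nh; apply: coord_form_bound => i; rewrite (schwarz _ _ oT sz)//.
rewrite derive_coord_form; last exact: smooth_on_differentiable (sDz _) _.
apply: coord_form_bound => j; apply: (MP (j :: i :: s)) => //.
rewrite /cball/= (le_trans (ler_normD _ _))// lerD//.
  by rewrite (le_trans (ler_normB _ _))// lerD2r.
case/andP: u01 => u0 u1; rewrite normrZ nh ger0_norm// mulr_ile1//; exact: ltW.
Qed.

(** The multiples of functions of this form are closed under differentiation;
    the factor absorbs the sign in [moll_derive]. *)
Lemma moll_smooth S eta : smooth_linear S -> finite_order S -> smooth eta ->
  smooth (moll S eta).
Proof.
move=> lS oS se; apply: (@smooth_onP _ _ setT (fun f => exists (b : R) zeta,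
  smooth zeta /\ f = fun x => b * moll S zeta x)); first exact: openT.
  move=> f [b [zeta [sz ->]]].
  have dm x : differentiable (moll S zeta) x by exact: (moll_derive_at x lS oS sz).1.
  split=> [x _|v].
    by apply: differentiableM_fun => //; exact: differentiable_cst.
  exists (fun x => - b * moll S (fun y => 'D_v zeta y) x).
    by exists (- b), (fun y => 'D_v zeta y); split=> //; exact: smooth_derive.
  move=> x _; rewrite (@deriveM_fun _ _ (cst b))//.
  by rewrite derive_cst mul0r addr0 (moll_derive_at x lS oS sz).2 mulrN mulNr.
by exists 1, eta; split=> //; apply/funext => x; rewrite mul1r.
Qed.

Lemma moll_derive S eta v x : smooth_linear S -> finite_order S -> smooth eta ->
  'D_v (moll S eta) x = - moll S (fun y => 'D_v eta y) x.
Proof. by move=> lS oS se; rewrite (moll_derive_at x lS oS se).2. Qed.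

(** The closed ball makes the condition stable under differentiation. *)
Definition small_support (r : R) eta := forall y, eta y != 0 -> `|y| <= r.

Lemma small_support_out r eta y : small_support r eta -> r < `|y| -> eta y = 0.
Proof. by move=> se ry; apply/eqP; apply: contraLR ry => /se; rewrite -leNgt. Qed.

Lemma small_support_derive r eta v : small_support r eta ->
  small_support r (fun y => 'D_v eta y).
Proof.
move=> se y; apply: contraNT; rewrite -ltNge => ry.
have oW : open [set x : V | r < `|x|].
  rewrite (_ : [set x | _] = @Num.norm R V @^-1` [set u | r < u])//.
  by apply: open_comp; [move=> ? _; exact: norm_continuous|exact: open_gt].
rewrite (@eq_on_derive _ _ _ _ (cst 0) v _ oW)//; first by rewrite derive_cst.
by move=> z; exact: small_support_out.
Qed.

End mollification.

(** * Line integrals of averaged functionals *)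

Section line_integrals.
Context (R : realType) (n : nat).
Local Notation V := 'rV[R]_n.
Implicit Types (eta g : V -> R) (u x y : V).

Local Notation int L f := (\int[@lebesgue_measure R]_(t in `[0, L]) f t).

(** An integral over [-L, L], folded so as to integrate over an interval
    starting at 0. *)
Definition two_sided g u (L : R) x : R :=
  \int[@lebesgue_measure R]_(t in `[0, L]) (g (x + t *: u) + g (x + (- t) *: u)).

Definition two_sided_kernel g u (p : V * R) : R :=
  g (p.1 + p.2 *: u) + g (p.1 + (- p.2) *: u).

Lemma smooth_two_sided_kernel g u : smooth g ->
  smooth_on (slab (setT : set R) : set (V * R)) (two_sided_kernel g u).
Proof.
move=> sg; have oO : open (slab (setT : set R) : set (V * R)) by exact/open_slab/openT.
have s2 : smooth_on (slab (setT : set R) : set (V * R)) (fun p => p.2) by exact: smooth_sndR.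
apply: smooth_onD => //.
  apply: (@smooth_on_compose _ _ _ _ setT g _ oO) => //.
  by apply: smooth_map_add; [exact: smooth_fst|exact: smooth_map_scale].
apply: (@smooth_on_compose _ _ _ _ setT g _ oO) => //.
apply: smooth_map_add; first exact: smooth_fst.
by apply: smooth_map_scale; exact: smooth_onN.
Qed.

Lemma smooth_two_sided g u L : smooth g -> smooth (two_sided g u L).
Proof.
move=> sg; apply: (@itv_int_smooth _ _ 0 L setT (@openT R) (fun _ _ => I) (two_sided_kernel g u)).
exact: smooth_two_sided_kernel.
Qed.

Lemma derive_two_sided g u L x : 0 < L -> smooth g ->
  'D_u (two_sided g u L) x = g (x + L *: u) - g (x - L *: u).
Proof.
move=> L0 sg; have sk := smooth_two_sided_kernel u sg.
have dg y : differentiable g y by exact: smooth_on_differentiable sg _.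
have := @itv_int_derive _ _ 0 L setT (@openT R) (fun _ _ => I) _ u x sk.
rewrite /itv_int => ->.
pose F (t : R) := g (x + t *: u) + - g (x - t *: u).
pose f (t : R) : R := 'D_u g (x + t *: u) + 'D_u g (x + (- t) *: u).
transitivity (\int[@lebesgue_measure R]_(t in `[0, L]) f t).
  apply: eq_Rintegral => t _; pose P s := fun p : V * R => g (p.1 + (s * p.2) *: u).
  have sP s : smooth_on (slab (setT : set R) : set (V * R)) (P s).
    have oO : open (slab (setT : set R) : set (V * R)) by exact/open_slab/openT.
    apply: (@smooth_on_compose _ _ _ _ setT g _ oO) => //.
    apply: smooth_map_add; first exact: smooth_fst.
    by apply: smooth_map_scale; apply: smooth_onZ => //; exact: smooth_sndR.
  have DP s : 'D_(u, 0) (P s) (x, t) = 'D_u g (x + (s * t) *: u).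
    apply: derive_curve_eq => w; rewrite /P -[_ + w *: _]/(_, _)/= scaler0 addr0.
    by rewrite addrAC.
  rewrite (_ : two_sided_kernel g u = fun p => P 1 p + P (-1) p); last first.
    by apply/funext => p; rewrite /two_sided_kernel /P mul1r mulN1r.
  rewrite deriveD_fun ?DP ?mul1r ?mulN1r//; exact: smooth_on_differentiable (sP _) _.
have dF (t : R) : setT t -> is_derive t 1 F (f t).
  move=> _.
  have [d1 D1] := @line_is_derive _ _ g x u t (dg _).
  have [d2 D2] := @line_is_derive _ _ g x (- u) t (dg _).
  have E : (fun s : R => g (x + s *: - u)) = fun s => g (x - s *: u).
    by apply/funext => s; rewrite scalerN.
  rewrite E in d2 D2.
  have d2' : derivable (fun s : R => - g (x - s *: u)) t 1 by exact: derivableN.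
  have FE : F = (fun s : R => g (x + s *: u)) + (fun s : R => - g (x - s *: u)) by [].
  apply: DeriveDef; first by rewrite FE; exact: (derivableD d1 d2').
  rewrite FE (deriveD d1 d2') D1 (deriveN d2) D2 deriveN_dir// opprK.
  by rewrite /f scalerN scaleNr.
have cf (t : R) : setT t -> {for t, continuous f}.
  move=> _; have dD y : differentiable (fun y => 'D_u g y) y.
    exact: smooth_on_differentiable (smooth_derive u sg) _.
  have c1 := @line_continuous _ _ (fun y => 'D_u g y) x u t (dD _).
  have c2 := @line_continuous _ _ (fun y => 'D_u g y) x (- u) t (dD _).
  have E : (fun s : R => 'D_u g (x + s *: - u)) = fun s : R => 'D_u g (x + (- s) *: u).
    by apply/funext => s; rewrite scalerN scaleNr.
  by rewrite E in c2; exact: (cvgD c1 c2).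
rewrite (@itv_FTC R 0 L setT (fun _ _ => I) F f L0 dF cf) /F.
by rewrite !scale0r subr0 addr0 subrr subr0.
Qed.

Lemma derive0_line g u x : smooth g -> (forall y, 'D_u g y = 0) ->
  forall t : R, g (x + t *: u) = g x.
Proof.
move=> sg D0 t; have dg y : differentiable g y by exact: smooth_on_differentiable sg _.
have [|s _] := @mean_value _ _ g x (t *: u); first by move=> *; exact: dg.
by rewrite deriveZ_dir// D0 mulr0 => /eqP; rewrite subr_eq0 => /eqP.
Qed.

Lemma two_sided_eq0 g u L x : 0 <= L ->
  (forall t, `|t| <= L -> g (x + t *: u) = 0) -> two_sided g u L x = 0.
Proof.
move=> L0 g0; transitivity (\int[@lebesgue_measure R]_(t in `[0, L]) (fun=> 0 : R) t).
  apply: eq_Rintegral => t; rewrite inE /= in_itv/= => /andP[t0 tL].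
  by rewrite !g0 ?addr0// ?normrN ger0_norm.
by rewrite Rintegral_cst// mul0r.
Qed.

Lemma moll_far S (r0 eps : R) eta x :
  smooth_linear S ->
  (forall phi psi, smooth phi -> smooth psi ->
    (forall y, `|y| < r0 -> phi y = psi y) -> S phi = S psi) ->
  smooth eta -> small_support eps eta -> r0 + eps < `|x| -> moll S eta x = 0.
Proof.
move=> lS Sloc se eeta xr; rewrite -(smooth_linear0 lS); apply: Sloc => //.
- exact: smooth_shift.
- exact: smooth0.
move=> y yr; apply: small_support_out eeta _.
by have := ler_normD (x - y) y; rewrite subrK (distrC y); lra.
Qed.

(** Interchange of S with a line integral, without Fubini for S: both sides
    have the same derivative along u and vanish far out on the line. *)
Lemma moll_two_sided S eps eta u L x : smooth_linear S -> finite_order S ->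
  smooth eta -> small_support eps eta -> u != 0 -> 0 < L ->
  moll S (two_sided eta u L) x = two_sided (moll S eta) u L x.
Proof.
move=> lS oS se eeta u0 L0.
have sH : smooth (two_sided eta u L) by exact: smooth_two_sided.
have sm : smooth (moll S eta) by exact: moll_smooth.
have sB : smooth (moll S (two_sided eta u L)) by exact: moll_smooth.
have sb : smooth (two_sided (moll S eta) u L) by exact: smooth_two_sided.
have oT := @openT V.
pose D x := moll S (two_sided eta u L) x - two_sided (moll S eta) u L x.
have sD : smooth D by exact: smooth_onB.
have D0 y : 'D_u D y = 0.
  rewrite /D (@deriveB _ _ _ (moll S (two_sided eta u L)) (two_sided (moll S eta) u L)); last 2 first.
  - exact/diff_derivable/(smooth_on_differentiable sB).
  - exact/diff_derivable/(smooth_on_differentiable sb).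
  rewrite derive_two_sided// moll_derive//.
  have -> : (fun z => 'D_u (two_sided eta u L) z) =
      fun z => eta (z - (- (L *: u))) - eta (z - L *: u).
    by apply/funext => z; rewrite derive_two_sided// opprK.
  rewrite /moll smooth_linearB//; last 2 first.
  - exact: (@smooth_shift _ _ (fun z => eta (z - - (L *: u))) y (smooth_shift _ se)).
  - exact: (@smooth_shift _ _ (fun z => eta (z - L *: u)) y (smooth_shift _ se)).
  have shE w : (fun z => eta (z - y - w)) = (fun z => eta (z - (y + w))).
    by apply/funext => z; rewrite opprD addrA.
  by rewrite !shE; ring.
have [r0 r00 Sloc] := finite_order_local lS oS.
have nu0 : 0 < `|u| by rewrite normr_gt0.
pose T := L + (r0 + `|eps| + `|x| + 1) / `|u|.
have T0 : L * `|u| + (r0 + `|eps| + `|x| + 1) = T * `|u|.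
  by rewrite /T mulrDl divfK// gt_eqF.
have Tpos : 0 <= T by rewrite addr_ge0 ?ltW// divr_gt0// !ltr_wpDl// ?addr_ge0// ltW.
have far t : `|t| <= L -> r0 + `|eps| < `|x + T *: u + t *: u|.
  move=> tL.
  have : `|T *: u| <= `|x + T *: u + t *: u| + `|x| + `|t *: u|.
    rewrite {1}(_ : T *: u = (x + T *: u + t *: u) - x - t *: u).
      by rewrite (le_trans (ler_normB _ _))// lerD2r ler_normB.
    by rewrite addrAC addrK addrC addrA addNr add0r.
  rewrite !normrZ ger0_norm// -T0.
  have : `|t| * `|u| <= L * `|u| by rewrite ler_wpM2r.
  by lra.
have DE : D x = D (x + T *: u) by rewrite derive0_line.
apply/eqP; rewrite -subr_eq0 -/(D x) DE /D subr_eq0; apply/eqP.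
have eps_le : eps <= `|eps| by exact: ler_norm.
rewrite [RHS]two_sided_eq0 ?ltW//; last first.
  move=> t /far tfar; apply: (@moll_far _ r0 eps) => //.
  by apply: le_lt_trans tfar; rewrite lerD2l.
rewrite -(smooth_linear0 lS); apply: Sloc.
- exact: smooth_shift.
- exact: smooth0.
move=> y yr; apply: two_sided_eq0; first exact: ltW.
move=> t tL; apply: small_support_out eeta _; apply: le_lt_trans eps_le _.
have tL' : `|- t| <= L by rewrite normrN.
have := far _ tL'.
have -> : x + T *: u + (- t) *: u = y - (y - (x + T *: u) + t *: u).
  by rewrite opprD opprB addrA (addrC y) subrK scaleNr.
by have := ler_normB y (y - (x + T *: u) + t *: u); lra.
Qed.

(** What [ridge_vanish] gives for the functionals studied below. *)
Definition kills_ridges (S : (V -> R) -> R) q rho theta :=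
  forall h, smooth h -> ridge theta h -> (forall x, h x != 0 -> tube q theta rho x) -> S h = 0.

(** After the interchange, S is applied to the integral of eta over lines
    parallel to u.  When L is large this agrees, on the ball that S sees, with
    a function constant along u; it is supported in a tube because eta is
    supported in a ball. *)
Lemma moll_line_integral S eps q rho : smooth_linear S -> finite_order S ->
  0 <= eps -> (n%:R + 1) * eps <= rho ->
  exists2 B, 0 < B & forall u L eta, u != 0 -> kills_ridges S q rho (unit_dir u) ->
    B <= L * `|u| -> smooth eta -> small_support eps eta ->
    two_sided (moll S eta) u L q = 0.
Proof.
move=> lS oS eps0 epsrho.
have [r0 r00 Sloc] := finite_order_local lS oS.
pose W := (1 + n%:R) * (r0 + `|q|).
have W0 : 0 <= W by rewrite mulr_ge0// addr_ge0// ltW.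
exists (eps + W + 1) => [|u L eta u0 kS LB se eeta].
  by rewrite ltr_wpDl// addr_ge0.
set th := unit_dir u in kS *.
have th1 : enorm th = 1 by exact: enorm_unit_dir.
have thn : `|th| <= 1 by rewrite -th1 norm_le_enorm.
have nu0 : 0 < `|u| by rewrite normr_gt0.
have uE : u = enorm u *: th.
  by rewrite /th /unit_dir scalerA divff ?scale1r// gt_eqF// enorm_gt0.
have L0 : 0 < L.
  by rewrite -(pmulr_lgt0 _ nu0) (lt_le_trans _ LB)// ltr_wpDl// addr_ge0.
rewrite -(moll_two_sided q lS oS se eeta u0 L0) /moll.
set H := two_sided eta u L.
have sH : smooth H by exact: smooth_two_sided.
pose P (z : V) := z - dot z th *: th.
pose h y := H (P (y - q)).
have oT := @openT V.
have sh : smooth h.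
  apply: (@smooth_on_compose _ _ _ setT setT H _ oT) => //.
  have sq : smooth_map setT (fun y : V => y - q).
    by apply: smooth_map_add; [exact: smooth_id|exact: smooth_map_cst].
  apply: smooth_map_add => //; apply: smooth_map_opp => //; apply: smooth_map_scale.
  by apply: smooth_dot => // i; [exact: smooth_map_coord|exact: smooth_on_cst].
have Pn z : `|z| <= r0 + `|q| -> forall s, 0 <= s <= 1 ->
    `|P z + s *: (dot z th *: th)| <= W.
  move=> zr s /andP[s0 s1].
  have -> : P z + s *: (dot z th *: th) = z + ((s - 1) * dot z th) *: th.
    by apply/rowP => j; rewrite /P !mxE; ring.
  have dz : `|dot z th| <= n%:R * (r0 + `|q|).
    rewrite (le_trans (dot_le_norm _ _))// ler_wpM2l//.
    by rewrite (le_trans (ler_piMr _ thn)).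
  rewrite (le_trans (ler_normD _ _))//.
  rewrite (_ : W = (r0 + `|q|) + n%:R * (r0 + `|q|)); last by rewrite /W; ring.
  rewrite lerD// normrZ.
  rewrite (le_trans (ler_piMr _ thn))//.
  rewrite normrM (le_trans _ dz)// ler_piMl//.
  by rewrite ler_norml; apply/andP; split; lra.
have -> : S (fun y => H (y - q)) = S h.
  apply: Sloc; [exact: smooth_shift|exact: sh|].
  move=> y yr; rewrite /h; set z := y - q.
  have zr : `|z| <= r0 + `|q|.
    by rewrite (le_trans (ler_normB _ _))// lerD2r ltW.
  have dH w : differentiable H w by exact: smooth_on_differentiable sH _.
  have [|s s01] := @mean_value _ _ H (P z) (dot z th *: th); first by move=> *; exact: dH.
  rewrite {1}/P subrK => HE; apply/eqP; rewrite -subr_eq0 HE.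
  have thE (d : R) : d *: th = (d * (enorm u)^-1) *: u by rewrite -scalerA.
  have DH (d : R) w : 'D_(d *: th) H w = (d * (enorm u)^-1) * 'D_u H w.
    by rewrite thE; exact: deriveZ_dir.
  rewrite DH.
  rewrite derive_two_sided//.
  have out (v : V) : `|v| = L * `|u| -> eta (P z + s *: (dot z th *: th) + v) = 0.
    move=> vL; apply: small_support_out eeta _.
    have := Pn z zr s s01; set w := P z + _ => wW.
    have := ler_normB (w + v) w; rewrite addrAC subrr add0r vL.
    by move: LB wW; lra.
  by rewrite !out ?subrr ?mulr0// ?normrN normrZ gtr0_norm.
apply: kS; first exact: sh.
  move=> x t; rewrite /h; congr H.
  rewrite /P (_ : x + t *: th - q = x - q + t *: th); last by rewrite addrAC.
  by rewrite (dotDl (x - q)) dotZl -enorm_sqr th1 expr1n mulr1 scalerDl opprD addrACA subrr addr0.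
move=> x; rewrite /h /tube -/(P (x - q)); apply: contraNT; rewrite -ltNge => Px.
apply/eqP/two_sided_eq0; first exact: ltW.
move=> t _; apply: (small_support_out eeta); rewrite ltNge; apply/negP => tle.
set w := P (x - q) in Px tle.
have w0 : dot w th = 0.
  by rewrite /w /P dotDl dotNl dotZl -enorm_sqr th1 expr1n mulr1 subrr.
pose v := w + t *: u; have vE : v = w + (t * enorm u) *: th by rewrite /v {1}uE scalerA.
have dv : dot v th = t * enorm u by rewrite vE dotDl dotZl w0 -enorm_sqr th1 expr1n mulr1 add0r.
have wE : w = v - dot v th *: th by rewrite dv vE addrK.
move: Px; rewrite wE ltNge => /negP; apply.
apply: le_trans epsrho; rewrite (le_trans (ler_normB _ _))// mulrDl mul1r addrC lerD//.
rewrite normrZ (le_trans (ler_piMr _ thn))// (le_trans (dot_le_norm _ _))// ler_wpM2l//.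
by rewrite (le_trans (ler_piMr _ thn)).
Qed.

End line_integrals.

(** Isolates a linear fact whose ambient hypotheses are many. *)
Lemma split_lower_bound (R : realDomainType) (M1 M2 I0 X Y : R) :
  I0 - M1 <= X -> - M2 <= Y -> -1 * (M1 + M2) + I0 <= X + Y.
Proof. by lra. Qed.

Lemma itv_Rintegral_le (R : realType) (a b : R) (f g : R -> R) :
  bounded_on `[a, b] f -> bounded_on `[a, b] g ->
  (forall t, `[a, b]%classic t -> f t <= g t) ->
  \int[@lebesgue_measure R]_(t in `[a, b]) f t <= \int[@lebesgue_measure R]_(t in `[a, b]) g t.
Proof.
move=> bf bg fg; have mD : measurable (`[a, b]%classic : set R) by exact: measurable_itv.
have fD := itv_finite_measure a b.
apply: le_Rintegral => //.
- exact: (@bounded_on_integrable _ _ _ (@lebesgue_measure R) _ mD fD _ bf).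
- exact: (@bounded_on_integrable _ _ _ (@lebesgue_measure R) _ mD fD _ bg).
Qed.

(** * Moments in 1/t determine a function *)

Section moments.
Context (R : realType).

Lemma bernoulli_ineq (x : R) N : 0 <= x -> 1 + N%:R * x <= (1 + x) ^+ N.
Proof.
move=> x0; elim: N => [|N IH]; first by rewrite mul0r addr0 expr0.
rewrite exprS; apply: (@le_trans _ _ ((1 + x) * (1 + N%:R * x))).
  have : 0 <= N%:R * x * x by rewrite !mulr_ge0.
  by rewrite -natr1; lra.
by rewrite ler_wpM2l// addr_ge0.
Qed.

Section half_line.
Variables (delta L : R) (phi1 phi2 : R -> R).
Hypotheses (d0 : 0 < delta) (dL : delta < L).
Hypotheses (c1 : continuous phi1) (c2 : continuous phi2).
Hypothesis moment0 : forall k : nat, \int[@lebesgue_measure R]_(t in `[delta, L])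
  (t^-1 ^+ k * (phi1 t + (-1) ^+ k * phi2 t)) = 0.

Let O := [set t : R | 0 < t].

Let itvO t : delta <= t <= L -> O t.
Proof. by move=> /andP[dt _]; exact: lt_le_trans dt. Qed.

Let cinv (t : R) : O t -> {for t, continuous (fun t : R => t^-1)}.
Proof. by move=> t0; apply: inv_continuous; rewrite gt_eqF. Qed.

Let cpoly (p : {poly R}) (s t : R) : O t ->
  {for t, continuous (fun t : R => p.[s * t^-1])}.
Proof.
move=> t0; apply: (@continuous_comp _ _ _ (fun t : R => s * t^-1) (fun s => p.[s])).
  by apply: cvgM; [exact: cvg_cst|exact: cinv].
exact: continuous_horner.
Qed.

(** The points 1/t and -1/t run through two intervals on either side of 0; the
    two functions live on one of them each. *)
Lemma poly_moment0 (p : {poly R}) : \int[@lebesgue_measure R]_(t in `[delta, L])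
  (p.[1 * t^-1] * phi1 t + p.[-1 * t^-1] * phi2 t) = 0.
Proof.
transitivity (\int[@lebesgue_measure R]_(t in `[delta, L])
    \sum_(i < size p) p`_i * (t^-1 ^+ i * (phi1 t + (-1) ^+ i * phi2 t))).
  apply: eq_Rintegral => t _; rewrite !horner_coef !mulr_suml -big_split/=.
  by apply: eq_bigr => i _; rewrite mul1r exprMn; ring.
rewrite (@Rintegral_sum _ _ _ (@lebesgue_measure R) `[delta, L]%classic
  (measurable_itv _) (itv_finite_measure delta L) _ _ _
  (fun (i : 'I_(size p)) (t : R) => t^-1 ^+ i * (phi1 t + (-1) ^+ i * phi2 t))).
  by apply: big1 => i _; rewrite moment0 mulr0.
move=> i; apply: (itv_bounded_on itvO) => t Ot; apply: cvgM.
  rewrite (_ : (fun t : R => t^-1 ^+ i) = fun t : R => ('X^i : {poly R}).[1 * t^-1]); last first.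
    by apply/funext => u; rewrite hornerXn mul1r.
  rewrite (_ : t^-1 ^+ i = ('X^i : {poly R}).[1 * t^-1]); first exact: cpoly.
  by rewrite hornerXn mul1r.
by apply: cvgD; [exact: c1|apply: cvgM; [exact: cvg_cst|exact: c2]].
Qed.

(** Landau's method: if phi1 were positive at t0, integrate against the powers
    P^N of a polynomial with P > 1 near 1/t0 and 0 <= P <= 1 on the rest of
    both intervals.  The contribution near t0 grows without bound, the rest
    stays bounded. *)
Lemma moment_nonpos t0 : delta < t0 < L -> phi1 t0 <= 0.
Proof.
move=> /andP[dt0 t0L]; rewrite leNgt; apply/negP => phi0.
have t00 : 0 < t0 by exact: lt_trans dt0.
pose s0 := t0^-1; have s00 : 0 < s0 by rewrite invr_gt0.
pose c := phi1 t0 / 2; have c0 : 0 < c by rewrite divr_gt0.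
have cc : c < phi1 t0 by rewrite /c; lra.
have [rho [rho0 rhos rhoP]] : exists rho : R, [/\ 0 < rho, rho <= s0 &
    forall s, `|s - s0| < rho -> c < phi1 s^-1].
  have ci : {for s0, continuous (fun s : R => phi1 s^-1)}.
    by apply: (@continuous_comp _ _ _ (fun s : R => s^-1) phi1); [exact: cinv|exact: c1].
  have : \forall s \near s0, c < phi1 s^-1.
    by apply: (cvgr_gt _ ci); rewrite /s0 invrK.
  move=> /nbhs_shiftP[r r0 rP]; exists (Num.min r s0).
  rewrite lt_min r0 s00 ge_min lexx orbT; split=> // s; rewrite lt_min => /andP[sr _].
  by rewrite -(subrK s0 s); exact: rP.
have [r [r0 rd rL rP]] : exists r : R, [/\ 0 < r, delta <= t0 - r, t0 + r <= L &
    forall t, `|t - t0| <= r -> `|t^-1 - s0| < rho / 2].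
  have rho20 : 0 < rho / 2 by rewrite divr_gt0.
  have : \forall t \near t0, `|s0 - t^-1| < rho / 2.
    by move/cvgrPdist_lt : (cinv t00); apply.
  move=> /nbhs_shiftP[r r0 rP].
  pose r' := Num.min (r / 2) (Num.min (t0 - delta) (L - t0)).
  have r'0 : 0 < r' by rewrite !lt_min divr_gt0// !subr_gt0 dt0.
  have r'1 : r' <= r / 2 by rewrite ge_min lexx.
  have r'2 : r' <= t0 - delta by rewrite !ge_min lexx orbT.
  have r'3 : r' <= L - t0 by rewrite !ge_min lexx !orbT.
  exists r'; split=> //; [by lra|by lra|].
  move=> t tr; rewrite distrC -(subrK t0 t); apply: rP.
  by rewrite (le_lt_trans tr)//; lra.
have cb (f : R -> R) : continuous f -> exists2 M, 0 <= M & forall t : R, `[delta, L]%classic t -> `|f t| <= M.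
  move=> cf; have [M M0 MP] := @compact_continuous_bounded R R `[delta, L]%classic f
    (@segment_compact _ delta L) (fun x _ => cf x).
  by exists M.
have [M1 M10 M1P] := cb _ c1; have [M2 M20 M2P] := cb _ c2.
pose T := delta^-1 + s0; have T0 : 0 < T by rewrite addr_gt0// invr_gt0.
pose B := (T ^+ 2)^-1; have B0 : 0 < B by rewrite invr_gt0 exprn_gt0.
pose x := 3 / 4 * (B * rho ^+ 2); have x0 : 0 < x by rewrite mulr_gt0// mulr_gt0// exprn_gt0.
pose P s := 1 + B * rho ^+ 2 - B * (s - s0) ^+ 2.
(* B is small enough for P to be nonnegative on both intervals. *)
have Pfar s : `|s| <= delta^-1 -> rho <= `|s - s0| -> 0 <= P s <= 1.
  move=> sd rs; have sq : rho ^+ 2 <= (s - s0) ^+ 2.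
    by rewrite -[leRHS]real_normK ?num_real// ler_pXn2r// nnegrE// ltW.
  have sT : (s - s0) ^+ 2 <= T ^+ 2.
    rewrite -[leLHS]real_normK ?num_real// ler_pXn2r// ?nnegrE// ?(ltW T0)//.
    by rewrite (le_trans (ler_normB _ _))// lerD// gtr0_norm.
  have : B * (s - s0) ^+ 2 <= 1.
    by rewrite /B mulrC ler_pdivrMr ?mul1r// exprn_gt0.
  have : B * rho ^+ 2 <= B * (s - s0) ^+ 2 by rewrite ler_pM2l.
  have : 0 <= B * rho ^+ 2 by rewrite mulr_ge0 ?sqr_ge0// ltW.
  rewrite /P; move: (B * (s - s0) ^+ 2) (B * rho ^+ 2) => u v *.
  by apply/andP; split; lra.
have Pnear s : `|s - s0| < rho -> 1 <= P s.
  move=> sr; have : (s - s0) ^+ 2 <= rho ^+ 2.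
    by rewrite -[leLHS]real_normK ?num_real// ler_pXn2r// ?nnegrE// ltW.
  move=> /(ler_wpM2l (ltW B0)); rewrite /P.
  by move: (B * _) (B * _) => u v; lra.
have Pcore s : `|s - s0| < rho / 2 -> 1 + x <= P s.
  move=> sr; have : (s - s0) ^+ 2 <= (rho / 2) ^+ 2.
    rewrite -[leLHS]real_normK ?num_real// ler_pXn2r// ?nnegrE// ltW// divr_gt0//.
  move=> /(ler_wpM2l (ltW B0)); rewrite /P /x.
  rewrite (_ : B * (rho / 2) ^+ 2 = B * rho ^+ 2 / 4); last by field.
  by move: (B * (s - s0) ^+ 2) (B * rho ^+ 2) => u v; lra.
suff H N : (1 + x) ^+ N * c * (r *+ 2) <= (M1 + M2) * (L - delta).
  pose q := (M1 + M2) * (L - delta) / (x * c * (r *+ 2)).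
  have den0 : 0 < x * c * (r *+ 2) by rewrite !mulr_gt0// mulrn_wgt0.
  have q0 : 0 <= q.
    rewrite /q; apply: divr_ge0 (ltW den0); apply: mulr_ge0; first exact: addr_ge0.
    by rewrite subr_ge0 ltW.
  have qN := archi_boundP q0; set N := Num.bound q in qN.
  have := H N; rewrite leNgt => /negP; apply.
  have qE : (M1 + M2) * (L - delta) = q * (x * c * (r *+ 2)).
    by rewrite /q divfK// gt_eqF.
  rewrite qE; apply: (@lt_le_trans _ _ (N%:R * (x * c * (r *+ 2)))).
    by rewrite ltr_pM2r.
  rewrite (_ : _ * (x * c * (r *+ 2)) = N%:R * x * c * (r *+ 2)); last by rewrite !mulrA.
  apply: ler_wpM2r; first by rewrite mulrn_wge0// ltW.
  apply: ler_wpM2r; first exact: ltW.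
  by apply: le_trans (bernoulli_ineq N (ltW x0)); rewrite lerDr.
pose p : {poly R} := ((1 + B * rho ^+ 2)%:P - B *: ('X - s0%:P) ^+ 2) ^+ N.
have pE s : p.[s] = P s ^+ N.
  by rewrite /p horner_exp; congr (_ ^+ N); rewrite hornerD hornerN hornerZ horner_exp hornerXsubC hornerC.
pose Q t := p.[1 * t^-1] * phi1 t + p.[-1 * t^-1] * phi2 t.
have bQ : bounded_on `[delta, L] Q.
  apply: (itv_bounded_on itvO) => t Ot.
  by apply: cvgD; apply: cvgM; [exact: cpoly|exact: c1|exact: cpoly|exact: c2].
pose A : set R := `[t0 - r, t0 + r]%classic.
have AD : A `<=` `[delta, L]%classic.
  move=> t; rewrite /A /= !in_itv/= => /andP[t1 t2].
  by rewrite (le_trans rd t1) (le_trans t2 rL).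
pose K := (1 + x) ^+ N * c.
pose lo t := ((fun=> K) \_ A) t - (M1 + M2).
have mA : measurable A by exact: measurable_itv.
have bI : bounded_on `[delta, L] ((fun=> K) \_ A).
  split.
    apply/(measurable_restrict _ mA (measurable_itv _)).
    exact: measurable_cst.
  exists `|K| => t _; rewrite patchE; case: ifP => // _; by rewrite normr0.
have bM : bounded_on `[delta, L] (fun _ : R => M1 + M2) by exact: bounded_on_cst.
have loE : \int[@lebesgue_measure R]_(t in `[delta, L]) (-1 * (M1 + M2) + ((fun=> K) \_ A) t) =
    K * (r *+ 2) - (M1 + M2) * (L - delta).
  rewrite itv_Rintegral_lin// Rintegral_cst; last exact: measurable_itv.
  rewrite -Rintegral_mkcondr setIidr// Rintegral_cst//.
  have lenE (a b : R) : a < b -> fine (@lebesgue_measure R `[a, b]) = b - a.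
    by move=> ab; rewrite lebesgue_measure_itv/= lte_fin ab.
  rewrite /A !lenE//; first by rewrite mulN1r addrC; congr (_ - _); congr (_ * _); rewrite mulr2n; ring.
  by rewrite ltrD2l (lt_trans _ r0)// oppr_lt0.
rewrite -subr_le0 -/K -loE -(poly_moment0 p).
have blo : bounded_on `[delta, L] (fun t => -1 * (M1 + M2) + ((fun=> K) \_ A) t).
  exact: bounded_on_lin.
apply: (itv_Rintegral_le blo bQ).
move=> t Dt; have := Dt; rewrite /= in_itv/= => /andP[t1 t2].
have tpos : 0 < t by exact: lt_le_trans t1.
have tinv : `|t^-1| <= delta^-1 by rewrite gtr0_norm ?invr_gt0// lef_pV2.
have PN u : 0 <= P u <= 1 -> `|p.[u]| <= 1.
  by move=> /andP[P0 P1]; rewrite pE normrX exprn_ile1// ger0_norm.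
have p1 : `|p.[-1 * t^-1]| <= 1.
  apply/PN/Pfar; first by rewrite mulN1r normrN.
  rewrite mulN1r -opprD normrN gtr0_norm; last by rewrite addr_gt0// invr_gt0.
  by apply: le_trans rhos _; rewrite lerDr invr_ge0 ltW.
have p2 : rho <= `|t^-1 - s0| -> `|p.[1 * t^-1]| <= 1.
  by move=> rt; apply/PN/Pfar; rewrite mul1r.
have b2 : - M2 <= p.[-1 * t^-1] * phi2 t.
  have : `|p.[-1 * t^-1] * phi2 t| <= M2.
    by rewrite normrM -[leRHS]mul1r ler_pM// M2P.
  by rewrite ler_norml => /andP[].
apply: split_lower_bound => //.
have [far|near] := leP rho `|t^-1 - s0|.
  rewrite patchE ifF; last first.
    apply/negbTE; apply: contraTN far => /set_mem.
    rewrite /A /= in_itv/= => /andP[u1 u2]; rewrite -ltNge.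
    have tr : `|t - t0| <= r by rewrite ler_distl u1 u2.
    by rewrite (lt_trans (rP _ tr))// ltr_pdivrMr// ltr_pMr// ltr1n.
  rewrite sub0r; have : `|p.[1 * t^-1] * phi1 t| <= M1.
    by rewrite normrM -[leRHS]mul1r ler_pM// ?M1P// p2.
  by rewrite ler_norml => /andP[].
have phit : c < phi1 t by rewrite -(invrK t); exact: rhoP.
have P1 : 1 <= P (1 * t^-1) by rewrite mul1r; exact: Pnear.
apply: (@le_trans _ _ (((fun=> K) \_ A) t)); first by rewrite gerBl.
rewrite patchE; case: ifP => [/set_mem|_]; last first.
    rewrite mulr_ge0//; last by rewrite ltW// (lt_trans c0).
    by rewrite pE exprn_ge0// (le_trans ler01).
  rewrite /A /= in_itv/= => /andP[u1 u2]; rewrite /K pE ler_pM//; last exact: ltW.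
  - by rewrite exprn_ge0// addr_ge0// ltW.
  - exact: ltW.
  - apply: lerXn2r; rewrite ?nnegrE.
    + by rewrite addr_ge0// ltW.
    + exact: le_trans ler01 P1.
    + by rewrite mul1r; apply/Pcore/rP; rewrite ler_distl u1 u2.
Qed.

End half_line.

(** The function is t |-> phi1 t for positive and phi2 (-t) for negative
    arguments; away from 0, polynomials in 1/t separate points. *)
Lemma moments_determine (delta L : R) (phi1 phi2 : R -> R) t0 : 0 < delta -> delta < L ->
  continuous phi1 -> continuous phi2 ->
  (forall k : nat, \int[@lebesgue_measure R]_(t in `[delta, L])
     (t^-1 ^+ k * (phi1 t + (-1) ^+ k * phi2 t)) = 0) ->
  delta < t0 < L -> phi1 t0 = 0.
Proof.
move=> d0 dL c1 c2 M0 t0P; apply/eqP; rewrite eq_le (moment_nonpos d0 dL c1 c2)//=.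
have cN (f : R -> R) : continuous f -> continuous (fun t : R => - f t).
  by move=> cf t; apply: cvgN; exact: cf.
rewrite -oppr_le0; apply: (moment_nonpos d0 dL (cN _ c1) (cN _ c2)) => // k.
have b : bounded_on `[delta, L] (fun t => t^-1 ^+ k * (phi1 t + (-1) ^+ k * phi2 t)).
  apply: (@itv_bounded_on _ delta L [set t : R | 0 < t]).
    by move=> t /andP[dt _]; exact: lt_le_trans dt.
  move=> t t0'; have dV : differentiable (fun t : R => t^-1) t.
    by apply/derivable1_diffP; apply: derivableV; [rewrite gt_eqF|exact: derivable_id].
  have cX := differentiable_continuous (deriveX_fun (1 : R) k dV).1.
  apply: cvgM; first exact: cX.
  by apply: cvgD; [exact: c1|apply: cvgM; [exact: cvg_cst|exact: c2]].
transitivity (-1 * 0 + 0 : R); last by rewrite mulr0 addr0.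
rewrite -{1}(M0 k) -(_ : \int[@lebesgue_measure R]_(t in `[delta, L]) (fun=> 0 : R) t = 0); last first.
  by rewrite Rintegral_cst// mul0r.
rewrite -itv_Rintegral_lin//; last exact: bounded_on_cst.
by apply: eq_Rintegral => t _; ring.
Qed.

End moments.

Lemma itv_Rintegral0 (R : realType) (a b : R) :
  \int[@lebesgue_measure R]_(t in `[a, b]) (fun=> 0 : R) t = 0.
Proof. by rewrite Rintegral_cst// mul0r. Qed.

Lemma itv_RintegralZ (R : realType) (a b c : R) (f : R -> R) : bounded_on `[a, b] f ->
  \int[@lebesgue_measure R]_(t in `[a, b]) (c * f t) =
  c * \int[@lebesgue_measure R]_(t in `[a, b]) f t.
Proof.
move=> bf; rewrite -[RHS]addr0 -(itv_Rintegral0 a b) -itv_Rintegral_lin//; last first.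
  exact: bounded_on_cst.
by apply: eq_Rintegral => t _; rewrite addr0.
Qed.

(** The convex combinations met on the segments of the path
    theta -> v -> -theta lie on the unit sphere of the l^1 norm. *)
Lemma itv_abs_split (R : realDomainType) (s : R) : 0 <= s -> s <= 1 ->
  `|1 - s| + `|s| = 1 /\ `|- s| + `|1 - s| = 1.
Proof.
move=> s0 s1; rewrite normrN !ger0_norm ?subr_ge0//.
by split; [rewrite subrK|rewrite addrC subrK].
Qed.

Lemma eq_oppr0 (R : realDomainType) (x : R) : x = - x -> x = 0.
Proof. by lra. Qed.

Lemma derivable1_differentiable (R : realType) (f : R -> R) t :
  derivable f t 1 -> differentiable f t.
Proof. by move=> /derivable1_diffP. Qed.

(** * Unique continuation in a plane *)

Section plane.
Context (R : realType) (n : nat).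
Local Notation V := 'rV[R]_n.
Implicit Types (eta g : V -> R).

Lemma line_is_deriveN g q (u : V) (t : R) : differentiable g (q + (- t) *: u) ->
  is_derive t (1 : R) (fun t : R => g (q + (- t) *: u)) (- 'D_u g (q + (- t) *: u)).
Proof.
move=> dg; have E (s : R) : s *: - u = (- s) *: u by rewrite scalerN scaleNr.
have dg' : differentiable g (q + t *: - u) by rewrite E.
have := line_is_derive dg'; rewrite deriveN_dir// E.
by rewrite (_ : (fun s : R => g (q + s *: - u)) = fun s : R => g (q + (- s) *: u))//;
  apply/funext => s; rewrite E.
Qed.

Lemma Rintegral_itv_skip (delta L : R) (f : R -> R) : 0 <= delta ->
  (forall t, 0 <= t <= delta -> f t = 0) ->
  \int[@lebesgue_measure R]_(t in `[0, L]) f t =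
  \int[@lebesgue_measure R]_(t in `[delta, L]) f t.
Proof.
move=> d0 f0; pose D : set R := `[0, L]%classic; pose P : set R := `[delta, L]%classic.
have PD : P `<=` D.
  by move=> t; rewrite /P /D /= !in_itv/= => /andP[dt ->]; rewrite (le_trans d0).
transitivity (\int[@lebesgue_measure R]_(t in D `&` P) f t); last by rewrite setIidr.
rewrite Rintegral_mkcondr; apply: eq_Rintegral => t.
rewrite inE /D /= in_itv/= => /andP[t0 tL]; rewrite patchE; case: ifPn => //.
rewrite notin_setE /P /= in_itv/= tL andbT => /negP; rewrite -ltNge => td.
by rewrite f0// t0 ltW.
Qed.

Variables (S : (V -> R) -> R) (q : V) (eps rho : R) (theta v : V).
Hypotheses (lS : smooth_linear S) (oS : finite_order S).
Hypotheses (eps0 : 0 < eps) (epsrho : (n%:R + 1) * eps <= rho).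
Hypothesis S_near : forall h, smooth h -> (forall y, h y != 0 -> `|y - q| <= 2 * eps) -> S h = 0.
Hypotheses (th1 : dot theta theta = 1) (v1 : dot v v = 1) (thv : dot theta v = 0).
Hypothesis kS : forall a b : R, a *: theta + b *: v != 0 ->
  kills_ridges S q rho (unit_dir (a *: theta + b *: v)).

Let adm eta := smooth eta /\ small_support eps eta.

Let adm_derive eta w : adm eta -> adm (fun y => 'D_w eta y).
Proof. by move=> [se eeta]; split; [exact: smooth_derive|exact: small_support_derive]. Qed.

Lemma moll_near eta x : adm eta -> `|x| <= eps -> moll S eta (q + x) = 0.
Proof.
move=> [se eeta] xe; apply: S_near; first exact: smooth_shift.
move=> y /eeta ye; rewrite (_ : y - q = (y - (q + x)) + x); last first.
  by rewrite opprD addrA subrK.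
by rewrite (le_trans (ler_normD _ _))//; lra.
Qed.

Lemma moll_vanish_far : exists R0 : R, forall eta x, adm eta -> R0 <= `|x| -> moll S eta (q + x) = 0.
Proof.
have [r0 r00 Sloc] := finite_order_local lS oS.
exists (r0 + eps + `|q| + 1) => eta x [se eeta] xR.
apply: (@moll_far _ _ S r0 eps) => //.
by have := ler_normB (q + x) q; rewrite addrAC subrr add0r; lra.
Qed.

Let frame_norm a b : enorm (a *: theta + b *: v) ^+ 2 = a ^+ 2 + b ^+ 2.
Proof.
rewrite enorm_sqr dotDl !dotDr !dotZl !dotZr th1 v1 (dotC v) thv.
by ring.
Qed.

Let n_gt0 : 0 < n%:R :> R.
Proof.
rewrite ltr0n lt0n; apply/eqP => n0.
have := th1; rewrite /dot big1; first by move=> /eqP; rewrite eq_sym oner_eq0.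
by move=> i _; have := ltn_ord i; rewrite {2}n0.
Qed.

Let frame_low a b : `|a| + `|b| = 1 -> 1 / (2 * n%:R) <= `|a *: theta + b *: v|.
Proof.
move=> ab; set u := _ + _.
have u2 : 2^-1 <= enorm u.
  rewrite -(@ler_pXn2r _ 2) ?nnegrE ?enorm_ge0 ?invr_ge0//.
  rewrite frame_norm -[a ^+ 2]real_normK ?num_real// -[b ^+ 2]real_normK ?num_real//.
  have -> : `|b| = 1 - `|a| by lra.
  have := sqr_ge0 (`|a| - 2^-1); rewrite -subr_ge0 => H.
  rewrite -subr_ge0 (_ : _ - _ = 2 * (`|a| - 2^-1) ^+ 2 + 2^-1 ^+ 2); last by field.
  by apply: addr_ge0; [apply: mulr_ge0 => //; exact: sqr_ge0|exact: sqr_ge0].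
have := le_trans u2 (enorm_le_norm u).
rewrite ler_pdivrMr ?mulr_gt0// => H.
by rewrite (mulrC 2) mulrA (mulrC `|u|); lra.
Qed.

Let dir_le1 (w : V) : dot w w = 1 -> `|w| <= 1.
Proof. by move=> w1; rewrite (le_trans (norm_le_enorm _))// /enorm w1 sqrtr1. Qed.

Let frame_up a b : `|a| + `|b| = 1 -> `|a *: theta + b *: v| <= 1.
Proof.
move=> ab; rewrite -ab (le_trans (ler_normD _ _))// !normrZ.
by rewrite lerD// ler_piMr// dir_le1.
Qed.

(** The moments of g along theta are computed as explained at the top.  The
    integrals start at eps rather than 0, which avoids the singularity of
    t^-k, since g vanishes near q; they are folded to positive t; and the path
    theta -> v -> -theta consists of two segments that stay at a distance from
    0, so that one L serves all its points. *)
Lemma moll_plane eta t0 : adm eta -> 0 < t0 -> moll S eta (q + t0 *: theta) = 0.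
Proof.
move=> aeta t00; have thn := dir_le1 th1.
have [t0e|et0] := leP t0 eps.
  apply: moll_near => //; rewrite normrZ gtr0_norm//.
  by rewrite (le_trans (ler_piMr _ thn))// ltW.
have [B B0 HB] := moll_line_integral q lS oS (ltW eps0) epsrho.
have [R0 HR0] := moll_vanish_far.
pose L := (B + `|R0| + 1) * (2 * n%:R) + t0 + 1.
have c10 : 0 < 1 / (2 * n%:R) :> R by rewrite divr_gt0// mulr_gt0.
have Lt0 : t0 < L.
  rewrite /L; have : 0 <= (B + `|R0| + 1) * (2 * n%:R).
    by rewrite mulr_ge0// ?addr_ge0 ?mulr_ge0// ltW.
  by lra.
have Le : eps < L by exact: lt_trans Lt0.
have L0 : 0 < L by exact: lt_trans Le.
have Lbig (u : V) : 1 / (2 * n%:R) <= `|u| -> B + `|R0| <= L * `|u|.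
  move=> ul; apply: (@le_trans _ _ (L * (1 / (2 * n%:R)))); last by rewrite ler_wpM2l// ltW.
  have m0 : 0 < 2 * n%:R :> R by rewrite mulr_gt0.
  rewrite mulrA mulr1 ler_pdivlMr// /L (mulrDl _ 1) mul1r.
  by lra.
pose O : set R := [set t | 0 < t].
have oO : open O by exact: open_gt.
have itvO t : eps <= t <= L -> O t by move=> /andP[et _]; exact: lt_le_trans et.
pose g zeta : V -> R := moll S zeta.
have sg zeta : adm zeta -> smooth (g zeta) by case=> sz _; exact: moll_smooth.
have dg zeta y : adm zeta -> differentiable (g zeta) y.
  by move=> az; exact: smooth_on_differentiable (sg _ az) _.
have Dg zeta w y : adm zeta -> 'D_w (g zeta) y = - g (fun z => 'D_w zeta z) y.
  by case=> sz _; exact: moll_derive.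
(* the zeroth moment, along every direction of the path *)
have I0 a b zeta : `|a| + `|b| = 1 -> adm zeta ->
    \int[@lebesgue_measure R]_(t in `[eps, L])
      (g zeta (q + t *: (a *: theta + b *: v)) + g zeta (q + (- t) *: (a *: theta + b *: v))) = 0.
  move=> ab az; set u := a *: theta + b *: v.
  have ul := frame_low ab; have uu := frame_up ab; rewrite -/u in ul uu.
  have u0 : u != 0 by rewrite -normr_gt0 (lt_le_trans c10).
  rewrite -Rintegral_itv_skip; [|exact: ltW|].
    have [sz ez] := az; apply: HB => //; first exact: kS.
    by rewrite (le_trans _ (Lbig _ ul))// lerDl.
  move=> t /andP[t_ge0 te].
  have tu : `|t *: u| <= eps.
    by rewrite normrZ ger0_norm// (le_trans (ler_piMr _ uu)).
  by rewrite /g !moll_near ?addr0// scaleNr normrN.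
(* The first moment I1 has zero derivative on the path, so it takes the same
   value at theta and - theta; but it is odd. *)
pose k1 zeta (p : V * R) := p.2^-1 * (g zeta (q + p.2 *: p.1) - g zeta (q + (- p.2) *: p.1)).
pose I1 zeta := itv_int eps L (k1 zeta).
have oS1 : open (slab O : set (V * R)) by exact: open_slab.
have s2 : smooth_on (slab O : set (V * R)) (fun p => p.2) by exact: smooth_sndR.
have sgm zeta (c : R) : adm zeta ->
    smooth_on (slab O : set (V * R)) (fun p => g zeta (q + (c * p.2) *: p.1)).
  move=> az; apply: (@smooth_on_compose _ _ _ _ setT _ _ oS1) (sg _ az) _ => //.
  apply: smooth_map_add; first exact: smooth_map_cst.
  by apply: smooth_map_mul; [|exact: smooth_onZ|exact: smooth_fst].
have k1E zeta : k1 zeta = fun p => p.2^-1 *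
    (g zeta (q + (1 * p.2) *: p.1) + -1 * g zeta (q + (-1 * p.2) *: p.1)).
  by apply/funext => p; rewrite /k1 mul1r !mulN1r.
have sinv : smooth_on (slab O : set (V * R)) (fun p => p.2^-1).
  by apply: (@smooth_on_comp1 _ _ _ _ _ (fun p : V * R => p.2) oS1 s2 (@smooth_on_inv R)).
have sdiff zeta : adm zeta -> smooth_on (slab O : set (V * R)) (fun p =>
    g zeta (q + (1 * p.2) *: p.1) + -1 * g zeta (q + (-1 * p.2) *: p.1)).
  by move=> az; apply: smooth_onD => //; [exact: sgm|apply: smooth_onZ => //; exact: sgm].
have sk1 zeta : adm zeta -> smooth_on (slab O : set (V * R)) (k1 zeta).
  by move=> az; rewrite k1E; apply: smooth_onM => //; exact: sdiff.
have DI1 zeta w a b : adm zeta -> `|a| + `|b| = 1 ->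
    'D_w (I1 zeta) (a *: theta + b *: v) = 0.
  move=> az ab; set u := _ + _.
  rewrite (@itv_int_derive _ _ eps L O oO itvO (k1 zeta) w u (sk1 _ az)) /itv_int.
  have I0D := I0 a b (fun z => 'D_w zeta z) ab (adm_derive w az).
  transitivity (-1 * \int[@lebesgue_measure R]_(t in `[eps, L])
      (g (fun z => 'D_w zeta z) (q + t *: u) + g (fun z => 'D_w zeta z) (q + (- t) *: u))); last first.
    by rewrite I0D mulr0.
  have bd zeta' (c : R) : adm zeta' -> bounded_on `[eps, L] (fun t => g zeta' (q + (c * t) *: u)).
    move=> az'; apply: (itv_bounded_on itvO) => t _; apply: differentiable_continuous.
    have sl : smooth_on setT (fun t : R => g zeta' (q + (c * t) *: u)).
      apply: (@smooth_on_compose _ _ _ setT setT _ _ (@openT R)) (sg _ az') _ => //.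
      apply: smooth_map_add; first exact/smooth_map_cst/openT.
      by apply/smooth_map_scale/smooth_onZ; [exact: openT|exact/smooth_idR/openT].
    exact: smooth_on_differentiable sl _.
  have b12 : bounded_on `[eps, L] (fun t => g (fun z => 'D_w zeta z) (q + t *: u) +
      g (fun z => 'D_w zeta z) (q + (- t) *: u)).
    have b1 := bd _ 1 (adm_derive w az); have b2 := bd _ (-1) (adm_derive w az).
    have E : (fun t => g (fun z => 'D_w zeta z) (q + t *: u) +
        g (fun z => 'D_w zeta z) (q + (- t) *: u)) =
        (fun t => 1 * g (fun z => 'D_w zeta z) (q + (1 * t) *: u) +
        g (fun z => 'D_w zeta z) (q + (-1 * t) *: u)).
      by apply/funext => t; rewrite !mul1r mulN1r.
    by rewrite E; exact: (bounded_on_lin 1 b1 b2).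
  rewrite -(itv_RintegralZ _ b12).
  apply: eq_Rintegral => t; rewrite inE /= in_itv/= => /itvO t_gt0.
  have Op : slab O ((u, t) : V * R) by [].
  have D1 (c : R) : 'D_(w, 0) (fun p : V * R => g zeta (q + (c * p.2) *: p.1)) (u, t) =
      c * t * 'D_w (g zeta) (q + (c * t) *: u).
    rewrite -deriveZ_dir; last exact: dg.
    apply: derive_curve_eq => s; rewrite -[_ + s *: _]/(_, _)/= scaler0 addr0.
    by rewrite scalerDr addrA scalerA scalerA (mulrC s).
  have d1 c := smooth_on_differentiable (sgm zeta c az) Op.
  have d2 := smooth_on_differentiable (sdiff zeta az) Op.
  have d3 := smooth_on_differentiable sinv Op.
  rewrite k1E (deriveM_fun _ d3 d2) (@derive_invariant _ _ (fun p : V * R => p.2^-1)); last first.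
    by move=> s; transitivity ((t + s * 0)^-1); [by []|rewrite mulr0 addr0].
  have d4 : differentiable (fun p : V * R => -1 * g zeta (q + (-1 * p.2) *: p.1)) (u, t).
    by apply: differentiableM_fun => //; exact: differentiable_cst.
  pose G1 := g (fun z => 'D_w zeta z) (q + t *: u).
  pose G2 := g (fun z => 'D_w zeta z) (q + (- t) *: u).
  have E1 : 'D_(w, 0) (fun p : V * R => g zeta (q + (1 * p.2) *: p.1)) (u, t) = - (t * G1).
    by rewrite D1 Dg// mul1r mulrN.
  have E2 : 'D_(w, 0) (fun p : V * R => g zeta (q + (-1 * p.2) *: p.1)) (u, t) = t * G2.
    by rewrite D1 Dg// mulN1r mulrNN.
  have E3 : 'D_(w, 0) (fun p : V * R => -1 * g zeta (q + (-1 * p.2) *: p.1)) (u, t) = - (t * G2).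
    rewrite (@deriveM_fun _ _ (cst (-1)) _ _ _ _ (d1 (-1))); last exact: differentiable_cst.
    by rewrite derive_cst mul0r addr0 E2; exact: mulN1r.
  rewrite mul0r addr0 (deriveD_fun _ (d1 1) d4) E1 E3 -/G1 -/G2 -[(u, t).2]/t.
  have tn0 : t != 0 by rewrite gt_eqF.
  by rewrite -opprD -mulrDr mulrN (mulKf tn0); exact/esym/mulN1r.
have I1_0 zeta : adm zeta -> I1 zeta theta = 0.
  move=> az; have dI w : differentiable (I1 zeta) w.
    exact: smooth_on_differentiable (itv_int_smooth oO itvO (sk1 _ az)) _.
  have E1 : I1 zeta v = I1 zeta theta.
    have [|s /andP[s0 s1]] := @mean_value _ _ (I1 zeta) theta (v - theta).
      by move=> *; exact: dI.
    rewrite (_ : theta + s *: (v - theta) = (1 - s) *: theta + s *: v); last first.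
      by apply/rowP => i; rewrite !mxE; ring.
    have ab : `|1 - s| + `|s| = 1 by have [] := itv_abs_split s0 s1.
    rewrite (DI1 zeta _ _ _ az ab) (addrC theta) subrK => E.
    by apply/eqP; rewrite -subr_eq0; apply/eqP.
  have E2 : I1 zeta (- theta) = I1 zeta v.
    have [|s /andP[s0 s1]] := @mean_value _ _ (I1 zeta) v (- theta - v).
      by move=> *; exact: dI.
    rewrite (_ : v + s *: (- theta - v) = (- s) *: theta + (1 - s) *: v); last first.
      by apply/rowP => i; rewrite !mxE; ring.
    have ab : `|- s| + `|1 - s| = 1 by have [] := itv_abs_split s0 s1.
    rewrite (DI1 zeta _ _ _ az ab) (addrC v) subrK => E.
    by apply/eqP; rewrite -subr_eq0; apply/eqP.
  have E3 : I1 zeta (- theta) = - I1 zeta theta.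
    have b1 : bounded_on `[eps, L] (fun t => k1 zeta (theta, t)).
      apply: (itv_bounded_on itvO) => t Ot; apply: differentiable_continuous.
      apply: (@differentiable_comp_fun _ _ _ _ (k1 zeta) (fun t => (theta, t)) t _ _).1.
        by apply: (@differentiable_pair _ _ _ _ (cst theta) id) => //; exact: differentiable_cst.
      exact: (smooth_on_differentiable (sk1 _ az)).
    rewrite -mulN1r -(itv_RintegralZ _ b1); apply: eq_Rintegral => t _.
    by rewrite /k1 /= !scalerN !scaleNr !opprK mulN1r -mulrN opprB.
  by apply: eq_oppr0; rewrite -{1}E1 -E2.
(* The sign (-1)^k comes from folding t < 0 onto t > 0; differentiation flips
   it, and integrating the derivative of t^-(k+1) phi relates the moments of
   orders k + 2 and k + 1. *)
pose phi zeta (k : nat) (t : R) := g zeta (q + t *: theta) + (-1) ^+ k * g zeta (q + (- t) *: theta).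
have dphi zeta k (t : R) : adm zeta -> is_derive t (1 : R) (phi zeta k)
    (- phi (fun z => 'D_theta zeta z) k.+1 t).
  move=> az; have [d1 D1] := line_is_derive (dg _ (q + t *: theta) az).
  have [d2 D2] := line_is_deriveN (dg _ (q + (- t) *: theta) az).
  have dd1 : differentiable (fun s : R => g zeta (q + s *: theta)) t := derivable1_differentiable d1.
  have dd2 : differentiable (fun s : R => g zeta (q + (- s) *: theta)) t := derivable1_differentiable d2.
  have dd3 : differentiable (fun s : R => (-1) ^+ k * g zeta (q + (- s) *: theta)) t.
    by apply: differentiableM_fun => //; exact: differentiable_cst.
  apply: DeriveDef; first exact/derivable1_diffP/differentiableD_fun.
  rewrite (deriveD_fun _ dd1 dd3) D1 (@deriveM_fun _ _ (cst ((-1) ^+ k)) _ _ _ _ dd2); last first.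
    exact: differentiable_cst.
  by rewrite derive_cst mul0r addr0 D2 !Dg// /phi /cst exprS; ring.
have cphi zeta k : adm zeta -> continuous (phi zeta k).
  move=> az t; apply: differentiable_continuous; apply/derivable1_diffP.
  by case: (dphi zeta k t az).
have moments k : forall zeta, adm zeta -> \int[@lebesgue_measure R]_(t in `[eps, L])
    (t^-1 ^+ k * phi zeta k t) = 0.
  case: k => [zeta az|].
    rewrite -[RHS](I0 1 0 zeta _ az); last by rewrite normr1 normr0 addr0.
    by apply: eq_Rintegral => t _; rewrite /phi !expr0 !mul1r scale1r scale0r addr0.
  elim=> [zeta az|k IH zeta az].
    rewrite -[RHS](I1_0 zeta az); apply: eq_Rintegral => t _.
    by rewrite /k1 /phi /= !expr1 mulN1r.
  have azD := adm_derive theta az.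
  pose F (t : R) := t^-1 ^+ k.+1 * phi zeta k.+2 t.
  pose f (t : R) : R := - k.+1%:R * (t^-1 ^+ k.+2 * phi zeta k.+2 t) +
     -1 * (t^-1 ^+ k.+1 * phi (fun z => 'D_theta zeta z) k.+1 t).
  have dV (t : R) : O t -> differentiable (fun t : R => t^-1) t.
    by move=> t0'; apply/derivable1_diffP; apply: derivableV; [rewrite gt_eqF|exact: derivable_id].
  have dX j (t : R) : O t -> differentiable (fun t : R => t^-1 ^+ j) t.
    by move=> Ot; exact: (deriveX_fun (1 : R) j (dV t Ot)).1.
  have dF (t : R) : O t -> is_derive t 1 F (f t).
    move=> Ot; have [dp Dp] := dphi zeta k.+2 t az.
    have ddp : differentiable (phi zeta k.+2) t by exact/derivable1_diffP.
    have DX := (deriveX_fun (1 : R) k.+1 (dV t Ot)).2.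
    apply: DeriveDef; first exact/derivable1_diffP/differentiableM_fun/ddp/dX.
    rewrite (deriveM_fun _ (dX k.+1 t Ot) ddp) Dp DX.
    have DV : 'D_1 (fun s : R => s^-1) t = - t ^- 2.
      rewrite (@deriveV R (R : normedModType R) id t 1 (lt0r_neq0 Ot) (@derivable_id _ _ _ _)).
      by rewrite derive_id; exact: mulr1.
    rewrite DV.
    rewrite /f /phi !exprS /=.
    by rewrite expr0 !mulr1 invfM; ring.
  have cf (t : R) : O t -> {for t, continuous f}.
    move=> Ot; have c1 := differentiable_continuous (dX k.+2 t Ot).
    have c2 := differentiable_continuous (dX k.+1 t Ot).
    have c3 := cvgM c1 (cphi zeta k.+2 az t).
    have c4 := cvgM c2 (cphi _ k.+1 azD t).
    apply: cvgD; apply: cvgM; [exact: cvg_cst| |exact: cvg_cst|].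
      exact: c3.
    exact: c4.
  have phi0 zeta' j t : adm zeta' -> t = eps \/ t = L -> phi zeta' j t = 0.
    move=> az' [->|->]; rewrite /phi.
      have ee : `|eps *: theta| <= eps.
        by rewrite normrZ gtr0_norm// (le_trans (ler_piMr _ thn))// ltW.
      by rewrite /g !moll_near ?mulr0 ?addr0// scaleNr normrN.
    have thl : 1 / (2 * n%:R) <= `|theta|.
      have := @frame_low 1 0; rewrite scale1r scale0r addr0; apply.
      by rewrite normr1 normr0 addr0.
    have LR : R0 <= `|L *: theta|.
      rewrite normrZ gtr0_norm// (le_trans _ (Lbig _ thl))//.
      by rewrite (le_trans (ler_norm _))// lerDr ltW.
    by rewrite /g !HR0 ?mulr0 ?addr0// scaleNr normrN.
  have FTC := @itv_FTC R eps L O itvO F f Le dF cf.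
  have PL : phi zeta k.+2 L = 0 by apply: phi0 => //; right.
  have Pe : phi zeta k.+2 eps = 0 by apply: phi0 => //; left.
  rewrite /F PL Pe in FTC.
  have bphi j z : adm z -> bounded_on `[eps, L] (fun t => t^-1 ^+ j * phi z j t).
    move=> az'; apply: (itv_bounded_on itvO) => t Ot.
    have c1 := differentiable_continuous (dX j t Ot).
    by apply: cvgM => //; exact: cphi.
  have b2 : bounded_on `[eps, L] (fun t => -1 * (t^-1 ^+ k.+1 * phi (fun z => 'D_theta zeta z) k.+1 t)).
    have E : (fun t => -1 * (t^-1 ^+ k.+1 * phi (fun z => 'D_theta zeta z) k.+1 t)) =
        (fun t => -1 * (t^-1 ^+ k.+1 * phi (fun z => 'D_theta zeta z) k.+1 t) + 0).
      by apply/funext => t; rewrite addr0.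
    by rewrite E; exact: (bounded_on_lin (-1) (bphi k.+1 _ azD) (bounded_on_cst _ 0)).
  rewrite /f (itv_Rintegral_lin _ (bphi k.+2 _ az) b2) in FTC.
  have E0 : \int[@lebesgue_measure R]_(t in `[eps, L])
      (-1 * (t^-1 ^+ k.+1 * phi (fun z => 'D_theta zeta z) k.+1 t)) = 0.
    by rewrite (itv_RintegralZ _ (bphi k.+1 _ azD)) (IH _ azD) mulr0.
  move: FTC; rewrite E0 addr0 !mulr0 subrr => /eqP; rewrite mulf_eq0 oppr_eq0 pnatr_eq0 /=.
  by move=> /eqP.
have cg (c : R) : continuous (fun t : R => g eta (q + (c * t) *: theta)).
  move=> t; apply: differentiable_continuous.
  have sl : smooth_on setT (fun t : R => g eta (q + (c * t) *: theta)).
    apply: (@smooth_on_compose _ _ _ setT setT _ _ (@openT R)) (sg _ aeta) _ => //.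
    apply: smooth_map_add; first exact/smooth_map_cst/openT.
    by apply/smooth_map_scale/smooth_onZ; [exact: openT|exact/smooth_idR/openT].
  exact: smooth_on_differentiable sl _.
have := @moments_determine R eps L _ _ t0 eps0 Le (cg 1) (cg (-1)).
rewrite mul1r; apply; last by rewrite et0.
move=> k; rewrite -[RHS](moments k eta aeta); apply: eq_Rintegral => t _.
by rewrite /phi mul1r mulN1r.
Qed.

End plane.

(** * A partition of unity by small cells *)

Section partition.
Context (R : realType) (n : nat).
Local Notation V := 'rV[R]_n.

(** A bump of width 2 r around r (m + 1), the difference of two consecutive
    steps. *)
Definition cell (r : R) (m : R) (t : R) : R := step (r^-1 * t - m) - step (r^-1 * t - (m + 1)).

Lemma smooth_cell r m i : smooth (fun y : V => cell r m (y 0 i)).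
Proof.
have sa c : smooth (fun y : V => step (r^-1 * y 0 i - c)).
  apply: (@smooth_on_comp1 R V setT setT (@step R) (fun y : V => r^-1 * y 0 i - c)) => //.
  - exact: openT.
  - by apply: smooth_onB; [exact: openT|apply: smooth_onZ; [exact: openT|exact/smooth_coord/openT]|
      exact/smooth_on_cst/openT].
  - exact: smooth_step.
by apply: smooth_onB; [exact: openT|exact: sa|exact: sa].
Qed.

Lemma cell_support r m t : 0 < r -> cell r m t != 0 -> `|t - r * (m + 1)| <= r.
Proof.
move=> r0 ct; have tE : t = r * (r^-1 * t) by rewrite mulrA divff ?mul1r ?gt_eqF.
rewrite {1}tE -mulrBr normrM gtr0_norm// -[leRHS]mulr1 ler_pM2l//.
rewrite /cell in ct; set s := r^-1 * t in ct *.
rewrite ler_norml; apply/andP; split; rewrite leNgt; apply/negP => H; move/eqP: ct; apply.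
  by rewrite !step0 ?subrr//; lra.
by rewrite !step1 ?subrr//; lra.
Qed.

(** The sum telescopes. *)
Lemma sum_cell r (M : nat) t : 0 < r -> `|t| <= r * (M%:R - 1) ->
  \sum_(k < M.*2) cell r (k%:R - M%:R) t = 1.
Proof.
move=> r0; have tE : t = r * (r^-1 * t) by rewrite mulrA divff ?mul1r ?gt_eqF.
rewrite {1}tE normrM gtr0_norm// ler_pM2l// ler_norml => /andP[t1 t2].
set s := r^-1 * t in t1 t2 *.
transitivity (\sum_(k < M.*2) (step (s - (k%:R - M%:R)) - step (s - (k.+1%:R - M%:R)))).
  by apply: eq_bigr => k _; rewrite /cell -/s -(natr1 k); congr (_ - step (_ - _)); ring.
rewrite -(big_mkord xpredT (fun k => step (s - (k%:R - M%:R)) - step (s - (k.+1%:R - M%:R)))).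
rewrite -[LHS]opprK -sumrN (eq_bigr (fun k => step (s - (k.+1%:R - M%:R)) - step (s - (k%:R - M%:R)))).
  rewrite telescope_sumr// opprB step1; last by lra.
  by rewrite step0 ?subr0//; have := @natrD R M M; rewrite addnn => ->; lra.
by move=> k _; rewrite opprB.
Qed.

(** Multiply h by products of cells: on the ball seen by S, h is a finite sum of
    translates of functions with small support. *)
Lemma vanish_of_small (S : (V -> R) -> R) eps : 0 < eps -> smooth_linear S -> finite_order S ->
  (forall eta x, smooth eta -> small_support eps eta -> moll S eta x = 0) ->
  forall h, smooth h -> S h = 0.
Proof.
move=> eps0 lS oS Seta h sh.
have [r r0 Sloc] := finite_order_local lS oS.
pose M := (Num.truncn (eps^-1 * r)).+2.
have rM : r <= eps * (M%:R - 1).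
  rewrite mulrC -ler_pdivrMr// mulrC.
  have -> : M%:R - 1 = (Num.truncn (eps^-1 * r)).+1%:R :> R by rewrite /M -natr1 addrK.
  exact/ltW/truncnS_gt.
pose chi (kap : {ffun 'I_n -> 'I_M.*2}) (y : V) := \prod_i cell eps ((kap i)%:R - M%:R) (y 0 i).
have schi kap : smooth (fun y => chi kap y * h y).
  apply: smooth_onM => //; first exact: openT.
  by apply: smooth_on_prod => [|i _]; [exact: openT|exact: smooth_cell].
rewrite (Sloc h (fun y => \sum_(kap : {ffun 'I_n -> 'I_M.*2}) 1 * (chi kap y * h y)) sh).
- rewrite smooth_linear_sum// big1// => kap _; rewrite mul1r.
  pose c : V := \row_i (eps * ((kap i)%:R - M%:R + 1)).
  rewrite -(Seta (fun y => chi kap (y - - c) * h (y - - c)) c).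
  + by rewrite /moll; congr S; apply/funext => y; rewrite opprK subrK.
  + exact: (smooth_shift (- c) (schi kap)).
  + move=> y; rewrite opprK mulf_eq0 negb_or => /andP[+ _].
    move=> /prodf_neq0 yc; apply: norm_le_coord => [|i]; first exact: ltW.
    have := cell_support eps0 (yc i isT); rewrite !mxE.
    by rewrite addrK.
- apply: smooth_on_sum => [|kap _]; first exact: openT.
  by apply: smooth_onZ; [exact: openT|exact: schi].
- move=> x xr; under eq_bigr do rewrite mul1r.
  rewrite -mulr_suml -(bigA_distr_bigA (fun i (k : 'I_M.*2) => cell eps (k%:R - M%:R) (x 0 i))).
  rewrite big1 ?mul1r// => i _; apply: sum_cell => //.
  by rewrite (le_trans (coord_le_norm x i))// (le_trans _ rM)// ltW.
Qed.

End partition.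

(** * The exterior derivative contracted with two vectors *)

Section curl.
Context (R : realType) (n : nat) (f : 'I_n -> cs_distribution R n).
Local Notation V := 'rV[R]_n.
Local Notation e := (@Defs.basis R n).

(** The pairing of f with the vector field h w. *)
Definition along (w : V) (h : V -> R) : R := \sum_i w 0 i * f i h.

(** The contraction sum_ij u_i w_j T_ij of the exterior derivative
    ([curl_coord]).  Being bilinear and alternating, it can be evaluated in any
    basis of a plane. *)
Definition curl (u w : V) (h : V -> R) : R :=
  along u (fun y => 'D_w h y) - along w (fun y => 'D_u h y).

Lemma along_combo a u w h : along (a *: u + w) h = a * along u h + along w h.
Proof.
rewrite /along mulr_sumr -big_split; apply: eq_bigr => i _.
by rewrite !mxE mulrDl mulrA.
Qed.

Lemma along_linear w : smooth_linear (along w).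
Proof.
move=> a phi psi sp ss; rewrite /along mulr_sumr -big_split; apply: eq_bigr => i _.
by rewrite (cs_smooth_linear (f i) a sp ss) /=; ring.
Qed.

Lemma curl_antisym u w h : curl u w h = - curl w u h.
Proof. by rewrite /curl opprB. Qed.

Lemma curl_self w h : curl w w h = 0.
Proof. by rewrite /curl subrr. Qed.

Lemma curl_combor a u v w h : smooth h ->
  curl u (a *: v + w) h = a * curl u v h + curl u w h.
Proof.
move=> sh; rewrite /curl along_combo.
have -> : (fun y => 'D_(a *: v + w) h y) = fun y => a * 'D_v h y + 'D_w h y.
  by apply/funext => y; rewrite derive_combo//; exact: smooth_on_differentiable sh _.
rewrite (along_linear u a (smooth_derive v sh) (smooth_derive w sh)).
by rewrite mulrBr opprD addrACA.
Qed.

Lemma curl_combol a u v w h : smooth h ->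
  curl (a *: u + v) w h = a * curl u w h + curl v w h.
Proof.
by move=> sh; rewrite curl_antisym curl_combor// opprD -mulrN -!curl_antisym.
Qed.

Lemma curl0l w h : smooth h -> curl 0 w h = 0.
Proof.
move=> sh; have := curl_combol 1 0 0 w sh; rewrite scaler0 addr0 mul1r => E.
by apply: (addrI (curl 0 w h)); rewrite addr0 -E.
Qed.

Lemma curlZl a u w h : smooth h -> curl (a *: u) w h = a * curl u w h.
Proof. by move=> sh; have := curl_combol a u 0 w sh; rewrite addr0 curl0l// addr0. Qed.

Lemma along_basis i h : along (e i) h = f i h.
Proof.
rewrite /along (bigD1 i)//= big1 => [|j ji]; rewrite !mxE eqxx /=; first by rewrite eqxx mul1r addr0.
by rewrite (negbTE ji) mul0r.
Qed.

Lemma curl_basis i j h : curl (e i) (e j) h = f i (partial j h) - f j (partial i h).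
Proof. by rewrite /curl !along_basis. Qed.

Lemma curl_suml (I : Type) (r : seq I) (c : I -> R) (b : I -> V) w h : smooth h ->
  curl (\sum_(i <- r) c i *: b i) w h = \sum_(i <- r) c i * curl (b i) w h.
Proof.
move=> sh; elim: r => [|i r IH]; first by rewrite !big_nil curl0l.
by rewrite !big_cons curl_combol// IH.
Qed.

Lemma curl_coord u w h : smooth h ->
  curl u w h = \sum_i u 0 i * \sum_j w 0 j * (f i (partial j h) - f j (partial i h)).
Proof.
move=> sh; rewrite {1}(row_basis u) curl_suml//; apply: eq_bigr => i _; congr (_ * _).
rewrite curl_antisym {1}(row_basis w) curl_suml// -sumrN; apply: eq_bigr => j _.
by rewrite -mulrN -curl_antisym curl_basis.
Qed.

Lemma curl_linear u w : smooth_linear (curl u w).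
Proof.
move=> a phi psi sp ss; rewrite /curl.
have D v : (fun y => 'D_v (fun x => a * phi x + psi x) y) = fun y => a * 'D_v phi y + 'D_v psi y.
  apply/funext => y; have d1 := smooth_on_differentiable (x := y) sp I.
  have d2 := smooth_on_differentiable (x := y) ss I.
  have d3 : differentiable (fun x => a * phi x) y.
    by apply: differentiableM_fun d1; exact: differentiable_cst.
  rewrite (deriveD_fun _ d3 d2) (@deriveM_fun _ _ (cst a) _ _ _ _ d1); last exact: differentiable_cst.
  by rewrite derive_cst mul0r addr0.
rewrite !D !along_linear; first by rewrite mulrBr opprD addrACA.
all: exact: smooth_derive.
Qed.

Lemma finite_order_lin a (S T : (V -> R) -> R) : finite_order S -> finite_order T ->
  finite_order (fun h => a * S h + T h).
Proof.
move=> [r1 [N1 [C1 [C10 H1]]]] [r2 [N2 [C2 [C20 H2]]]].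
exists (Num.max r1 r2), (maxn N1 N2), (`|a| * C1 + C2).
split=> [|h M sh M0 hM]; first by rewrite addr_ge0// mulr_ge0.
have b1 : order_bound r1 N1 h M.
  by move=> s sN x xr; apply: hM; [rewrite leq_max sN|rewrite le_max xr].
have b2 : order_bound r2 N2 h M.
  by move=> s sN x xr; apply: hM; [rewrite leq_max sN orbT|rewrite le_max xr orbT].
rewrite (le_trans (ler_normD _ _))// mulrDl lerD ?H2// normrM -mulrA ler_wpM2l//.
exact: H1.
Qed.

Lemma finite_order_sum (I : Type) (r : seq I) (c : I -> R) (S : I -> (V -> R) -> R) :
  (forall i, finite_order (S i)) -> finite_order (fun h => \sum_(i <- r) c i * S i h).
Proof.
move=> oS; elim: r => [|i r IH].
  by exists 0, 0, 0; split=> // h M _ _ _; rewrite big_nil normr0 mul0r.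
have [r0 [N [C [C0 H]]]] := finite_order_lin (c i) (oS i) IH.
by exists r0, N, C; split=> // h M sh M0 hM; rewrite big_cons; exact: H.
Qed.

Lemma finite_order_partial (S : (V -> R) -> R) i : finite_order S ->
  finite_order (fun h => S (partial i h)).
Proof.
move=> [r [N [C [C0 H]]]]; exists r, N.+1, C; split=> // h M sh M0 hM.
apply: H => //; first exact: smooth_derive.
by move=> s sN x xr; rewrite /partial -iter_derive_rcons -map_rcons; apply: hM => //; rewrite size_rcons.
Qed.

Lemma curl_order u w : finite_order (curl u w).
Proof.
have oT i j : finite_order (fun h => f i (partial j h) - f j (partial i h)).
  have := finite_order_lin (-1) (finite_order_partial i (cs_finite_order (f j)))
    (finite_order_partial j (cs_finite_order (f i))).
  move=> [r [N [C [C0 H]]]]; exists r, N, C; split=> // h M sh M0 hM.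
  by have := H h M sh M0 hM; rewrite mulN1r addrC.
have [r [N [C [C0 H]]]] := finite_order_sum (index_enum 'I_n) (fun i => u 0 i)
  (fun i => finite_order_sum (index_enum 'I_n) (fun j => w 0 j) (oT i)).
by exists r, N, C; split=> // h M sh M0 hM; rewrite curl_coord//; exact: H.
Qed.

End curl.

(** * Consequences of the hypotheses for the exterior derivative *)

Section necessity.
Context (R : realType) (n : nat) (f : 'I_n -> cs_distribution R n).
Local Notation V := 'rV[R]_n.
Local Notation e := (@Defs.basis R n).

Lemma smooth_map_subr (q : V) : smooth_map setT (fun x : V => x - q).
Proof. by apply: smooth_map_add; [exact/smooth_id/openT|exact/smooth_map_cst/openT]. Qed.

Lemma open_tubeC (q theta : V) (rho : R) : open [set x | ~ tube q theta rho x].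
Proof.
pose F (x : V) : V := x - q - dot (x - q) theta *: theta.
have cF : continuous F.
  have sF : smooth_map setT F.
    have s1 := smooth_map_subr q.
    apply: smooth_map_add => //; apply: smooth_map_opp; first exact: openT.
    apply: smooth_map_scale; rewrite /dot.
    apply: smooth_on_sum => [|i _]; first exact: openT.
    apply: smooth_onM; [exact: openT| |exact/smooth_on_cst/openT].
    by apply: smooth_map_coord; [exact: openT|exact: s1].
  move=> x; apply: differentiable_continuous.
  by apply: (smooth_map_differentiable (@openT _) sF).
rewrite (_ : [set x | _] = (fun x => `|F x|) @^-1` [set r | rho < r]).
  apply: open_comp; last exact: open_gt.
  move=> x _; apply: continuous_comp; first exact: cF.
  exact: norm_continuous.
apply/seteqP; split=> x /=; rewrite /tube -/(F x) ltNge; first by move/negP.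
by move/negP.
Qed.

(** The derivative of h along u vanishes and the one along z is again a ridge
    function, supported in the same tube as the tube is closed. *)
Lemma curl_kills_ridges A q rho u z :
  xray_vanishes_on_lines_meeting f A -> enorm u = 1 -> 0 < rho ->
  (forall y, `|y - q| <= 2 * rho -> A y) -> kills_ridges (curl f u z) q rho u.
Proof.
move=> fA u1 rho0 qA h sh rh th; rewrite /curl.
have -> : (fun y => 'D_u h y) = fun=> 0.
  by apply/funext => y; apply: derive_invariant => t; exact: rh.
rewrite (smooth_linear0 (along_linear f z)) subr0.
apply: (ridge_vanish fA u1 rho0 qA (smooth_derive z sh)) => [x t|x].
  by apply: derive_curve_eq => s; rewrite addrAC rh.
apply: contra_neqP => nx.
rewrite (@eq_on_derive _ _ _ h (cst 0) z x (@open_tubeC q u rho))//; first exact: derive_cst.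
move=> y ny; apply/eqP; apply: contra_notT ny; exact: th.
Qed.

(** In the basis formed by u = a theta + b v and either theta or v, the
    contraction is a multiple of one to which [curl_kills_ridges] applies. *)
Lemma curl_kills_plane_ridges A q rho theta v a b :
  xray_vanishes_on_lines_meeting f A -> 0 < rho ->
  (forall y, `|y - q| <= 2 * rho -> A y) -> a *: theta + b *: v != 0 ->
  kills_ridges (curl f theta v) q rho (unit_dir (a *: theta + b *: v)).
Proof.
move=> fA rho0 qA; set u := _ + _ => u0; have u1 := enorm_unit_dir u0.
have c0 : enorm u != 0 by rewrite gt_eqF// enorm_gt0.
have Eu w h : smooth h -> curl f (unit_dir u) w h = (enorm u)^-1 * curl f u w h.
  by move=> sh; exact: curlZl.
move=> h sh rh th.
have K w : curl f u w h = 0.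
  have := @curl_kills_ridges A q rho (unit_dir u) w fA u1 rho0 qA h sh rh th.
  by rewrite Eu// => /eqP; rewrite mulf_eq0 invr_eq0 (negbTE c0) => /eqP.
have Kv : a * curl f theta v h = 0.
  by have := K v; rewrite /u (curl_combol f a theta _ v sh) (curlZl f b v v sh) curl_self mulr0 addr0.
have Kt : b * curl f theta v h = 0.
  have := K theta; rewrite /u (curl_combol f a theta _ theta sh) (curlZl f b v theta sh) curl_self.
  by rewrite mulr0 add0r curl_antisym mulrN => /eqP; rewrite oppr_eq0 => /eqP.
have [a0|a0] := eqVneq a 0; last first.
  by apply/eqP; move/eqP: Kv; rewrite mulf_eq0 (negbTE a0).
have [b0|b0] := eqVneq b 0; last first.
  by apply/eqP; move/eqP: Kt; rewrite mulf_eq0 (negbTE b0).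
by move: u0; rewrite /u a0 b0 !scale0r addr0 eqxx.
Qed.

(** The condition on h bounds its closed support, because the ball is closed. *)
Lemma curl_near A q r u w h :
  (forall i j, vanishes_on A (exterior_derivative f i j)) ->
  (forall y, `|y - q| <= r -> A y) -> smooth h ->
  (forall y, h y != 0 -> `|y - q| <= r) -> curl f u w h = 0.
Proof.
move=> dfA qA sh hq; rewrite curl_coord// big1// => i _; rewrite big1 ?mulr0// => j _.
rewrite (_ : _ - _ = exterior_derivative f i j h); last first.
  by rewrite /exterior_derivative /distr_partial opprK addrC.
pose B : set V := [set y | `|y - q| <= r].
have cB : closed B.
  rewrite (_ : B = (fun y => `|y - q|) @^-1` [set s | s <= r])//.
  apply: closed_comp; last exact: closed_le.
  move=> y _; apply: (@continuous_comp _ _ _ (fun y : V => y - q)); last exact: norm_continuous.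
  apply: differentiable_continuous.
  exact: (smooth_map_differentiable (@openT _) (smooth_map_subr q) I).
have sB : support_on setT h `<=` B.
  have [_ cl] := closure_id B; rewrite /support_on [X in _ `<=` X](closure_id B).1//.
  by apply: closure_subset => y [_ /= hy]; exact: hq.
rewrite dfA ?mulr0//; last by move=> y /sB; exact: qA.
apply: (@subclosed_compact _ _ (cball (r + `|q|))); first exact: closed_closure.
  exact: compact_cball.
move=> y /sB /= yr; rewrite /cball /= -[y](subrK q).
by rewrite (le_trans (ler_normD _ _))// lerD2r.
Qed.

End necessity.

(** * The exterior derivative vanishes everywhere *)

Section main.
Context (R : realType) (n : nat) (f : 'I_n -> cs_distribution R n) (A : set 'rV[R]_n).
Local Notation V := 'rV[R]_n.
Hypotheses (dfA : forall i j, vanishes_on A (exterior_derivative f i j))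
  (fA : xray_vanishes_on_lines_meeting f A).

(** Split w into its components along x - q and orthogonal to it: the first is
    killed by antisymmetry, the second spans with x - q a plane to which
    [moll_plane] applies. *)
Lemma curl_moll_radial (q : V) (rho eps : R) eta x w : 0 < eps -> (n%:R + 1) * eps <= rho ->
  (forall y, `|y - q| <= 2 * rho -> A y) -> smooth eta -> small_support eps eta ->
  moll (curl f (x - q) w) eta x = 0.
Proof.
move=> eps0 er qA se eeta; have sx := smooth_shift x se.
have rho_eps : eps <= rho.
  by apply: le_trans er; rewrite mulrDl mul1r lerDr mulr_ge0// ltW.
have rho0 : 0 < rho by exact: lt_le_trans rho_eps.
rewrite /moll; have [->|xq] := eqVneq x q; first by rewrite subrr curl0l//; exact: smooth_shift.
have xq0 : x - q != 0 by rewrite subr_eq0.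
pose t0 := enorm (x - q); pose theta := unit_dir (x - q).
have t00 : 0 < t0 by rewrite enorm_gt0.
have xE : x - q = t0 *: theta by rewrite /theta /unit_dir scalerA divff ?scale1r ?gt_eqF.
have th1 : dot theta theta = 1 by rewrite -enorm_sqr enorm_unit_dir// expr1n.
rewrite {1}xE curlZl//; pose w' := w - dot w theta *: theta.
have wE : w = dot w theta *: theta + w' by rewrite addrC subrK.
rewrite {1}wE curl_combor// curl_self mulr0 add0r.
have [->|w'0] := eqVneq w' 0; first by rewrite curl_antisym curl0l// oppr0 mulr0.
pose v := unit_dir w'; have c0 : 0 < enorm w' by rewrite enorm_gt0.
have w'E : w' = enorm w' *: v by rewrite /v /unit_dir scalerA divff ?scale1r ?gt_eqF.
have v1 : dot v v = 1 by rewrite -enorm_sqr enorm_unit_dir// expr1n.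
have thv : dot theta v = 0.
  by rewrite /v /unit_dir dotZr /w' dotDr dotNr dotZr th1 mulr1 (dotC theta w) subrr mulr0.
rewrite curl_antisym w'E curlZl// -mulrN -curl_antisym.
have := @moll_plane R n (curl f theta v) q eps rho theta v (curl_linear f theta v)
  (curl_order f theta v) eps0 er _ th1 v1 thv _ eta t0 (conj se eeta) t00.
rewrite /moll (_ : q + t0 *: theta = x); last by rewrite -xE addrC subrK.
move=> ->; [by rewrite !mulr0| |].
  have qA' y : `|y - q| <= 2 * eps -> A y.
    by move=> yq; apply: qA; apply: le_trans yq _; rewrite ler_pM2l.
  move=> h sh hq; exact: (@curl_near R n f A q (2 * eps) theta v h dfA qA' sh hq).
by move=> a b ab; exact: (curl_kills_plane_ridges fA rho0 qA ab).
Qed.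

(** The difference of [curl_moll_radial] at q = p + s u and at q = p. *)
Lemma curl_moll_eq0 : open A -> A !=set0 -> exists2 eps : R, 0 < eps &
  forall eta x u w, smooth eta -> small_support eps eta -> moll (curl f u w) eta x = 0.
Proof.
move=> oA [p Ap]; have [r r0 pA] := (nbhs_shiftP p A).1 (oA p Ap).
have n10 : 0 < n%:R + 1 :> R by rewrite ltr_wpDl.
pose rho := r / 4; pose eps := rho / (n%:R + 1).
have rho0 : 0 < rho by rewrite divr_gt0.
have eps0 : 0 < eps by rewrite divr_gt0.
exists eps => // eta x u w se eeta.
have er : (n%:R + 1) * eps <= rho by rewrite mulrC divfK// gt_eqF.
have sx := smooth_shift x se.
have qA q : `|q - p| <= rho -> forall y, `|y - q| <= 2 * rho -> A y.
  move=> qp y yq; rewrite -(subrK p y); apply: pA.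
  rewrite -(subrK q y) -addrA (le_lt_trans (ler_normD _ _))//.
  by apply: (@le_lt_trans _ _ (2 * rho + rho)); [exact: lerD|rewrite /rho; lra].
have rad q : `|q - p| <= rho -> curl f (x - q) w (fun y => eta (y - x)) = 0.
  by move=> qp; exact: (@curl_moll_radial q rho eps eta x w eps0 er (qA q qp) se eeta).
pose s := rho / (`|u| + 1).
have u10 : 0 < `|u| + 1 by rewrite ltr_wpDl.
have s0 : 0 < s by rewrite divr_gt0.
have E1 := rad p; have E2 := rad (p + s *: u).
rewrite /moll; apply: (mulfI (lt0r_neq0 s0)); rewrite mulr0.
rewrite -curlZl// (_ : s *: u = (-1) *: (x - (p + s *: u)) + (x - p)); last first.
  by apply/rowP => i; rewrite !mxE; ring.
rewrite curl_combol// E2 ?E1 ?mulr0 ?addr0//.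
- by rewrite subrr normr0 ltW.
- rewrite addrAC subrr add0r normrZ gtr0_norm// /s mulrAC ler_pdivrMr//.
  by rewrite ler_pM2l// lerDl.
Qed.

Lemma curl_eq0 : open A -> A !=set0 -> forall u w h, smooth h -> curl f u w h = 0.
Proof.
move=> oA A0 u w h sh; have [eps eps0 He] := curl_moll_eq0 oA A0.
apply: (vanish_of_small eps0 (curl_linear f u w) (curl_order f u w) _ sh).
by move=> eta x; exact: He.
Qed.

End main.

Theorem theorem1p2 (R : realType) (n : nat) (n_ge2 : (2 <= n)%N)
    (f : 'I_n -> cs_distribution R n) (V : set 'rV[R]_n)
    (V_open : open V) (V_nonempty : V !=set0)
    (df_V : forall i j : 'I_n, vanishes_on V (exterior_derivative f i j)) :
  xray_vanishes_on_lines_meeting f V <->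
  exists phi : cs_distribution R n, is_differential f phi.
Proof.
split=> [fV|[phi dphi] psi spsi _ _]; last exact: xray_of_differential dphi.
have n_gt0 : (0 < n)%N by exact: ltnW.
apply: (@closed_exact _ _ f (Ordinal n_gt0) (Ordinal n_ge2)) => // i j h sh.
apply/eqP; rewrite -subr_eq0 -curl_basis; apply/eqP.
exact: (curl_eq0 df_V fV V_open V_nonempty).
Qed.
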